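(* Let $A\in\mathbb{R}^{n\times n}$ and $\mu\ge0$ be such that $A_\mu=A+\mu I$ is symmetric positive definite, and let $\lambda_1,\dots,\lambda_n$ be the eigenvalues of $A$, ordered in decreasing magnitude. Let $d$ be such that $\lambda_d\le\lambda_n+\mu$, let $q\ge0$ be an integer, and let $X\in\mathbb{R}^{l\times n}$ be a Gaussian sketching matrix of size $l\ge2.4d+4$. Let $\Pi$ be the orthogonal projector onto $\mathrm{range}(A_\mu A^qX^{\mathrm T})$ and $$T=\left(\frac{\|(I-\Pi)A_\mu(I-\Pi)\|}{\lambda_n+\mu}\right)^{1/2}.$$ Then $$\mathbb{E}(T)\le1+\left(148\tfrac nd\right)^{\frac1{4q+4}} .$$ In addition, with probability $1-6^{-d}$, $$T\le1+\left(3240\tfrac nd\right)^{\frac1{4q+4}} .$$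
   Context: $\|\cdot\|$ is the spectral norm. A Gaussian matrix $X\in\mathbb{R}^{l\times n}$ has i.i.d. normal entries with mean $0$ and variance $l^{-1}$; the sketching dimension is taken with $l\ll n$. ($T$ is the constant in the bound $2\mathrm e^{-2t/T}$ on the relative error reduction after $t$ iterations of CG or MINRES applied to the system preconditioned by $P=A_\mu^{-1}((I-\Pi)A_\mu(I-\Pi)+\tau\Pi)$ with $\lambda_{\min}(A_\mu)\le\tau\le\|(I-\Pi)A_\mu(I-\Pi)\|$.)
   Formalization: The condition λ_d ≤ λ_n+μ is replaced by |λ_d| ≤ λ_n+μ (the same if λ_d ≥ 0 or λ_n ≥ 0); as written it fails, e.g. μ=1, d=1, l=7, spectrum −0.99, 0.95 (8 times), −0.9, q large; also 1 ≤ d ≤ n. *)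

(* Defs.v *)
From HB Require Import structures.
From mathcomp Require Import all_boot all_order all_algebra.
From mathcomp Require Import all_classical all_reals all_analysis.

Set Implicit Arguments.
Unset Strict Implicit.
Unset Printing Implicit Defensive.

Import Order.TTheory GRing.Theory Num.Theory.
Import numFieldNormedType.Exports.

Local Open Scope classical_set_scope.
Local Open Scope ring_scope.

Definition enorm (R : realType) (n : nat) (x : 'cV[R]_n) : R :=
  Num.sqrt (\sum_(i < n) x i 0 ^+ 2).

(* The norm instance that the library puts on matrices is the entrywise
   maximum, so the operator norm induced by [enorm] is defined here. *)
Definition spectral_norm (R : realType) (m n : nat) (A : 'M[R]_(m, n)) : R :=
  sup [set enorm (A *m x) | x in [set x : 'cV[R]_n | enorm x <= 1]].

Definition sym_posdef (R : realType) (n : nat) (A : 'M[R]_n) : Prop :=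
  A^T = A /\ forall x : 'cV[R]_n, x != 0 -> 0 < (x^T *m A *m x) 0 0.

(* [lambda] lists the eigenvalues with multiplicity; the k-th eigenvalue is
   [nth 0 lambda k.-1]. *)
Definition eigenvalues_decr_magnitude (R : realType) (n : nat)
    (A : 'M[R]_n) (lambda : n.-tuple R) : Prop :=
  char_poly A = \prod_(x <- lambda) ('X - x%:P) /\
  sorted (fun x y : R => `|y| <= `|x|) lambda.

(* [%MS] compares row spaces, hence the transposes: the range of a matrix
   acting on column vectors is its column space. *)
Definition orthogonal_projector_onto_range (R : realType) (n m : nat)
    (Pi : 'M[R]_n) (M : 'M[R]_(n, m)) : Prop :=
  [/\ Pi^T = Pi, Pi *m Pi = Pi & (Pi^T == M^T)%MS].

Definition mutually_independent d (Omega : measurableType d) (R : realType)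
    (P : probability Omega R) (I : finType) (Y : I -> Omega -> R) : Prop :=
  forall (J : {set I}) (B : I -> set R), (forall i, measurable (B i)) ->
    P (\bigcap_(i in [set` J]) (Y i @^-1` B i)) =
    (\prod_(i in J) P (Y i @^-1` B i))%E.

(* The second argument of [normal_prob] is the standard deviation. *)
Definition gaussian_sketch d (Omega : measurableType d) (R : realType)
    (P : probability Omega R) (l n : nat) (X : Omega -> 'M[R]_(l, n)) : Prop :=
  [/\ forall i j, measurable_fun [set: Omega] (fun w => X w i j),
      forall i j (B : set R), measurable B ->
        P ((fun w => X w i j) @^-1` B) =
        normal_prob 0 (Num.sqrt (l%:R^-1 : R)) B &
      mutually_independent P (fun ij : 'I_l * 'I_n => fun w => X w ij.1 ij.2)].

Section ProjectorExistence.
Variables (R : realType).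

Let gram_eq0 n k (B : 'M[R]_(n, k)) (v : 'rV[R]_k) :
  v *m (B^T *m B) = 0 -> v *m B^T = 0.
Proof.
move=> v0; have : (v *m B^T) *m (v *m B^T)^T = 0.
  by rewrite trmx_mul trmxK mulmxA -(mulmxA v) v0 mul0mx.
move=> /matrixP/(_ 0 0); rewrite !mxE => /eqP; rewrite psumr_eq0; last first.
  by move=> i _; rewrite [_^T _ _]mxE -expr2 sqr_ge0.
move=> /allP h; apply/rowP => j; rewrite [RHS]mxE.
have /= := h j (mem_index_enum _).
by rewrite [_^T _ _]mxE -expr2 sqrf_eq0 => /eqP.
Qed.

Lemma orthogonal_projector_exists n m (M : 'M[R]_(n, m)) :
  exists Pi, orthogonal_projector_onto_range Pi M.
Proof.
set B := (row_base M^T)^T.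
have BT : B^T = row_base M^T by rewrite /B trmxK.
have Bfree : row_free B^T by rewrite BT row_base_free.
have Gu : B^T *m B \in unitmx.
  rewrite -row_free_unit -kermx_eq0; apply/eqP/row_matrixP => i.
  rewrite row0; have : row i (kermx (B^T *m B)) *m (B^T *m B) = 0.
    by rewrite -row_mul mulmx_ker row0.
  move=> /gram_eq0 h; apply: (row_free_inj Bfree).
  by rewrite h mul0mx.
set G := B^T *m B in Gu *.
have GT : G^T = G by rewrite /G trmx_mul trmxK.
exists (B *m invmx G *m B^T).
have sym : (B *m invmx G *m B^T)^T = B *m invmx G *m B^T.
  by rewrite !trmx_mul trmxK trmx_inv GT mulmxA.
split=> //.
  by rewrite !mulmxA -(mulmxA _ B^T B) -/G mulmxKV.
rewrite sym; apply/andP; split.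
  by rewrite (submx_trans (submxMl _ _))// BT eq_row_base.
have := submxMl (B^T) (B *m invmx G *m B^T).
have -> : B^T *m (B *m invmx G *m B^T) = B^T.
  by rewrite !mulmxA -/G mulmxV ?mul1mx.
by rewrite {1}BT; apply: submx_trans; rewrite eq_row_base.
Qed.

End ProjectorExistence.

(* Main.v *)
(** Write [A = U diag(lambda) U^T], [k = d - 1], [m = ceil(k/2)], and split the
    standard Gaussian matrix [Z = sqrt(l) X U] after its first [k] columns as
    [Z = (Z1 | Z2)]. A vector [u] with [Pi u = 0] satisfies [Z w = 0] for
    [w_i = (lambda_i + mu) lambda_i^q (U^T u)_i]. If the head [w1] and the tail
    [w2] of every kernel vector satisfy [|w1|^2m <= rho |w2|^2m], then a power
    mean inequality bounds the quadratic form of [A_mu] on the kernel of [Pi]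
    and gives [T <= 1 + y] whenever [y >= 1] and
    [(9/4)^m rho <= y^((4q+4)m)].

    On the kernel, [w1 = - (Z1^T Z1)^-1 Z1^T Z2 w2]. Testing [w1] against an
    independent Gaussian vector [b], Cauchy-Schwarz and the even Gaussian moments
    show that [rho = E_b |Z2^T Z1 (Z1^T Z1)^-1 b|^2m / (2m-1)!!] is admissible.
    By rotation invariance its expectation is at most
    [(k+2m)^m (n-k+2m)^m / (2m)!]: the norm of a column of
    [Z1 (Z1^T Z1)^-1] is the inverse distance of a column of [Z1] to the span of
    the others, and the chi-square law with [2m+2] degrees of freedom has
    [m]-th negative moment [1/(2^m m!)]. This is at most [(40 n/d)^m / 6];
    Markov's inequality gives the tail bound, and Bernoulli's inequality, which
    linearizes the root, gives the expectation. *)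

Require Import Defs.
From HB Require Import structures.
From mathcomp Require Import all_boot all_order all_algebra.
From mathcomp Require Import all_classical all_reals all_analysis.
From mathcomp Require Import measurable_realfun.
From mathcomp Require Import ring lra zify.

Set Implicit Arguments.
Unset Strict Implicit.
Unset Printing Implicit Defensive.

Import Order.TTheory GRing.Theory Num.Theory.
Import numFieldNormedType.Exports.

Local Open Scope classical_set_scope.
Local Open Scope ring_scope.

(** * One-dimensional Gaussian integrals *)

(** The estimate has to hold for all kernel vectors at once, which points to the operator norm of
    [Z2^T Z1 (Z1^T Z1)^-1], whose moments are not directly accessible. Averaging over the test
    vector [b] replaces this norm by single vectors, and these can be rotated onto a coordinate
    axis. Since [m >= k/2], the average exceeds the [2m]-th power of the norm by at most a constant
    to the power [m]. A moment of order proportional to [d] is also what Markov's inequality needs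
    for a failure probability [6^-d].

    Independence is used by resampling: a Gaussian law is determined by its values on boxes, so
    separate blocks of a matrix may be read off from separate points of a product space, and
    Tonelli's theorem applies.

    The constant [9/4] is [3^2], from [|lambda_i + mu| <= 3 (lambda_n + mu)] on the tail, times
    [1/4], from [c s <= (c + s)^2 / 4]. Then [3240 = 9/4 * 40 * 6^2], where [6^2] per moment pays
    for the probability. The condition [y >= 1] enters through [3 + y^2 <= (1 + y)^2]. *)

Definition image_measure d1 d2 (T1 : measurableType d1) (T2 : measurableType d2)
  (R : realType) (m : {measure set T1 -> \bar R}) (f : T1 -> T2)
  (mf : measurable_fun setT f) : {measure set T2 -> \bar R}.
Proof. by refine (pushforward m f : {measure set T2 -> \bar R}). Defined.

Section affine_change.
Variable R : realType.
Notation leb := (@lebesgue_measure R).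

Lemma measurable_affine (a b : R) :
  measurable_fun setT ((fun x => a * x + b) : measurableTypeR R -> measurableTypeR R).
Proof. by apply: measurable_funD => //; apply: measurable_funM. Qed.

(** By uniqueness of Lebesgue measure: [|a|] times its image under the affine map agrees with it on
    half-open intervals. *)
Lemma lebesgue_measure_affine (a b : R) (A : set (measurableTypeR R)) :
  a != 0 -> measurable A ->
  leb ((fun x => a * x + b) @^-1` A) = (`|a|^-1%:E * leb A)%E.
Proof.
move=> a0 mA.
have na0 : 0 < `|a| by rewrite normr_gt0.
pose phi : measurableTypeR R -> measurableTypeR R := fun x => a * x + b.
have mphi : measurable_fun setT phi by exact: measurable_affine.
pose m := mscale (NngNum (ltW na0)) (image_measure leb mphi).
have : leb A = m A.
  apply: lebesgue_measure_unique => // X [[u v]] _ <-.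
  rewrite -[RHS]/(`|a|%:E * leb (phi @^-1` `]u, v]))%E.
  have [an|ap|a00] := ltgtP a 0; last by move/eqP: a0.
  - have -> : phi @^-1` `]u, v]%classic = `[(v - b) / a, (u - b) / a[%classic.
      apply/seteqP; split => x /=; rewrite /phi !in_itv/= ler_ndivrMr// ltr_ndivlMr// (mulrC x) => /andP[? ?]; apply/andP; split; lra.
    rewrite !lebesgue_measure_itv/= !lte_fin ltr_ndivlMr// divfK// ltrD2r.
    case: ifP => // uv; last by rewrite mule0.
    rewrite -EFinB -EFinM ltr0_norm// -mulrBl; congr EFin; field.
    by rewrite lt_eqF.
  - have -> : phi @^-1` `]u, v]%classic = `](u - b) / a, (v - b) / a]%classic.
      apply/seteqP; split => x /=; rewrite /phi !in_itv/= ltr_pdivrMr// ler_pdivlMr// (mulrC x) => /andP[? ?]; apply/andP; split; lra.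
    rewrite !lebesgue_measure_itv/= !lte_fin ltr_pdivrMr// divfK ?gt_eqF// ltrD2r.
    case: ifP => // uv; last by rewrite mule0.
    rewrite -EFinB -EFinM gtr0_norm// -mulrBl; congr EFin; field.
    by rewrite gt_eqF.
move=> ->; rewrite /m /mscale/= muleA -EFinM mulVf ?gt_eqF// mul1e.
by [].
Qed.

Lemma ge0_integral_affine (a b : R) (f : R -> \bar R) :
  a != 0 -> measurable_fun setT f -> (forall x, 0 <= f x)%E ->
  (\int[leb]_x f (a * x + b)%R = `|a|^-1%:E * \int[leb]_x f x)%E.
Proof.
move=> a0 mf f0.
have na0 : 0 <= `|a|^-1 by rewrite invr_ge0.
pose phi : measurableTypeR R -> measurableTypeR R := fun x => a * x + b.
have mphi : measurable_fun setT phi by exact: measurable_affine.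
have := @ge0_integral_pushforward _ _ _ _ R phi mphi leb setT f measurableT mf (fun x _ => f0 x).
rewrite preimage_setT => <-.
rewrite -[RHS](@ge0_integral_mscale _ _ _ leb setT measurableT (NngNum na0) f)//.
apply: (@eq_measure_integral _ _ _ setT (mscale (NngNum na0) leb) (image_measure leb mphi)) => A mA _.
by rewrite /mscale/= /pushforward lebesgue_measure_affine.
Qed.

End affine_change.

Section normal_integral.
Variable R : realType.
Notation leb := (@lebesgue_measure R).

(** The Radon-Nikodym derivative of the normal law is known only almost everywhere; it agrees with
    the density because both integrate to the law on every measurable set. *)
Lemma ge0_integral_normal_prob (m s : R) (f : R -> \bar R) :
  measurable_fun setT f -> (forall x, 0 <= f x)%E ->
  (\int[normal_prob m s]_x f x = \int[leb]_x (f x * (normal_pdf m s x)%:E))%E.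
Proof.
move=> mf f0.
have dom := @normal_prob_dominates R m s.
rewrite -(@Radon_Nikodym_SigmaFinite.change_of_variables _ _ _ (normal_prob m s) leb dom f)//.
apply: ae_eq_integral => //.
- apply: emeasurable_funM => //.
  exact: measurable_int (Radon_Nikodym_SigmaFinite.f_integrable dom).
- apply: emeasurable_funM => //; apply/measurable_EFinP.
  exact: measurable_normal_pdf.
- apply: ae_eqe_mul2l.
  apply: integral_ae_eq => //.
  + exact: Radon_Nikodym_SigmaFinite.f_integrable.
  + by apply/measurable_EFinP; exact: measurable_normal_pdf.
  + by move=> A _ mA; rewrite -Radon_Nikodym_SigmaFinite.f_integral.
Qed.

End normal_integral.

(** * Rotation invariance of the planar Gaussian law *)

Section planar_rotation.
Variable R : realType.
Local Opaque normal_prob normal_pdf.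
Notation leb := (@lebesgue_measure R).
Notation gamma := (normal_prob (0 : R) (1 : R)).
Notation phi := (normal_pdf (0 : R) (1 : R)).

Lemma std_normal_pdfE x : phi x = normal_peak 1 * expR (- (x ^+ 2 / 2)).
Proof.
by rewrite normal_pdfE ?oner_eq0// /normal_fun subr0 expr1n mulNr.
Qed.

Lemma std_normal_pdf_rotate (c s x y : R) : c ^+ 2 + s ^+ 2 = 1 ->
  phi (c * x - s * y) * phi (s * x + c * y) = phi x * phi y.
Proof.
move=> cs; rewrite !std_normal_pdfE mulrACA [RHS]mulrACA -!expRD; congr (_ * expR _).
rewrite -!opprD -!mulrDl; congr (- (_ / _)).
transitivity ((c ^+ 2 + s ^+ 2) * (x ^+ 2 + y ^+ 2)); first by ring.
by rewrite cs mul1r.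
Qed.

Lemma normal_pdf_scale (s x : R) : 0 < s ->
  normal_pdf 0 s x = s^-1 * phi (x / s).
Proof.
move=> s0; rewrite std_normal_pdfE normal_pdfE ?gt_eqF// /normal_fun subr0 mulrA.
congr (_ * expR _); last first.
  by rewrite -mulr_natr; field; rewrite gt_eqF.
rewrite /normal_peak expr1n mul1r -[s ^+ 2 * pi *+ 2]mulrnAr sqrtrM ?sqr_ge0//.
by rewrite sqrtr_sqr gtr0_norm// invfM.
Qed.

(** Turns the entries of the sketch, of standard deviation [Num.sqrt l^-1], into standard normal
    ones. *)
Lemma normal_prob_scale (s : R) (B : set R) : 0 < s -> measurable B ->
  normal_prob 0 s ((fun x => s^-1 * x) @^-1` B) = gamma B.
Proof.
move=> s0 mB.
have ms : measurable_fun setT (fun x : R => s^-1 * x).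
  exact: mulrl_measurable.
have mB' : measurable ((fun x => s^-1 * x) @^-1` B).
  by rewrite -[X in measurable X]setTI; exact: ms.
have mI (r : R) (A : set R) : measurable A ->
    normal_prob 0 r A = (\int[normal_prob 0 r]_x (\1_A x)%:E)%E.
  by move=> mA; rewrite integral_indic// setIT.
rewrite (mI s _ mB') (mI 1 _ mB).
have m1 : measurable_fun setT (fun x : R => (\1_B x : R)%:E).
  exact/measurable_EFinP.
have m2 : measurable_fun setT (fun x : R => (\1_((fun x => s^-1 * x) @^-1` B) x : R)%:E).
  exact/measurable_EFinP.
rewrite (ge0_integral_normal_prob _ _ m1) ?(ge0_integral_normal_prob _ _ m2); last 2 first.
- by move=> x; rewrite lee_fin.
- by move=> x; rewrite lee_fin.
pose f (y : R) := ((\1_B y)%:E * (s^-1 * phi y)%:E)%E.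
transitivity (\int[leb]_x f (s^-1 * x + 0)%R)%E.
  apply: eq_integral => x _; rewrite /f addr0 normal_pdf_scale// (mulrC x).
  by rewrite !indicE.
rewrite ge0_integral_affine ?invr_eq0 ?gt_eqF//; last first.
- by move=> x; rewrite /f -EFinM lee_fin !mulr_ge0// ?invr_ge0 ?(ltW s0)// normal_pdf_ge0.
- rewrite /f; apply: emeasurable_funM; apply/measurable_EFinP => //.
  by apply: measurable_funM => //; exact: measurable_normal_pdf.
rewrite gtr0_norm ?invr_gt0// invrK -ge0_integralZl//; last 3 first.
- rewrite /f; apply: emeasurable_funM; apply/measurable_EFinP => //.
  by apply: measurable_funM => //; exact: measurable_normal_pdf.
- by move=> x _; rewrite /f -EFinM lee_fin !mulr_ge0// ?invr_ge0 ?(ltW s0)// normal_pdf_ge0.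
- by rewrite lee_fin ltW.
by apply: eq_integral => x _; rewrite /f muleCA -EFinM mulVKf ?gt_eqF.
Qed.

Lemma ge0_integral_gaussN (f : R -> \bar R) :
  measurable_fun setT f -> (forall x, 0 <= f x)%E ->
  (\int[gamma]_x f (- x)%R = \int[gamma]_x f x)%E.
Proof.
move=> mf f0; rewrite !ge0_integral_normal_prob//; last first.
  exact: measurableT_comp.
pose g x := (f x * (phi x)%:E)%E.
transitivity (\int[leb]_x g ((-1) * x + 0)%R)%E.
  apply: eq_integral => x _; rewrite /g addr0 mulN1r; congr (_ * _%:E)%E.
  by rewrite !std_normal_pdfE sqrrN.
rewrite ge0_integral_affine ?oppr_eq0 ?oner_eq0//.
- by rewrite normrN1 invr1 mul1e.
- by apply: emeasurable_funM => //; apply/measurable_EFinP; exact: measurable_normal_pdf.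
- by move=> x; rewrite /g mule_ge0// lee_fin normal_pdf_ge0.
Qed.

(** The rotation is factored into two one-variable affine substitutions, with Tonelli's theorem in
    between: [u = c x + s y] at fixed [y], then [v = (y - s u) / c] at fixed [u]. The Jacobian
    factors [|c|^-1] and [|c|] cancel. The case [c = 0] is recovered later by composing two
    rotations. *)
Lemma gauss_rotate (c s : R) (h : R * R -> \bar R) : c != 0 ->
  c ^+ 2 + s ^+ 2 = 1 -> measurable_fun setT h -> (forall z, 0 <= h z)%E ->
  (\int[gamma]_x \int[gamma]_y h (c * x + s * y, - s * x + c * y)%R
   = \int[gamma]_x \int[gamma]_y h (x, y))%E.
Proof.
move=> c0 cs mh h0.
have c20 : c * c != 0 by rewrite mulf_neq0.
have ci : c^-1 = c + s ^+ 2 / c by rewrite -[LHS]mul1r -cs; field.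
have mphi : measurable_fun setT (phi : R -> R) by exact: measurable_normal_pdf.
have phi0 x : 0 <= phi x by exact: normal_pdf_ge0.
have mlin (a b : R) : measurable_fun setT (fun z : R * R => a * z.1 + b * z.2).
  by apply: measurable_funD; apply: measurable_funM => //.
have mpl (a b : R) : measurable_fun setT (fun z : R * R => phi (a * z.1 + b * z.2)).
  by apply: measurableT_comp => //; exact: mlin.
have mhl (a b a' b' : R) : measurable_fun setT
    (fun z : R * R => h (a * z.1 + b * z.2, a' * z.1 + b' * z.2)%R).
  by apply: measurableT_comp => //; apply/measurable_fun_pair; exact: mlin.
(* All integrands below have this shape, so measurability is shown once: [a b a' b'] are the
   coefficients in the arguments of [h], and [a1 b1 a2 b2] those in the two densities. *)
pose K a b a' b' a1 b1 a2 b2 : R * R -> \bar R := fun z : R * R =>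
  (h (a * z.1 + b * z.2, a' * z.1 + b' * z.2)%R *
   (phi (a1 * z.1 + b1 * z.2) * phi (a2 * z.1 + b2 * z.2))%:E)%E.
have mK a b a' b' a1 b1 a2 b2 : measurable_fun setT (K a b a' b' a1 b1 a2 b2).
  apply: emeasurable_funM; first exact: mhl.
  by apply/measurable_EFinP/measurable_funM; exact: mpl.
have K0 a b a' b' a1 b1 a2 b2 z : (0 <= K a b a' b' a1 b1 a2 b2 z)%E.
  by rewrite mule_ge0// lee_fin mulr_ge0.
have step a b a' b' :
  (\int[gamma]_x \int[gamma]_y h (a * x + b * y, a' * x + b' * y)%R =
   \int[leb]_x \int[leb]_y (K a b a' b' 1 0 0 1)%R (x, y))%E.
  rewrite ge0_integral_normal_prob//; last 2 first.
  - pose H := (fun z : R * R => h (a * z.1 + b * z.2, a' * z.1 + b' * z.2)%R).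
    by apply: (@measurable_fun_fubini_tonelli_F _ _ _ _ _ gamma H); [exact: mhl|move=> z; exact: h0].
  - by move=> x; apply: integral_ge0.
  apply: eq_integral => x _.
  rewrite ge0_integral_normal_prob//; last first.
    exact: measurable_fun_pair2 (mhl a b a' b').
  rewrite -ge0_integralZr//; last 3 first.
  - apply: emeasurable_funM; last exact/measurable_EFinP.
    exact: measurable_fun_pair2 (mhl a b a' b').
  - by move=> y _; rewrite mule_ge0// lee_fin.
  - by rewrite lee_fin.
  apply: eq_integral => y _; rewrite /K/= mul1r !mul0r addr0 add0r mul1r.
  by rewrite -muleA -EFinM (mulrC (phi y)).
rewrite [LHS]step (@fubini_tonelli _ _ _ _ _ leb leb (K c s (- s) c 1 0 0 1) (mK _ _ _ _ _ _ _ _) (K0 _ _ _ _ _ _ _ _)).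
pose K1 := K 0 1 c^-1 (- s / c) 1 0 (- s / c) c^-1.
have mK1 : measurable_fun setT K1 by exact: mK.
have K10 z : (0 <= K1 z)%E by exact: K0.
transitivity (\int[leb]_y (`|c|^-1%:E * \int[leb]_u K1 (y, u)))%E.
  apply: eq_integral => y _.
  pose k u := K1 (y, u).
  have mk : measurable_fun setT k.
    by exact: (@measurable_fun_pair2 _ _ _ _ _ _ _ y mK1).
  have k0 u : (0 <= k u)%E by exact: K0.
  rewrite -[RHS](ge0_integral_affine (s * y) c0 mk k0).
  apply: eq_integral => x _; rewrite /k /K1 /K/=; congr (h (_, _) * _%:E)%E.
  - by ring.
  - transitivity ((c + s ^+ 2 / c) * y + (- s / c) * (c * x + s * y)); first by field.
    by rewrite -ci; ring.
  - by rewrite mulrC; congr (_ * _); apply: f_equal; field.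
rewrite ge0_integralZl; last 4 first.
- exact: measurableT.
- exact: (@measurable_fun_fubini_tonelli_F _ _ _ _ _ leb K1 mK1 K10).
- by move=> x _; apply: integral_ge0 => z _; exact: K10.
- by rewrite lee_fin invr_ge0.
rewrite (@fubini_tonelli _ _ _ _ _ leb leb K1 mK1 K10).
rewrite -ge0_integralZl; last 4 first.
- exact: measurableT.
- exact: (@measurable_fun_fubini_tonelli_G _ _ _ _ _ leb K1 mK1 K10).
- by move=> x _; apply: integral_ge0 => z _; exact: K10.
- by rewrite lee_fin invr_ge0.
have -> : (\int[gamma]_x \int[gamma]_y h (x, y) =
   \int[leb]_x \int[leb]_y (K 1 0 0 1 1 0 0 1)%R (x, y))%E.
  rewrite -step; apply: eq_integral => x _; apply: eq_integral => y _.
  by rewrite !mul0r !mul1r addr0 add0r.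
apply: eq_integral => u _.
pose G v := K 1 0 0 1 1 0 0 1 (u, v).
have -> : (\int[leb]_y K1 (y, u) =
  \int[leb]_y G (c^-1 * y + (- s / c) * u)%R)%E.
  apply: eq_integral => y _; rewrite /G /K1 /K/= !mul0r !mul1r !addr0 !add0r; congr (_ * _%:E)%E.
  rewrite -(std_normal_pdf_rotate u _ cs) mulrC; congr (_ * _); apply: f_equal.
    transitivity ((c + s ^+ 2 / c) * u + (- s / c) * y); first by rewrite -ci; ring.
    by field.
  by field.
have mG : measurable_fun setT G.
  by exact: (@measurable_fun_pair2 _ _ _ _ _ _ _ u (mK 1 0 0 1 1 0 0 1)).
have G0 v : (0 <= G v)%E by exact: K0.
have ci0 : c^-1 != 0 by rewrite invr_eq0.
rewrite (ge0_integral_affine (- s / c * u) ci0 mG G0).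
by rewrite muleA -EFinM normfV invrK mulVf ?normr_eq0// mul1e.
Qed.

End planar_rotation.

(** * Even moments of the standard normal law *)

Section gauss_moments.
Variable R : realType.
Notation leb := (@lebesgue_measure R).
Notation gamma := (normal_prob (0 : R) (1 : R)).
Notation phi := (normal_pdf (0 : R) (1 : R)).

(** The integrand times the standard density is [s] times the normal density of standard deviation
    [s = (1 - 2t)^(-1/2)]. *)
Lemma gauss_mgf_sqr (t : R) : t < 1 / 2 ->
  (\int[gamma]_x (expR (t * x ^+ 2))%:E)%E = ((Num.sqrt (1 - 2 * t))^-1)%:E.
Proof.
move=> t12; have p0 : 0 < 1 - 2 * t by lra.
set s := (Num.sqrt (1 - 2 * t))^-1.
have s0 : 0 < s by rewrite invr_gt0 sqrtr_gt0.
have mf : measurable_fun setT (fun x : R => (expR (t * x ^+ 2))%:E).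
  apply/measurable_EFinP; apply: measurableT_comp => //.
  by apply: measurable_funM => //; exact: measurable_funX.
rewrite (ge0_integral_normal_prob _ _ mf); last first.
  by move=> x; rewrite lee_fin expR_ge0.
transitivity (\int[leb]_x (s%:E * (normal_pdf 0 s x)%:E))%E.
  apply: eq_integral => x _; rewrite -!EFinM; congr EFin.
  rewrite (normal_pdf_scale _ s0) mulVKf ?gt_eqF// !std_normal_pdfE mulrCA -expRD.
  congr (_ * expR _).
  have -> : (x / s) ^+ 2 = x ^+ 2 * (1 - 2 * t).
    by rewrite /s invrK exprMn sqr_sqrtr// ltW.
  by field.
rewrite ge0_integralZl; last 4 first.
- exact: measurableT.
- apply/measurable_EFinP; exact: measurable_normal_pdf.
- by move=> x _; rewrite lee_fin normal_pdf_ge0.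
- by rewrite lee_fin ltW.
by rewrite integral_normal_pdf mule1.
Qed.

Lemma integral_gauss_cst (r : R) : (\int[gamma]_x r%:E)%E = r%:E.
Proof.
rewrite (integral_cst _ measurableT); transitivity (r%:E * 1)%E; last by rewrite mule1.
by congr (_ * _)%E; exact: (@probability_setT _ _ _ (normal_prob 0 1)).
Qed.

(** The double factorial [(2m-1)!!], the [2m]-th moment of the standard normal law. *)
Definition odd_fact (m : nat) : nat := \prod_(j < m) (2 * j + 1).

Lemma odd_factS m : odd_fact m.+1 = (odd_fact m * (2 * m + 1))%N.
Proof. by rewrite /odd_fact big_ord_recr. Qed.

Lemma odd_fact_gt0 m : (0 < odd_fact m)%N.
Proof. by apply: prodn_gt0 => i; rewrite addn1. Qed.

Lemma fact_odd_fact m : ((2 * m)`! = 2 ^ m * m`! * odd_fact m)%N.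
Proof.
elim: m => [|m IH]; first by rewrite /odd_fact big_ord0.
rewrite mulnS add2n !factS IH odd_factS expnS.
nia.
Qed.

(** Closes the induction for the even moments: with double factorials inserted for the lower
    moments, the sum over [j] becomes the binomial expansion of [2^m]. *)
Lemma odd_fact_bin m j : (j <= m)%N ->
  ('C(2 * m, 2 * j) * (odd_fact j * odd_fact (m - j)) = 'C(m, j) * odd_fact m)%N.
Proof.
move=> jm.
have h1 : ('C(2 * m, 2 * j) * ((2 * j)`! * (2 * (m - j))`!) = (2 * m)`!)%N.
  by rewrite mulnBr bin_fact// leq_pmul2l.
have h2 := bin_fact jm.
have e : (2 ^ m = 2 ^ j * 2 ^ (m - j))%N by rewrite -expnD subnKC.
move: h1; rewrite !fact_odd_fact -h2 e => h.
have p : (0 < 2 ^ j * 2 ^ (m - j) * (j`! * (m - j)`!))%N.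
  by rewrite !muln_gt0 !expn_gt0 !fact_gt0.
apply/eqP; rewrite -(eqn_pmul2l p); apply/eqP.
by move: h; move: (2 ^ j)%N (2 ^ (m - j))%N j`! (m - j)`! => a b c d; nia.
Qed.

Lemma sum_even_odd (F : nat -> R) m :
  \sum_(i < (2 * m).+1) F i =
  \sum_(j < m.+1) F (2 * j)%N + \sum_(j < m) F (2 * j).+1.
Proof.
elim: m => [|m IH]; first by rewrite muln0 !big_ord_recr !big_ord0 /=; ring.
rewrite mulnS add2n !big_ord_recr/= in IH *.
by rewrite IH mulnS add2n; ring.
Qed.

Lemma sum_pow_even (x y : R) m :
  (x + y) ^+ (2 * m) + (- x + y) ^+ (2 * m) =
  2 * \sum_(j < m.+1) 'C(2 * m, 2 * j)%:R * (x ^+ (2 * j) * y ^+ (2 * (m - j))).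
Proof.
rewrite addrC (addrC x) (addrC (- x)) !exprDn -big_split/=.
pose F (i : nat) : R := y ^+ (2 * m - i) * (- x) ^+ i *+ 'C(2 * m, i) + y ^+ (2 * m - i) * x ^+ i *+ 'C(2 * m, i).
rewrite (sum_even_odd F) [X in _ + X]big1 ?addr0; last first.
  by move=> j _; rewrite /F -mulrnDl -mulrDr (exprS (- x)) (exprS x) (exprM (- x)) sqrrN -exprM mulNr addNr mulr0 mul0rn.
rewrite mulr_sumr; apply: eq_bigr => j _.
have e : (- x) ^+ (2 * j) = x ^+ (2 * j) by rewrite exprM sqrrN -exprM.
rewrite /F e -mulnBr; move: (x ^+ _) (y ^+ _) 'C(_, _) => a b c.
by rewrite -[b * a *+ c]mulr_natr; ring.
Qed.

Lemma measurable_exprn_EFin (m : nat) : measurable_fun setT (fun x : R => (x ^+ m)%:E).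
Proof. by apply/measurable_EFinP; exact: measurable_funX. Qed.

(** Integrating [1 - t x^2 <= exp(- t x^2)] gives [1 <= t mu1 + (1 + 2t)^(-1/2)], which for small
    [t] excludes [mu1 < 1]. *)
Lemma gauss_second_moment : (1 <= \int[gamma]_x (x ^+ 2)%:E)%E.
Proof.
set mu1 := (\int[gamma]_x _)%E.
have mu10 : (0 <= mu1)%E by apply: integral_ge0 => x _; rewrite lee_fin sqr_ge0.
have key (t : R) : 0 < t -> (1 <= t%:E * mu1 + ((Num.sqrt (1 + 2 * t))^-1)%:E)%E.
  move=> t0.
  have -> : ((Num.sqrt (1 + 2 * t))^-1)%:E = (\int[gamma]_x (expR (- t * x ^+ 2))%:E)%E.
    by rewrite gauss_mgf_sqr ?mulrN ?opprK//; lra.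
  have m2 := measurable_exprn_EFin 2.
  have me : measurable_fun setT (fun x : R => (expR (- t * x ^+ 2))%:E).
    apply/measurable_EFinP; apply: measurableT_comp => //.
    by apply: measurable_funM => //; exact: measurable_funX.
  rewrite /mu1 -ge0_integralZl; last 4 first.
  - exact: measurableT.
  - exact: m2.
  - by move=> x _; rewrite lee_fin sqr_ge0.
  - by rewrite lee_fin ltW.
  rewrite -ge0_integralD; last 5 first.
  - exact: measurableT.
  - by move=> x _; rewrite -EFinM lee_fin mulr_ge0 ?sqr_ge0// ltW.
  - by apply: emeasurable_funM.
  - by move=> x _; rewrite lee_fin expR_ge0.
  - exact: me.
  have -> : (1 = \int[gamma]_x (cst 1 x))%E.
    by rewrite integral_gauss_cst.
  apply: ge0_le_integral => //.
  - by apply: emeasurable_funD => //; apply: emeasurable_funM.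
  - move=> x _; rewrite -EFinM -EFinD lee_fin.
    by have := expR_ge1Dx (- t * x ^+ 2); rewrite mulNr; lra.
case E : mu1 mu10 key => [r| |] // r0 key; last by rewrite leey.
rewrite lee_fin; rewrite leNgt; apply/negP => r1.
(* With this choice [r = 1 - 3t], and [(1 + 2t)^(-1/2) <= 1 - t + 3/2 t^2] turns [key] into
   [1 <= 1 - 3/2 t^2]. *)
pose t := (1 - r) / 3.
have t0 : 0 < t by rewrite /t; lra.
have := key t t0; rewrite -EFinM -EFinD lee_fin.
have p0 : 0 < 1 + 2 * t by lra.
have : (Num.sqrt (1 + 2 * t))^-1 <= 1 - t + 3 / 2 * t ^+ 2.
  have q0 : 0 < 1 - t + 3 / 2 * t ^+ 2 by rewrite /t; nra.
  rewrite -[leRHS]invrK lef_pV2 ?posrE ?invr_gt0 ?sqrtr_gt0//.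
  rewrite -(@ler_pXn2r _ 2) ?nnegrE ?invr_ge0 ?sqrtr_ge0 ?(ltW q0)//.
  rewrite sqr_sqrtr ?(ltW p0)// exprVn -[leLHS]mul1r ler_pdivrMr ?exprn_gt0//.
  have -> : (1 + 2 * t) * (1 - t + 3 / 2 * t ^+ 2) ^+ 2 =
    1 + t ^+ 3 * (5 - 15 / 4 * t + 9 / 2 * t ^+ 2) by field.
  by rewrite lerDl mulr_ge0 ?exprn_ge0 ?(ltW t0)//; nra.
have : r = 1 - 3 * t by rewrite /t; field.
nra.
Qed.

Lemma ge0_iter_integral_sum (I : Type) (s : seq I) (F : I -> R * R -> \bar R) :
  (forall i, measurable_fun setT (F i)) -> (forall i z, 0 <= F i z)%E ->
  (\int[gamma]_x \int[gamma]_y (\sum_(i <- s) F i (x, y)) =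
   \sum_(i <- s) \int[gamma]_x \int[gamma]_y F i (x, y))%E.
Proof.
move=> mF F0.
transitivity (\int[gamma]_x (\sum_(i <- s) \int[gamma]_y F i (x, y)))%E.
  apply: eq_integral => x _; apply: ge0_integral_sum => //.
  by move=> i; apply: (@measurable_fun_pair2 _ _ _ _ _ _ _ x (mF i)).
apply: ge0_integral_sum => //.
- by move=> i; exact: (@measurable_fun_fubini_tonelli_F _ _ _ _ _ gamma (F i) (mF i) (F0 i)).
- by move=> i x _; apply: integral_ge0.
Qed.

(** Invariance of the mean of [x^(2M) + y^(2M)] under rotation by 45 degrees expresses [2 mu_M]
    through the products [mu_j mu_(M-j)]. The two end terms contribute [4 / 2^M] times [mu_M], which
    is less than [2 mu_M] from [M = 2] on; hence the lower bounds on the smaller moments carry over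
    to [mu_M]. *)
Lemma gauss_even_moment (m : nat) :
  ((odd_fact m)%:R%:E <= \int[gamma]_x (x ^+ (2 * m))%:E)%E.
Proof.
pose mu j : \bar R := (\int[gamma]_x (x ^+ (2 * j))%:E)%E.
have mu0 j : (0 <= mu j)%E.
  by apply: integral_ge0 => x _; rewrite lee_fin exprM exprn_ge0 ?sqr_ge0.
have prod_mu (a : R) i j : 0 <= a ->
    (\int[gamma]_x \int[gamma]_y (a * (x ^+ (2 * i) * y ^+ (2 * j)))%:E = a%:E * (mu i * mu j))%E.
  move=> a0; have p0 k (x : R) : 0 <= x ^+ (2 * k) by rewrite exprM exprn_ge0 ?sqr_ge0.
  transitivity (\int[gamma]_x ((a * x ^+ (2 * i))%:E * mu j))%E.
    apply: eq_integral => x _; rewrite /mu -ge0_integralZl; last 4 first.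
    - exact: measurableT.
    - exact: measurable_exprn_EFin.
    - by move=> y _; rewrite lee_fin.
    - by rewrite lee_fin mulr_ge0.
    by apply: eq_integral => y _; rewrite -EFinM mulrA.
  rewrite ge0_integralZr; last 4 first.
  - exact: measurableT.
  - by apply/measurable_EFinP/measurable_funM => //; exact: measurable_funX.
  - by move=> x _; rewrite lee_fin mulr_ge0.
  - exact: mu0.
  rewrite muleA; congr (_ * _)%E; rewrite /mu -ge0_integralZl; last 4 first.
  - exact: measurableT.
  - exact: measurable_exprn_EFin.
  - by move=> y _; rewrite lee_fin.
  - by rewrite lee_fin.
  by apply: eq_integral => y _; rewrite -EFinM.
have muT0 : mu 0%N = 1%:E.
  by rewrite /mu muln0; under eq_integral do rewrite expr0; exact: integral_gauss_cst.
elim/ltn_ind: m => -[|[|m]] IH.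
- by rewrite /odd_fact big_ord0 -/(mu 0%N) muT0.
- have -> : odd_fact 1 = 1%N by rewrite /odd_fact big_ord_recr big_ord0.
  by rewrite muln1; exact: gauss_second_moment.
set M := m.+2; rewrite -/(mu M).
pose c : R := (Num.sqrt 2)^-1.
have c0 : c != 0 by rewrite invr_eq0 gt_eqF// sqrtr_gt0.
have c2 : c ^+ 2 = 1 / 2 by rewrite /c exprVn sqr_sqrtr// mul1r.
have cs : c ^+ 2 + c ^+ 2 = 1 by rewrite c2; field.
pose h (z : R * R) := (z.1 ^+ (2 * M) + z.2 ^+ (2 * M))%:E.
have mh : measurable_fun setT h.
  by apply/measurable_EFinP/measurable_funD; apply: measurable_funX.
have h0 z : (0 <= h z)%E.
  by rewrite lee_fin addr_ge0// exprM exprn_ge0 ?sqr_ge0.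
have := gauss_rotate c0 cs mh h0.
pose a (j : 'I_M.+1) : R := 2 * (c ^+ (2 * M) * 'C(2 * M, 2 * j)%:R).
have a0 j : 0 <= a j.
  by rewrite /a exprM c2; apply: mulr_ge0 => //; apply: mulr_ge0 => //; apply: exprn_ge0; lra.
have pk k (x : R) : 0 <= x ^+ (2 * k) by rewrite exprM exprn_ge0 ?sqr_ge0.
have mF b i j : measurable_fun setT (fun z : R * R => (b * (z.1 ^+ (2 * i) * z.2 ^+ (2 * j)))%:E).
  by apply/measurable_EFinP/measurable_funM => //; apply: measurable_funM; apply: measurable_funX.
have -> : (\int[gamma]_x \int[gamma]_y h (x, y) = mu M + mu M)%E.
  pose F (p : nat * nat) (z : R * R) := (1 * (z.1 ^+ (2 * p.1) * z.2 ^+ (2 * p.2)))%:E.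
  transitivity (\int[gamma]_x \int[gamma]_y \sum_(p <- [:: (M, 0); (0, M)]%N) F p (x, y))%E.
    apply: eq_integral => x _; apply: eq_integral => y _.
    by rewrite !big_cons big_nil adde0 /h /F/= !muln0 !expr0 !mul1r mulr1 EFinD.
  rewrite ge0_iter_integral_sum; last 2 first.
  - by move=> p; exact: mF.
  - by move=> p z; rewrite lee_fin !mulr_ge0.
  by rewrite !big_cons big_nil adde0 /F !prod_mu// muT0 !mul1e mule1.
have -> : (\int[gamma]_x \int[gamma]_y h (c * x + c * y, - c * x + c * y)%R =
  \sum_(j < M.+1) (a j)%:E * (mu j * mu (M - j)%N))%E.
  pose F (j : 'I_M.+1) (z : R * R) := (a j * (z.1 ^+ (2 * j) * z.2 ^+ (2 * (M - j))))%:E.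
  transitivity (\int[gamma]_x \int[gamma]_y \sum_(j < M.+1) F j (x, y))%E.
    apply: eq_integral => x _; apply: eq_integral => y _.
    rewrite /h /F sumEFin; congr EFin => /=.
    rewrite mulNr -mulrN -!mulrDr !exprMn -mulrDr sum_pow_even mulrCA !mulr_sumr.
    by apply: eq_bigr => j _; rewrite /a; ring.
  rewrite ge0_iter_integral_sum; last 2 first.
  - by move=> p; exact: mF.
  - by move=> p z; rewrite lee_fin; apply: mulr_ge0; [exact: a0|exact: mulr_ge0].
  by apply: eq_bigr => j _; rewrite prod_mu.
have [muoo|mufin] := eqVneq (mu M) +oo%E; first by rewrite muoo leey.
have : mu M \is a fin_num by rewrite ge0_fin_numE// ltey.
case Er : (mu M) (mu0 M) => [r| |]// r0 _ E.
(* [e] marks the two end terms, those that contain [mu M] itself. *)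
pose e (j : 'I_M.+1) := (j == 0%N :> nat) || (j == M :> nat).
have {E} : (\sum_(j < M.+1) a j * (if e j then r else (odd_fact j * odd_fact (M - j))%:R)) <= r + r.
  rewrite -lee_fin EFinD -E -sumEFin; apply: lee_sum => j _.
  rewrite EFinM lee_pmul2l ?lte_fin//; last first.
    apply: mulr_gt0 => //; apply: mulr_gt0; first by apply: exprn_gt0; rewrite invr_gt0 sqrtr_gt0.
    by rewrite ltr0n bin_gt0 leq_mul2l -ltnS ltn_ord.
  rewrite /e; have [->|j0] := eqVneq (j : nat) 0%N; first by rewrite /= subn0 Er muT0 mul1e.
  have [->|jM] := eqVneq (j : nat) M; first by rewrite /= subnn Er muT0 mule1.
  rewrite /= natrM EFinM; apply: lee_pmul; rewrite ?lee_fin//; apply: IH.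
    by rewrite -/M ltn_neqAle jM -ltnS ltn_ord.
  by rewrite ltn_subrL lt0n j0.
have h2M' : 2 < 2 ^+ M :> R.
  by have : 1 <= 2 ^+ m :> R; [apply: exprn_ege1; lra|rewrite /M !exprS; lra].
have -> : \sum_(j < M.+1) a j * (if e j then r else (odd_fact j * odd_fact (M - j))%:R)
  = 2 / 2 ^+ M * (2 ^+ M * (odd_fact M)%:R + 2 * (r - (odd_fact M)%:R)).
  have -> : 2 ^+ M * (odd_fact M)%:R + 2 * (r - (odd_fact M)%:R) =
    \sum_(j < M.+1) ('C(M, j)%:R * (odd_fact M)%:R + (if e j then r - (odd_fact M)%:R else 0)).
    rewrite big_split/= -mulr_suml; congr (_ * _ + _).
      have -> : 2 = 1 + 1 :> R by [].
      by rewrite exprDn; apply: eq_bigr => j _; rewrite !expr1n mulr1.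
    have e0 : e ord0 = true by [].
    have eM : e (lift ord0 ord_max) = true.
      by apply/orP; right; apply/eqP; rewrite /= /bump leq0n add1n.
    rewrite big_ord_recl big_ord_recr e0 eM big1 /=; first by rewrite add0r mulr_natl mulr2n.
    move=> j _; rewrite /e /= /bump leq0n /= add1n eqSS.
    by rewrite (ltn_eqF (ltn_ord j)).
  rewrite mulr_sumr; apply: eq_bigr => j _.
  have -> : a j = 2 / 2 ^+ M * 'C(2 * M, 2 * j)%:R.
    by rewrite /a exprM c2 mulrA expr_div_n expr1n mul1r.
  rewrite -[LHS]mulrA; congr (_ * _).
  have jM : (j <= M)%N by rewrite -ltnS.
  rewrite /e; case: ifPn => [/orP[/eqP->|/eqP->]|_].
  - by rewrite muln0 !bin0 !mul1r addrC subrK.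
  - by rewrite !binn !mul1r addrC subrK.
  - by rewrite addr0 -!natrM odd_fact_bin.
rewrite lee_fin => E; rewrite leNgt; apply/negP => rM.
suff : r + r < 2 / 2 ^+ M * (2 ^+ M * (odd_fact M)%:R + 2 * (r - (odd_fact M)%:R)).
  by rewrite ltNge E.
rewrite mulrAC ltr_pdivlMr; last by lra.
have : 0 < ((odd_fact M)%:R - r) * (2 ^+ M - 2) by rewrite mulr_gt0 ?subr_gt0.
by move: (2 ^+ M : R) => u; nra.
Qed.
End gauss_moments.

(** * Orthogonal matrices and the spectral theorem *)

Section linear_algebra.
Variable R : realType.

Definition sqn n (x : 'cV[R]_n) : R := \sum_i x i 0 ^+ 2.

Lemma sqn_ge0 n (x : 'cV[R]_n) : 0 <= sqn x.
Proof. by apply: sumr_ge0 => i _; exact: sqr_ge0. Qed.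

Lemma sqnE n (x : 'cV[R]_n) : sqn x = (x^T *m x) 0 0.
Proof. by rewrite mxE; apply: eq_bigr => i _; rewrite mxE expr2. Qed.

Lemma sqn_eq0 n (x : 'cV[R]_n) : (sqn x == 0) = (x == 0).
Proof.
apply/idP/eqP => [|->]; last by rewrite /sqn big1// => i _; rewrite mxE expr0n.
rewrite psumr_eq0 => [/allP h|i _]; last exact: sqr_ge0.
apply/colP => i; rewrite mxE; apply/eqP.
by have := h i (mem_index_enum _); rewrite sqrf_eq0.
Qed.

Lemma sqnZ n a (x : 'cV[R]_n) : sqn (a *: x) = a ^+ 2 * sqn x.
Proof. by rewrite /sqn mulr_sumr; apply: eq_bigr => i _; rewrite mxE exprMn. Qed.

Lemma enorm_sqr n (x : 'cV[R]_n) : enorm x ^+ 2 = sqn x.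
Proof. by rewrite sqr_sqrtr// sqn_ge0. Qed.

Lemma enorm_ge0 n (x : 'cV[R]_n) : 0 <= enorm x.
Proof. exact: sqrtr_ge0. Qed.

Definition orthmx n (U : 'M[R]_n) := U^T *m U == 1%:M.

Lemma orthmxP n (U : 'M[R]_n) : orthmx U -> U^T *m U = 1%:M /\ U *m U^T = 1%:M.
Proof. by move=> /eqP h; split => //; exact: mulmx1C. Qed.

Lemma orthmx1 n : orthmx (1%:M : 'M[R]_n).
Proof. by rewrite /orthmx trmx1 mulmx1. Qed.

Lemma orthmx_tr n (U : 'M[R]_n) : orthmx U -> orthmx U^T.
Proof. by move=> /orthmxP[_ h]; rewrite /orthmx trmxK h. Qed.

Lemma orthmxM n (U V : 'M[R]_n) : orthmx U -> orthmx V -> orthmx (U *m V).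
Proof.
move=> /orthmxP[hU _] /orthmxP[hV _]; rewrite /orthmx trmx_mul mulmxA -(mulmxA V^T).
by rewrite hU mulmx1 hV.
Qed.

Lemma sqn_orth n (U : 'M[R]_n) x : orthmx U -> sqn (U *m x) = sqn x.
Proof.
by move=> /orthmxP[h _]; rewrite !sqnE trmx_mul mulmxA -(mulmxA x^T) h mulmx1.
Qed.

Lemma orthmx_block m n (U : 'M[R]_m) (V : 'M[R]_n) :
  orthmx U -> orthmx V -> orthmx (block_mx U 0 0 V).
Proof.
move=> /orthmxP[hU _] /orthmxP[hV _]; rewrite /orthmx tr_block_mx mulmx_block.
by rewrite !trmx0 !mul0mx !mulmx0 !addr0 !add0r hU hV -scalar_mx_block.
Qed.

(* The reflection exchanging [x] and [|x| e_i]. *)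
Lemma householder n (x : 'cV[R]_n) (i : 'I_n) :
  exists2 H : 'M[R]_n, orthmx H & H *m x = enorm x *: delta_mx i 0.
Proof.
set e : 'cV[R]_n := delta_mx i 0.
have [xe|xe] := eqVneq x (enorm x *: e).
  by exists 1%:M; [exact: orthmx1|rewrite mul1mx].
pose a := x - enorm x *: e.
have a0 : sqn a != 0 by rewrite sqn_eq0 subr_eq0.
have dot1 (u v : 'cV[R]_n) : u^T *m v = ((u^T *m v) 0 0)%:M by rewrite -mx11_scalar.
have ax : 2 * (a^T *m x) 0 0 = sqn a.
  have -> : (a^T *m x) 0 0 = sqn x - enorm x * x i 0.
    have -> : (a^T *m x) 0 0 = \sum_j (x j 0 ^+ 2 - (j == i)%:R * (enorm x * x i 0)).
      rewrite mxE; apply: eq_bigr => j _; rewrite !mxE eqxx andbT.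
      by case: eqP => [->|_] /=; ring.
    rewrite sumrB -mulr_suml [X in _ - X * _](bigD1 i)//= [X in _ - (_ + X) * _]big1 ?eqxx => [|j /negbTE->//].
    by rewrite addr0 mul1r.
  have -> : sqn a = sqn x - 2 * (enorm x * x i 0) + enorm x ^+ 2.
    have -> : sqn a = \sum_j (x j 0 ^+ 2 + (j == i)%:R * (enorm x ^+ 2 - 2 * (enorm x * x i 0))).
      apply: eq_bigr => j _; rewrite !mxE eqxx andbT.
      by case: eqP => [->|_]; rewrite /=; ring.
    rewrite big_split/= -mulr_suml [X in _ + X * _](bigD1 i)//= [X in _ + (_ + X) * _]big1 ?eqxx => [|j /negbTE->//].
    by rewrite -/(sqn x) /=; ring.
  by rewrite enorm_sqr; ring.
pose H := 1%:M - (2 / sqn a) *: (a *m a^T).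
have HT : H^T = H by rewrite /H linearB/= linearZ/= trmx1 trmx_mul trmxK.
exists H.
  rewrite /orthmx HT /H mulmxBl mul1mx mulmxBr mulmx1 -!scalemxAl -!scalemxAr.
  rewrite -mulmxA (mulmxA a^T) (dot1 a a) -sqnE mul_scalar_mx -scalemxAr !scalerA.
  have -> : 2 / sqn a * (2 / sqn a * sqn a) = 2 / sqn a + 2 / sqn a by field.
  by rewrite scalerDl opprB addrK subrK.
rewrite /H mulmxBl mul1mx -scalemxAl -mulmxA (dot1 a x) mul_mx_scalar scalerA.
rewrite (_ : 2 / sqn a * _ = 1) ?scale1r; first by rewrite /a opprB addrC subrK.
by rewrite mulrAC ax divff.
Qed.

Lemma char_poly_similar n (U V A : 'M[R]_n) : U *m V = 1%:M ->
  char_poly (U *m A *m V) = char_poly A.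
Proof.
move=> UV; rewrite /char_poly.
have -> : char_poly_mx (U *m A *m V) =
    map_mx polyC U *m char_poly_mx A *m map_mx polyC V.
  rewrite /char_poly_mx mulmxBr mulmxBl -!map_mxM/= mul_mx_scalar -scalemxAl -map_mxM UV.
  by rewrite map_mx1 scalemx1.
rewrite !det_mulmx mulrAC -det_mulmx -map_mxM UV map_mx1 det1 mul1r.
by [].
Qed.

Lemma char_poly_block_diag m n (A : 'M[R]_m) (B : 'M[R]_n) :
  char_poly (block_mx A 0 0 B) = char_poly A * char_poly B.
Proof.
rewrite /char_poly /char_poly_mx scalar_mx_block map_block_mx/= !map_mx0.
by rewrite opp_block_mx add_block_mx !oppr0 !addr0 det_ublock.
Qed.

(** Deflation: a Householder reflection takes an eigenvector for the head of [s] to the first axis,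
    symmetry makes the matrix block diagonal, and the remaining block has the tail of [s] as
    spectrum. The eigenvalues thus keep their given order, on which the split into head and tail
    relies. *)
Lemma real_spectral n (A : 'M[R]_n) (s : seq R) : A^T = A ->
  char_poly A = \prod_(x <- s) ('X - x%:P) ->
  exists2 U : 'M[R]_n, orthmx U & A = U *m diag_mx (\row_i s`_i) *m U^T.
Proof.
elim: n A s => [|n IH] A s AT chA.
  by exists 1%:M; [exact: orthmx1|apply/matrixP => -[]].
case: s chA => [|x s] chA.
  by have := size_char_poly A; rewrite chA big_nil size_poly1.
have : eigenvalue A x by rewrite eigenvalue_root_char chA big_cons rootM root_XsubC eqxx.
case/eigenvalueP => v vA v0.
have Av : A *m v^T = x *: v^T by rewrite -{1}AT -trmx_mul vA linearZ.
have [H oH Hv] := householder v^T ord0.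
have [HH HH'] := orthmxP oH.
have nv : enorm v^T != 0.
  by rewrite -sqrf_eq0 enorm_sqr sqn_eq0 -[0]trmx0 (inj_eq trmx_inj).
have B0 : H *m A *m H^T *m delta_mx ord0 0 = x *: delta_mx ord0 0 :> 'cV[R]_n.+1.
  have -> : delta_mx ord0 0 = (enorm v^T)^-1 *: (H *m v^T) by rewrite Hv scalerA mulVf ?scale1r.
  rewrite -scalemxAr mulmxA -(mulmxA _ H^T H) HH mulmx1 -mulmxA Av -scalemxAr.
  by rewrite !scalerA mulrC.
have [B defB] : exists B : 'M[R]_(1 + n), B = H *m A *m H^T by exists (H *m A *m H^T).
have BT : B^T = B by rewrite defB !trmx_mul trmxK AT mulmxA.
have Bc i : B i ord0 = x * (i == ord0)%:R.
  have := congr1 (fun M : 'cV_n.+1 => M i 0) B0.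
  by rewrite -defB -colE !mxE eqxx andbT => ->.
have l0 : lshift n (0 : 'I_1) = ord0 :> 'I_(1 + n) by exact: ord_inj.
have BE : B = block_mx x%:M 0 0 (drsubmx B).
  rewrite -[LHS]submxK; congr block_mx.
  - by apply/matrixP => i j; rewrite !ord1 !mxE l0 Bc eqxx mulr1.
  - apply/matrixP => i j; rewrite !ord1 !mxE -BT mxE.
    by rewrite l0 Bc mulr0.
  - apply/matrixP => i j; rewrite !ord1 !mxE.
    by rewrite l0 Bc mulr0.
have chB : char_poly (drsubmx B) = \prod_(y <- s) ('X - y%:P).
  have : char_poly B = char_poly A by rewrite defB; exact: char_poly_similar.
  rewrite chA {1}BE char_poly_block_diag big_cons.
  have -> : char_poly (x%:M : 'M[R]_1) = 'X - x%:P.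
    by rewrite /char_poly /char_poly_mx det_mx11 !mxE eqxx !mulr1n.
  by apply: mulfI; rewrite polyXsubC_eq0.
have dT : (drsubmx B)^T = drsubmx B by rewrite trmx_drsub BT.
have [U' oU' BU] := IH _ _ dT chB.
pose V : 'M[R]_(1 + n) := block_mx (1%:M : 'M[R]_1) 0 0 U'.
exists (H^T *m (V : 'M[R]_n.+1)).
  by apply: orthmxM; [exact: orthmx_tr|apply: (@orthmx_block 1 n) => //; exact: orthmx1].
have -> : A = H^T *m B *m H.
  by rewrite defB !mulmxA HH mul1mx -mulmxA HH mulmx1.
have -> : diag_mx (\row_(i < n.+1) (x :: s)`_i) =
    block_mx x%:M 0 0 (diag_mx (\row_(i < n) s`_i)) :> 'M[R]_(1 + n).
  apply/matrixP => i j; rewrite !mxE.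
  case: splitP => i' ii; rewrite !mxE; case: splitP => j' jj; rewrite !mxE -val_eqE/= ii jj ?ord1//=.
rewrite BE BU trmx_mul /V (tr_block_mx (1%:M : 'M[R]_1)) trmxK !trmx0 trmx1 !mulmxA; congr (_ *m _).
rewrite -!(mulmxA H^T); congr (_ *m _).
set D := diag_mx _.
have -> : block_mx x%:M 0 0 (U' *m D *m U'^T) =
    (V *m (block_mx x%:M 0 0 D : 'M[R]_(1 + n))) *m (block_mx 1%:M 0 0 U'^T : 'M[R]_(1 + n)).
  by rewrite /V !mulmx_block !mul0mx !mulmx0 !mul1mx !mulmx1 !addr0 !add0r mul0mx.
by [].
Qed.

(** Each column costs one row: once the other columns vanish in the first [r + 1] rows, a reflection
    within these rows concentrates the top of the remaining column in the last of them. The first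
    [r] rows of [H] are then orthonormal vectors orthogonal to the columns of [G]. *)
Lemma ortho_zero_rows p r l (G : 'M[R]_(l, p)) : (r + p <= l)%N ->
  exists2 H : 'M[R]_l, orthmx H & forall (i : 'I_l) j, (i < r)%N -> (H *m G) i j = 0.
Proof.
elim: p r l G => [|p IH] r l G rpl.
  by exists 1%:M; [exact: orthmx1|move=> i []].
have rp' : (r.+1 + p <= l)%N by rewrite addSnnS.
have [H0 oH0 H0C] := IH r.+1 l (col' ord0 G) rp'.
have [l' El] : exists l', l = (r.+1 + l')%N.
  by exists (l - r.+1)%N; rewrite subnKC// (leq_trans _ rp')// leq_addr.
subst l.
have [K oK Kc] := householder (usubmx (H0 *m col ord0 G)) ord_max.
exists (block_mx K 0 0 1%:M *m H0).
  by apply: orthmxM => //; apply: orthmx_block => //; exact: orthmx1.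
move=> i j ir; rewrite -mulmxA.
have -> : i = lshift l' (Ordinal (leqW ir : (i < r.+1)%N)) by exact: ord_inj.
have top (M : 'cV[R]_(r.+1 + l')) (i' : 'I_r.+1) :
    (block_mx K 0 0 1%:M *m M) (lshift l' i') 0 = (K *m usubmx M) i' 0.
  by rewrite -{1}[M]vsubmxK mul_block_col mul0mx addr0 col_mxEu.
transitivity ((block_mx K 0 0 1%:M *m (H0 *m col j G)) (lshift l' (Ordinal (leqW ir : (i < r.+1)%N))) 0).
  by rewrite colE !mulmxA -colE [RHS]mxE.
rewrite top; have [->|j0] := eqVneq j ord0.
  by rewrite Kc !mxE eqxx andbT -val_eqE/= ltn_eqF ?mulr0.
have -> : usubmx (H0 *m col j G) = 0; last by rewrite mulmx0 mxE.
apply/colP => k; rewrite !mxE.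
have [j' jj _] : {j' | j = lift ord0 j' & unlift ord0 j = Some j'}.
  by apply: unlift_some; rewrite eq_sym.
have := H0C (lshift l' k) j' (ltn_ord k); rewrite mxE => E; rewrite -[RHS]E.
by apply: eq_bigr => k' _; rewrite !mxE jj.
Qed.

Definition dot n (x y : 'cV[R]_n) : R := \sum_i x i 0 * y i 0.

Lemma dotE n (x y : 'cV[R]_n) : dot x y = (x^T *m y) 0 0.
Proof. by rewrite mxE; apply: eq_bigr => i _; rewrite mxE. Qed.

Lemma cauchy_schwarz n (x y : 'cV[R]_n) : dot x y ^+ 2 <= sqn x * sqn y.
Proof.
have [y0|y0] := eqVneq (sqn y) 0.
  have -> : dot x y = 0; last by rewrite expr0n y0 mulr0.
  by move/eqP: y0; rewrite sqn_eq0 => /eqP->; rewrite /dot big1// => i _; rewrite mxE mulr0.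
have y1 : 0 < sqn y by rewrite lt_neqAle eq_sym y0 sqn_ge0.
have : 0 <= sqn (sqn y *: x - dot x y *: y) by exact: sqn_ge0.
have -> : sqn (sqn y *: x - dot x y *: y) = sqn y * (sqn x * sqn y - dot x y ^+ 2).
  have quad a b : sqn (a *: x - b *: y) =
      a ^+ 2 * sqn x - 2 * (a * b) * dot x y + b ^+ 2 * sqn y.
    rewrite /sqn /dot !mulr_sumr -sumrB -big_split/=.
    by apply: eq_bigr => i _; rewrite !mxE; ring.
  by rewrite quad; ring.
by rewrite pmulr_rge0// subr_ge0.
Qed.

End linear_algebra.

(** * Measurability and laws of matrices *)

Section matrix_measurability.
Variable R : realType.

Definition mx_box a b (B : 'I_a -> 'I_b -> set R) : set 'M[R]_(a, b) :=
  [set M | forall i j, B i j (M i j)].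

Definition mx_boxes a b : set (set 'M[R]_(a, b)) :=
  [set mx_box B | B in [set B : 'I_a -> 'I_b -> set R | forall i j, measurable (B i j)]].

(** The boxes are stable under intersection, so a finite measure on this sigma-algebra is determined
    by its values on them. *)
Definition mxT a b := g_sigma_algebraType (@mx_boxes a b).

(** Equivalent to measurability into [mxT]; the entrywise form is the one that passes easily through
    matrix operations. *)
Definition mxmeas d (O : measurableType d) a b (f : O -> 'M[R]_(a, b)) :=
  forall i j, measurable_fun setT (fun w => f w i j).

Lemma mxmeas_measurable d (O : measurableType d) a b (f : O -> 'M[R]_(a, b)) :
  mxmeas f -> measurable_fun setT (f : O -> mxT a b).
Proof.
move=> mf; refine (@measurability _ _ O (mxT a b) setT f (@mx_boxes a b) erefl _).
move=> _ [_ [B mB <-] <-]; rewrite setTI.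
have -> : f @^-1` mx_box B = \big[setI/setT]_(i < a) \big[setI/setT]_(j < b) ((fun w => f w i j) @^-1` B i j).
  apply/seteqP; split => w /=.
    move=> h; rewrite -bigcap_seq => i _ /=; rewrite -bigcap_seq => j _ /=.
    exact: h.
  rewrite -bigcap_seq => h i j; have := h i (mem_index_enum _).
  by rewrite -bigcap_seq => /(_ j (mem_index_enum _)).
apply: bigsetI_measurable => i _; apply: bigsetI_measurable => j _.
by rewrite -[X in measurable X]setTI; apply: mf => //; exact: mB.
Qed.

Lemma mxmeas_id a b : mxmeas (id : mxT a b -> 'M[R]_(a, b)).
Proof.
move=> i j _ A mA; rewrite setTI.
apply: sub_sigma_algebra.
exists (fun i' j' => if (i' == i) && (j' == j) then A else setT).
  by move=> i' j' /=; case: ifP.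
apply/seteqP; split => M /=.
  by move=> /(_ i j); rewrite !eqxx.
by move=> h i' j'; case: ifP => // /andP[/eqP-> /eqP->].
Qed.

Lemma measurable_mxmeas d (O : measurableType d) a b (f : O -> 'M[R]_(a, b)) :
  measurable_fun setT (f : O -> mxT a b) -> mxmeas f.
Proof.
by move=> mf i j; apply: (measurableT_comp (@mxmeas_id a b i j) mf).
Qed.

Lemma mxmeas_comp d (O : measurableType d) a b a' b' (g : 'M[R]_(a, b) -> 'M[R]_(a', b'))
  (f : O -> 'M[R]_(a, b)) : mxmeas (g : mxT a b -> _) -> mxmeas f -> mxmeas (g \o f).
Proof.
move=> mg mf; apply: measurable_mxmeas.
by apply: (measurableT_comp (mxmeas_measurable mg)); exact: mxmeas_measurable.
Qed.

Section ops.
Context d (O : measurableType d).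

Lemma measurable_sumr (I : Type) (s : seq I) (f : I -> O -> R) :
  (forall i, measurable_fun setT (f i)) ->
  measurable_fun setT (fun w => \sum_(i <- s) f i w).
Proof.
move=> mf; elim: s => [|i s IH].
  by under eq_fun do rewrite big_nil; exact: measurable_cst.
by under eq_fun do rewrite big_cons; exact: measurable_funD.
Qed.

Lemma measurable_prodr (I : Type) (s : seq I) (f : I -> O -> R) :
  (forall i, measurable_fun setT (f i)) ->
  measurable_fun setT (fun w => \prod_(i <- s) f i w).
Proof.
move=> mf; elim: s => [|i s IH].
  by under eq_fun do rewrite big_nil; exact: measurable_cst.
by under eq_fun do rewrite big_cons; exact: measurable_funM.
Qed.

Lemma mxmeas_cst a b (M : 'M[R]_(a, b)) : mxmeas (fun _ : O => M).
Proof. by move=> i j; exact: measurable_cst. Qed.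

Lemma mxmeas_mul a b c (f : O -> 'M[R]_(a, b)) (g : O -> 'M[R]_(b, c)) :
  mxmeas f -> mxmeas g -> mxmeas (fun w => f w *m g w).
Proof.
move=> mf mg i j; under eq_fun do rewrite mxE.
by apply: measurable_sumr => k; exact: measurable_funM.
Qed.

Lemma mxmeas_add a b (f g : O -> 'M[R]_(a, b)) :
  mxmeas f -> mxmeas g -> mxmeas (fun w => f w + g w).
Proof.
by move=> mf mg i j; under eq_fun do rewrite mxE; exact: measurable_funD.
Qed.

Lemma mxmeas_opp a b (f : O -> 'M[R]_(a, b)) : mxmeas f -> mxmeas (fun w => - f w).
Proof.
by move=> mf i j; under eq_fun do rewrite mxE; exact: measurable_funN.
Qed.

Lemma mxmeas_tr a b (f : O -> 'M[R]_(a, b)) : mxmeas f -> mxmeas (fun w => (f w)^T).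
Proof. by move=> mf i j; under eq_fun do rewrite mxE; exact: mf. Qed.

Lemma mxmeas_scale a b (c : O -> R) (f : O -> 'M[R]_(a, b)) :
  measurable_fun setT c -> mxmeas f -> mxmeas (fun w => c w *: f w).
Proof.
by move=> mc mf i j; under eq_fun do rewrite mxE; exact: measurable_funM.
Qed.

Lemma mxmeas_lsub a b c (f : O -> 'M[R]_(a, b + c)) : mxmeas f -> mxmeas (fun w => lsubmx (f w)).
Proof. by move=> mf i j; under eq_fun do rewrite mxE; exact: mf. Qed.

Lemma mxmeas_rsub a b c (f : O -> 'M[R]_(a, b + c)) : mxmeas f -> mxmeas (fun w => rsubmx (f w)).
Proof. by move=> mf i j; under eq_fun do rewrite mxE; exact: mf. Qed.

Lemma mxmeas_row_mx a b c (f : O -> 'M[R]_(a, b)) (g : O -> 'M[R]_(a, c)) :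
  mxmeas f -> mxmeas g -> mxmeas (fun w => row_mx (f w) (g w)).
Proof.
move=> mf mg i j; under eq_fun do rewrite mxE.
by case: (fintype.split j) => k; [exact: mf|exact: mg].
Qed.

Lemma measurable_det a (f : O -> 'M[R]_a) : mxmeas f -> measurable_fun setT (fun w => \det (f w)).
Proof.
move=> mf; rewrite /determinant; apply: measurable_sumr => s.
by apply: measurable_funM => //; apply: measurable_prodr => i; exact: mf.
Qed.

Lemma mxmeas_adj a (f : O -> 'M[R]_a) : mxmeas f -> mxmeas (fun w => \adj (f w)).
Proof.
move=> mf i j; under eq_fun do rewrite mxE /cofactor.
apply: measurable_funM => //; apply: measurable_det => i' j'.
by under eq_fun do rewrite !mxE; exact: mf.
Qed.

Lemma measurable_sqn a (f : O -> 'cV[R]_a) : mxmeas f -> measurable_fun setT (fun w => sqn (f w)).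
Proof. by move=> mf; apply: measurable_sumr => i; apply: measurable_funX; exact: mf. Qed.

Lemma measurable_invr (f : O -> R) : measurable_fun setT f -> measurable_fun setT (fun w => (f w)^-1).
Proof.
move=> mf; apply: (@measurableT_comp _ _ _ _ _ _ (@GRing.inv R)) => //.
have -> : [set: R] = [set 0] `|` ~` [set 0] by rewrite setUv.
apply/measurable_funU; [exact: measurable_set1|exact: measurableC|].
split; first exact: measurable_fun_set1.
apply: open_continuous_measurable_fun; first by apply: closed_openC; exact: closed_eq.
move=> x /[!inE] /= x0; apply: inv_continuous.
exact/eqP.
Qed.

End ops.
End matrix_measurability.

(** * Product probability spaces *)

Section product_probability.
Context d1 d2 (T1 : measurableType d1) (T2 : measurableType d2) (R : realType).
Variables (P1 : probability T1 R) (P2 : probability T2 R).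

Definition prod_prob : set (T1 * T2) -> \bar R := (P1 \x P2)%E.

HB.instance Definition _ := Measure.on prod_prob.

Let prod_prob_setT : prod_prob setT = 1%E.
Proof.
rewrite /prod_prob -setXTT; transitivity (P1 setT * P2 setT)%E.
  exact: product_measure1E.
by rewrite !probability_setT mule1.
Qed.

HB.instance Definition _ := Measure_isProbability.Build _ _ _ prod_prob prod_prob_setT.

Lemma prod_probX A B : measurable A -> measurable B ->
  prod_prob (A `*` B) = (P1 A * P2 B)%E.
Proof. exact: product_measure1E. Qed.

Lemma ge0_integral_prod_prob (f : T1 * T2 -> \bar R) :
  measurable_fun setT f -> (forall x, 0 <= f x)%E ->
  (\int[prod_prob]_z f z = \int[P1]_x \int[P2]_y f (x, y))%E.
Proof. by move=> mf f0; exact: (@fubini_tonelli1 _ _ _ _ _ P1 P2). Qed.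

End product_probability.

(** * Standard Gaussian matrices and their blocks *)

Section gaussian_matrices.
Variable R : realType.
Notation gamma := (normal_prob (0 : R) (1 : R)).

(** Normality and independence in one condition on the law, which makes it possible to change the
    underlying probability space. *)
Definition std_gauss d (O : measurableType d) (P : probability O R) a b
    (Z : O -> 'M[R]_(a, b)) : Prop :=
  mxmeas Z /\ forall B : 'I_a -> 'I_b -> set R, (forall i j, measurable (B i j)) ->
    P (Z @^-1` mx_box B) = (\prod_i \prod_j fine (gamma (B i j)))%:E.

Lemma measurable_mx_box a b (B : 'I_a -> 'I_b -> set R) :
  (forall i j, measurable (B i j)) -> measurable (mx_box B : set (mxT R a b)).
Proof. by move=> mB; apply: sub_sigma_algebra; exists B. Qed.

Lemma mx_box_setI_closed a b : setI_closed (@mx_boxes R a b).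
Proof.
move=> _ _ [B mB <-] [C mC <-]; exists (fun i j => B i j `&` C i j).
  by move=> i j; exact: measurableI.
by apply/seteqP; split => M /=; [move=> h; split=> i j; case: (h i j)|move=> [h1 h2] i j; split].
Qed.

(** Two probability laws that agree on a generating family stable under intersection are equal, here
    on the boxes. *)
Lemma std_gauss_law d (O : measurableType d) (P : probability O R)
    d' (O' : measurableType d') (P' : probability O' R) a b
    (Z : O -> 'M[R]_(a, b)) (Z' : O' -> 'M[R]_(a, b)) (A : set (mxT R a b)) :
  std_gauss P Z -> std_gauss P' Z' -> measurable A ->
  P (Z @^-1` A) = P' (Z' @^-1` A).
Proof.
move=> [mZ bZ] [mZ' bZ'] mA.
pose m1 := image_measure P (mxmeas_measurable mZ).
pose m2 := image_measure P' (mxmeas_measurable mZ').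
suff : m1 A = m2 A by [].
apply: (@measure_unique _ R (mxT R a b) (@mx_boxes R a b) (fun _ => setT)) => //.
- exact: mx_box_setI_closed.
- by move=> _; exists (fun _ _ => setT) => //; apply/seteqP; split.
- by apply/seteqP; split => // M _; exists 0%N.
- by move=> _ [B mB <-]; rewrite /m1 /m2 /= /pushforward (bZ _ mB) (bZ' _ mB).
- by move=> _; rewrite /m1 /= /pushforward preimage_setT probability_setT ltry.
Qed.

Lemma std_gauss_integral d (O : measurableType d) (P : probability O R)
    d' (O' : measurableType d') (P' : probability O' R) a b
    (Z : O -> 'M[R]_(a, b)) (Z' : O' -> 'M[R]_(a, b)) (F : mxT R a b -> \bar R) :
  std_gauss P Z -> std_gauss P' Z' -> measurable_fun setT F -> (forall M, 0 <= F M)%E ->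
  (\int[P]_w F (Z w) = \int[P']_w F (Z' w))%E.
Proof.
move=> gZ gZ' mF F0.
have mZ := mxmeas_measurable gZ.1; have mZ' := mxmeas_measurable gZ'.1.
rewrite -[LHS](@ge0_integral_pushforward _ _ _ (mxT R a b) R Z mZ P setT F)//.
rewrite -[RHS](@ge0_integral_pushforward _ _ _ (mxT R a b) R Z' mZ' P' setT F)//.
apply: (@eq_measure_integral _ _ _ setT (image_measure P' mZ') (image_measure P mZ)) => A mA _.
exact: std_gauss_law.
Qed.

(** Lets a distributional claim about [Z] be checked on a convenient model [Z'], such as one on a
    product space where blocks have separate sources. *)
Lemma std_gauss_transfer d (O : measurableType d) (P : probability O R)
    d' (O' : measurableType d') (P' : probability O' R) a b a' b'
    (Z : O -> 'M[R]_(a, b)) (Z' : O' -> 'M[R]_(a, b)) (f : 'M[R]_(a, b) -> 'M[R]_(a', b')) :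
  mxmeas (f : mxT R a b -> _) -> std_gauss P Z -> std_gauss P' Z' ->
  std_gauss P' (f \o Z') -> std_gauss P (f \o Z).
Proof.
move=> mf gZ gZ' [_ h]; split; first exact: mxmeas_comp (gZ.1).
move=> B mB; transitivity (P' ((f \o Z') @^-1` mx_box B)); last exact: h.
apply: (std_gauss_law (A := f @^-1` mx_box B) gZ gZ').
rewrite -[X in measurable X]setTI.
by apply: (mxmeas_measurable mf) => //; exact: measurable_mx_box.
Qed.

Lemma gamma_setT : fine (gamma setT) = 1.
Proof. by rewrite (@probability_setT _ _ _ (normal_prob 0 1)). Qed.

Lemma gamma_fin A : measurable A -> gamma A = (fine (gamma A))%:E.
Proof. by move=> mA; rewrite fineK// (@fin_num_measure _ _ _ (normal_prob 0 1)). Qed.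

Lemma std_gauss_tr d (O : measurableType d) (P : probability O R) a b
  (Z : O -> 'M[R]_(a, b)) : std_gauss P Z -> std_gauss P (fun w => (Z w)^T).
Proof.
move=> [mZ h]; split; first exact: mxmeas_tr.
move=> B mB; rewrite exchange_big/= -(h (fun i j => B j i))//; congr (P _).
by apply/seteqP; split => w /= hw i j; have := hw j i; rewrite mxE.
Qed.

Lemma std_gauss_row_mx d (O : measurableType d) (P : probability O R)
    d' (O' : measurableType d') (P' : probability O' R) a b c
    (Z : O -> 'M[R]_(a, b)) (Z' : O' -> 'M[R]_(a, c)) :
  std_gauss P Z -> std_gauss P' Z' ->
  std_gauss (prod_prob P P') (fun w => row_mx (Z w.1) (Z' w.2)).
Proof.
move=> [mZ h] [mZ' h']; split.
  apply: mxmeas_row_mx => i j.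
    by apply: (measurableT_comp (mZ i j)).
  by apply: (measurableT_comp (mZ' i j)).
move=> B mB.
have -> : (fun w => row_mx (Z w.1) (Z' w.2)) @^-1` mx_box B =
    (Z @^-1` mx_box (fun i j => B i (lshift c j))) `*` (Z' @^-1` mx_box (fun i j => B i (rshift b j))).
  apply/seteqP; split => -[w w'] /=.
    by move=> hw; split => i j; [have := hw i (lshift c j)|have := hw i (rshift b j)]; rewrite ?row_mxEl ?row_mxEr.
  by move=> [h1 h2] i j; rewrite mxE; case: splitP => k jk; [have := h1 i k|have := h2 i k]; congr (B i _ _); apply: val_inj.
transitivity (P (Z @^-1` mx_box (fun i j => B i (lshift c j))) * P' (Z' @^-1` mx_box (fun i j => B i (rshift b j))))%E.
  apply: prod_probX.
    by rewrite -[X in measurable X]setTI; apply: (mxmeas_measurable mZ) => //; exact: measurable_mx_box.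
  by rewrite -[X in measurable X]setTI; apply: (mxmeas_measurable mZ') => //; exact: measurable_mx_box.
rewrite h// h'// -EFinM -big_split/=; congr EFin; apply: eq_bigr => i _.
by rewrite big_split_ord.
Qed.

Lemma std_gauss_lsub d (O : measurableType d) (P : probability O R) a b c
  (Z : O -> 'M[R]_(a, b + c)) : std_gauss P Z -> std_gauss P (fun w => lsubmx (Z w)).
Proof.
move=> [mZ h]; split; first exact: mxmeas_lsub.
move=> B mB.
pose C i (j : 'I_(b + c)) := match fintype.split j with inl k => B i k | inr _ => setT end.
have mC i j : measurable (C i j) by rewrite /C; case: (fintype.split j) => k.
have -> : (fun w => lsubmx (Z w)) @^-1` mx_box B = Z @^-1` mx_box C.
  apply/seteqP; split => w /=.
    move=> hw i j; rewrite /C; case: splitP => // k jk.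
    by have := hw i k; rewrite mxE; congr (B i k (Z w i _)); apply: val_inj.
  by move=> hw i j; have := hw i (lshift c j); rewrite mxE /C (unsplitK (inl j)).
rewrite (h _ mC); congr EFin; apply: eq_bigr => i _.
rewrite big_split_ord/= [X in _ * X]big1 ?mulr1 => [|j _].
  by apply: eq_bigr => j _; rewrite /C (unsplitK (inl j)).
by rewrite /C (unsplitK (inr j)) gamma_setT.
Qed.

Lemma std_gauss_rsub d (O : measurableType d) (P : probability O R) a b c
  (Z : O -> 'M[R]_(a, b + c)) : std_gauss P Z -> std_gauss P (fun w => rsubmx (Z w)).
Proof.
move=> [mZ h]; split; first exact: mxmeas_rsub.
move=> B mB.
pose C i (j : 'I_(b + c)) := match fintype.split j with inl _ => setT | inr k => B i k end.
have mC i j : measurable (C i j) by rewrite /C; case: (fintype.split j) => k.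
have -> : (fun w => rsubmx (Z w)) @^-1` mx_box B = Z @^-1` mx_box C.
  apply/seteqP; split => w /=.
    move=> hw i j; rewrite /C; case: splitP => // k jk.
    by have := hw i k; rewrite mxE; congr (B i k (Z w i _)); apply: val_inj.
  by move=> hw i j; have := hw i (rshift b j); rewrite mxE /C (unsplitK (inr j)).
rewrite (h _ mC); congr EFin; apply: eq_bigr => i _.
rewrite big_split_ord/= [X in X * _]big1 ?mul1r => [|j _].
  by apply: eq_bigr => j _; rewrite /C (unsplitK (inr j)).
by rewrite /C (unsplitK (inl j)) gamma_setT.
Qed.

Lemma std_gauss_const : std_gauss (normal_prob 0 1) (fun x : R => const_mx x : 'M[R]_1).
Proof.
split; first by move=> i j; under eq_fun do rewrite mxE; exact: measurable_id.
move=> B mB; rewrite !big_ord1 -(gamma_fin (mB _ _)).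
have -> : (fun x : R => const_mx x : 'M[R]_1) @^-1` mx_box B = B 0 0; last by [].
apply/seteqP; split => x /=; first by move=> /(_ 0 0); rewrite mxE.
by move=> hx i j; rewrite !ord1 mxE.
Qed.

Lemma std_gauss_mx0 d (O : measurableType d) (P : probability O R) b
  (Z : O -> 'M[R]_(0, b)) : std_gauss P Z.
Proof.
split=> [[]//|B mB]; rewrite big_ord0 -(probability_setT P); congr (P _).
by apply/seteqP; split => // w _ [].
Qed.

End gaussian_matrices.

(** * Orthogonal invariance of Gaussian matrices *)

Section orthogonal_invariance.
Variable R : realType.
Notation gamma := (normal_prob (0 : R) (1 : R)).

Lemma measure_int_indic d (T : measurableType d) (m : {measure set T -> \bar R}) A :
  measurable A -> m A = (\int[m]_z (\1_A z)%:E)%E.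
Proof. by move=> mA; rewrite integral_indic// setIT. Qed.

Lemma eq_std_gauss d (O : measurableType d) (P : probability O R) a b
    (Z Z' : O -> 'M[R]_(a, b)) :
  Z =1 Z' -> std_gauss P Z -> std_gauss P Z'.
Proof. by move=> /funext->. Qed.

(** This property is stable under products and block sums, so that it spreads from sign changes and
    planar rotations to all orthogonal matrices. *)
Definition row_inv b (U : 'M[R]_b) : Prop :=
  forall d (O : measurableType d) (P : probability O R) (Z : O -> 'rV[R]_b),
  std_gauss P Z -> std_gauss P (fun w => Z w *m U).

Lemma mxmeas_mulr a b c (U : 'M[R]_(b, c)) :
  mxmeas ((fun M : 'M[R]_(a, b) => M *m U) : mxT R a b -> _).
Proof. by apply: mxmeas_mul; [exact: mxmeas_id|exact: mxmeas_cst]. Qed.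

Lemma row_inv1 b : row_inv (1%:M : 'M[R]_b).
Proof. by move=> d O P Z gZ; under eq_fun do rewrite mulmx1. Qed.

Lemma row_invM b (U V : 'M[R]_b) : row_inv U -> row_inv V -> row_inv (U *m V).
Proof.
by move=> iU iV d O P Z gZ; under eq_fun do rewrite mulmxA; exact/iV/iU.
Qed.

(** On a product space the two halves of the row depend on different coordinates, and [U] and [V]
    act on them separately. *)
Lemma row_inv_block b c (U : 'M[R]_b) (V : 'M[R]_c) :
  row_inv U -> row_inv V -> row_inv (block_mx U 0 0 V).
Proof.
move=> iU iV d O P Z gZ.
have gZ' := std_gauss_row_mx (std_gauss_lsub gZ) (std_gauss_rsub gZ).
apply: (std_gauss_transfer (mxmeas_mulr (block_mx U 0 0 V)) gZ gZ').
have := std_gauss_row_mx (iU _ _ _ _ (std_gauss_lsub gZ)) (iV _ _ _ _ (std_gauss_rsub gZ)).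
apply: eq_std_gauss => w /=.
by rewrite mul_row_block !mulmx0 addr0 add0r.
Qed.

Lemma gammaN (B : set R) : measurable B -> gamma (-%R @^-1` B) = gamma B.
Proof.
move=> mB.
have mI (A : set R) : measurable A -> gamma A = (\int[gamma]_x (\1_A x)%:E)%E.
  exact: (measure_int_indic (normal_prob 0 1)).
have mN : measurable (-%R @^-1` B).
  by rewrite -[X in measurable X]setTI; exact: oppr_measurable.
have m1 : measurable_fun setT (fun x : R => (\1_B x : R)%:E) by exact/measurable_EFinP.
have p1 (x : R) : (0 <= (\1_B x : R)%:E)%E by rewrite lee_fin.
by rewrite (mI _ mN) (mI _ mB) -[RHS](ge0_integral_gaussN m1 p1).
Qed.

Lemma row_invN : row_inv ((-1)%:M : 'M[R]_1).
Proof.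
move=> d O P Z gZ.
apply: (std_gauss_transfer (mxmeas_mulr (-1)%:M) gZ (std_gauss_const R)).
split.
  move=> i j; under eq_fun do rewrite /= mul_mx_scalar !mxE mulN1r.
  exact: oppr_measurable.
move=> B mB; rewrite !big_ord1 -(gamma_fin (mB _ _)) -(gammaN (mB 0 0)); congr (gamma _).
apply/seteqP; split => x /=.
  by move=> /(_ 0 0); rewrite mul_mx_scalar !mxE mulN1r.
by move=> h i j; rewrite !ord1 mul_mx_scalar !mxE mulN1r.
Qed.

Definition rot_mx (c s : R) : 'M[R]_(1 + 1) :=
  block_mx c%:M (- s)%:M s%:M c%:M.

Lemma rot_mxM c s c' s' :
  rot_mx c s *m rot_mx c' s' = rot_mx (c * c' - s * s') (c * s' + s * c').
Proof.
rewrite /rot_mx mulmx_block -!scalar_mxM -!raddfD/=.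
by congr block_mx; congr (_%:M); ring.
Qed.

Lemma rot_mx_orth c s : c ^+ 2 + s ^+ 2 = 1 -> orthmx (rot_mx c s).
Proof.
move=> cs; rewrite /orthmx /rot_mx tr_block_mx !tr_scalar_mx mulmx_block -!scalar_mxM -!raddfD/=.
have -> : c * c + s * s = 1 by rewrite -cs; ring.
have -> : c * - s + s * c = 0 by ring.
have -> : - s * c + c * s = 0 by ring.
have -> : - s * - s + c * c = 1 by rewrite -cs; ring.
by rewrite !raddf0 -scalar_mx_block.
Qed.

Lemma rot_mx_tr c s : (rot_mx c s)^T = rot_mx c (- s).
Proof. by rewrite /rot_mx tr_block_mx !tr_scalar_mx opprK. Qed.

(** On the product of two one-dimensional normal laws this is [gauss_rotate] applied to the
    indicator of a rectangle. *)
Lemma row_inv_rot_neq0 c s : c != 0 -> c ^+ 2 + s ^+ 2 = 1 -> row_inv (rot_mx c s).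
Proof.
move=> c0 cs d O P Z gZ.
have gZ' := std_gauss_row_mx (std_gauss_const R) (std_gauss_const R).
apply: (std_gauss_transfer (mxmeas_mulr (rot_mx c s)) gZ gZ').
have E (z : R * R) : row_mx (const_mx z.1 : 'M[R]_1) (const_mx z.2 : 'M[R]_1) *m rot_mx c s =
    row_mx (const_mx (c * z.1 + s * z.2)) (const_mx (- s * z.1 + c * z.2)).
  rewrite /rot_mx mul_row_block !mul_mx_scalar; congr row_mx; apply/matrixP => i j; rewrite !mxE//.
have m1 : measurable_fun setT (fun z : R * R => c * z.1 + s * z.2).
  by apply: measurable_funD; apply: measurable_funM.
have m2 : measurable_fun setT (fun z : R * R => - s * z.1 + c * z.2).
  by apply: measurable_funD; apply: measurable_funM.
split.
  move=> i j; under eq_fun do rewrite /= E mxE.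
  case: (fintype.split j) => k; under eq_fun do rewrite mxE.
    exact: m1.
  exact: m2.
move=> B mB.
set B0 := B 0 (lshift 1 0); set B1 := B 0 (rshift 1 0).
have mB01 : measurable (B0 `*` B1) by apply: measurableX; exact: mB.
transitivity (prod_prob gamma gamma (B0 `*` B1)); last first.
  transitivity (gamma B0 * gamma B1)%E; first by apply: prod_probX; exact: mB.
  rewrite big_ord1 big_split_ord/= !big_ord1 EFinM -!gamma_fin//; exact: mB.
pose rot (z : R * R) := (c * z.1 + s * z.2, - s * z.1 + c * z.2).
have mrot : measurable_fun setT rot by apply/measurable_fun_pair.
have -> : ((fun M => M *m rot_mx c s) \o (fun w : R * R => row_mx (const_mx w.1 : 'M[R]_1) (const_mx w.2 : 'M[R]_1))) @^-1` mx_box B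
   = rot @^-1` (B0 `*` B1).
  apply/seteqP; split => z /=; rewrite E.
    by move=> h; split; [have := h 0 (lshift 1 0)|have := h 0 (rshift 1 0)];
      rewrite ?row_mxEl ?row_mxEr mxE.
  move=> [h1 h2] i j; rewrite (ord1 i) mxE; case: splitP => k jk; rewrite mxE (ord1 k) in jk *.
    by have -> : j = lshift 1 0 by exact: val_inj.
  by have -> : j = rshift 1 0 by exact: val_inj.
have mA : measurable (rot @^-1` (B0 `*` B1)).
  by rewrite -[X in measurable X]setTI; exact: mrot.
have pI (A : set (R * R)) : measurable A ->
    prod_prob gamma gamma A = (\int[gamma]_x \int[gamma]_y (\1_A (x, y))%:E)%E.
  move=> mA'; have m3 : measurable_fun setT (fun z : R * R => (\1_A z : R)%:E) by exact/measurable_EFinP.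
  have p3 (z : R * R) : (0 <= (\1_A z : R)%:E)%E by rewrite lee_fin.
  transitivity (\int[prod_prob gamma gamma]_z (\1_A z)%:E)%E.
    exact: (measure_int_indic (prod_prob gamma gamma) mA').
  exact: (@ge0_integral_prod_prob _ _ _ _ _ gamma gamma _ m3 p3).
refine (etrans (pI _ mA) (etrans _ (esym (pI _ mB01)))).
have m4 : measurable_fun setT (fun z : R * R => (\1_(B0 `*` B1) z : R)%:E) by exact/measurable_EFinP.
have p4 (z : R * R) : (0 <= (\1_(B0 `*` B1) z : R)%:E)%E by rewrite lee_fin.
rewrite -(gauss_rotate c0 cs m4 p4); apply: eq_integral => x _; apply: eq_integral => y _.
by rewrite !indicE.
Qed.

(** For [c = 0] the rotation is a quarter turn, hence the square of an eighth turn, whose cosine is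
    not 0. *)
Lemma row_inv_rot c s : c ^+ 2 + s ^+ 2 = 1 -> row_inv (rot_mx c s).
Proof.
move=> cs; have [c0|c0] := eqVneq c 0; last exact: row_inv_rot_neq0.
pose k : R := (Num.sqrt 2)^-1.
have k0 : k != 0 by rewrite invr_eq0 gt_eqF// sqrtr_gt0.
have k2 : k ^+ 2 = 1 / 2 by rewrite /k exprVn sqr_sqrtr// mul1r.
have s2 : s ^+ 2 = 1 by rewrite -cs c0; ring.
have -> : rot_mx c s = rot_mx k (s * k) *m rot_mx k (s * k).
  rewrite rot_mxM c0; congr rot_mx.
    by transitivity (k ^+ 2 * (1 - s ^+ 2)); [rewrite s2; ring|ring].
  by transitivity (s * (2 * k ^+ 2)); [rewrite k2; field|ring].
have ks : k ^+ 2 + (s * k) ^+ 2 = 1 by rewrite exprMn s2 k2; field.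
by apply: row_invM; exact: row_inv_rot_neq0.
Qed.

(** A reflection of all coordinates but the first leaves only two nonzero coordinates, and a planar
    rotation merges them into one. The reflection acts in dimension [b], where invariance is
    assumed. In dimension one a sign suffices. *)
Lemma row_inv_to_e0 b (a : 'cV[R]_(1 + b)) : sqn a = 1 ->
  (forall U : 'M[R]_b, orthmx U -> row_inv U) ->
  exists V : 'M[R]_(1 + b), [/\ orthmx V, row_inv V, row_inv V^T & V *m a = delta_mx ord0 0].
Proof.
case: b a => [|b] a a1 IH.
  have a2 : a ord0 0 ^+ 2 = 1 by rewrite -a1 /sqn big_ord1.
  have aE : a = (a ord0 0)%:M by apply/matrixP => i j; rewrite !ord1 mxE eqxx mulr1n.
  exists (a ord0 0)%:M; rewrite tr_scalar_mx.
  have iv : row_inv ((a ord0 0)%:M : 'M[R]_(1 + 0)).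
    by move/eqP: a2; rewrite sqrf_eq1 => /orP[/eqP->|/eqP->]; [exact: row_inv1|exact: row_invN].
  split => //.
  - by rewrite /orthmx tr_scalar_mx -scalar_mxM -expr2 a2.
  - rewrite [X in _ *m X]aE -scalar_mxM -expr2 a2.
    by apply/matrixP => i j; rewrite !ord1 !mxE.
set r0 := a ord0 0; set r' : 'cV[R]_(1 + b) := dsubmx a; set t := enorm r'.
have rt : r0 ^+ 2 + t ^+ 2 = 1.
  rewrite -a1 /t enorm_sqr /sqn [RHS](@big_split_ord _ _ _ 1 (1 + b))/= big_ord1.
  congr (_ ^+ 2 + _); first by congr (a _ _); exact: val_inj.
  by apply: eq_bigr => i _; rewrite mxE.
have [H oH Hr] := householder r' ord0.
pose G : 'M[R]_(1 + 1 + b) := block_mx (rot_mx r0 (- t)) 0 0 1%:M.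
pose W : 'M[R]_(1 + (1 + b)) := block_mx 1%:M 0 0 H.
have oG : orthmx G.
  by apply: orthmx_block; [apply: rot_mx_orth; rewrite sqrrN|exact: orthmx1].
have oW : orthmx W by apply: orthmx_block => //; exact: orthmx1.
have iG : row_inv G.
  by apply: row_inv_block; [apply: row_inv_rot; rewrite sqrrN|exact: row_inv1].
have iGT : row_inv G^T.
  rewrite /G tr_block_mx !trmx0 rot_mx_tr opprK trmx1.
  by apply: row_inv_block; [exact: row_inv_rot|exact: row_inv1].
have iW : row_inv W.
  by apply: row_inv_block; [exact: row_inv1|exact: IH].
have iWT : row_inv W^T.
  by rewrite /W tr_block_mx !trmx0 trmx1; apply: row_inv_block; [exact: row_inv1|apply: IH; exact: orthmx_tr].
exists ((G : 'M[R]_(1 + (1 + b))) *m W); split.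
- exact: orthmxM.
- exact: row_invM.
- by rewrite trmx_mul; exact: row_invM.
have Wa : W *m a = col_mx r0%:M (t *: delta_mx ord0 0).
  rewrite -[a]vsubmxK mul_block_col !mul0mx !mul1mx addr0 add0r Hr; congr col_mx.
  by apply/matrixP => i j; rewrite !ord1 !mxE mulr1n; congr (a _ _); exact: val_inj.
rewrite -mulmxA Wa.
have -> : (col_mx r0%:M (t *: delta_mx ord0 0) : 'cV[R]_(1 + (1 + b))) =
    (col_mx (col_mx r0%:M t%:M) 0 : 'cV[R]_(1 + 1 + b)).
  apply/colP => i; rewrite !mxE.
  case: splitP => j ij; case: splitP => k ik; rewrite !mxE.
  - case: splitP => j' jj'; rewrite !mxE ?ord1//.
    by move: ik; rewrite ij jj' ord1.
  - by move: ik; rewrite ij ord1.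
  - case: splitP => j' jj'; rewrite !mxE.
      by move: ik; rewrite ij jj' ord1.
    have -> : j = ord0 by apply: val_inj; move: ik; rewrite ij jj' ord1 /= !add1n => -[].
    by rewrite !ord1 eqxx mulr1.
  - have /negbTE-> : j != ord0.
      by apply/negP => /eqP jj; move: ik; rewrite ij jj.
    by rewrite mulr0.
have -> : G *m col_mx (col_mx r0%:M t%:M) 0 = col_mx (rot_mx r0 (- t) *m col_mx r0%:M t%:M) 0.
  by rewrite /G mul_block_col mulmx0 addr0 mul0mx mulmx0 addr0.
rewrite /rot_mx mul_block_col -!scalar_mxM -!raddfD/= opprK.
have -> : r0 * r0 + t * t = 1 by rewrite -rt; ring.
have -> : - t * r0 + r0 * t = 0 by ring.
apply/colP => i; rewrite !mxE.
case: splitP => j ij; rewrite !mxE.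
  case: splitP => k jk; rewrite !mxE.
    have -> : i = ord0 by apply: ord_inj; rewrite ij jk ord1.
    by rewrite !ord1 !eqxx.
  have /negbTE-> : i != ord0 by apply/negP => /eqP ii; move: ij; rewrite ii jk.
  by rewrite mul0rn.
have /negbTE-> : i != ord0 by apply/negP => /eqP ii; move: ij; rewrite ii.
by [].
Qed.

(** If [V] takes the first row of [U] to the first basis vector, then [U V^T] fixes that vector. It
    is therefore block diagonal with an orthogonal block of smaller size, to which the induction
    applies. *)
Lemma orth_row_inv b (U : 'M[R]_b) : orthmx U -> row_inv U.
Proof.
elim: b U => [|b IH] U oU.
  by rewrite (_ : U = 1%:M); [exact: row_inv1|apply/matrixP => -[]].
have [hU hU'] := orthmxP oU.
pose a : 'cV[R]_(1 + b) := (row ord0 U)^T.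
have a1 : sqn a = 1.
  have := congr1 (fun M : 'M[R]_b.+1 => M ord0 ord0) hU'; rewrite !mxE eqxx => E; apply: etrans E.
  by rewrite /sqn; apply: eq_bigr => i _; rewrite /a !mxE expr2.
have [V [oV iV iVT Va]] := row_inv_to_e0 a1 IH.
pose B : 'M[R]_(1 + b) := (U : 'M[R]_(1 + b)) *m V^T.
have oB : orthmx B by apply: orthmxM => //; exact: orthmx_tr.
have [hB hB'] := orthmxP oB.
have BT0 : B^T *m delta_mx ord0 0 = delta_mx ord0 0 :> 'cV[R]_(1 + b).
  rewrite /B trmx_mul trmxK -mulmxA -[RHS]Va; congr (V *m _).
  by rewrite -colE /a tr_row.
have l0 : lshift b (0 : 'I_1) = ord0 :> 'I_(1 + b) by exact: ord_inj.
have B0 j : B ord0 j = (j == ord0)%:R.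
  have := congr1 (fun M : 'cV[R]_(1 + b) => M j 0) BT0.
  by rewrite -colE !mxE eqxx andbT.
have BT0' : B *m delta_mx ord0 0 = delta_mx ord0 0 :> 'cV[R]_(1 + b).
  by rewrite -{1}BT0 mulmxA hB' mul1mx.
have B0' j : B j ord0 = (j == ord0)%:R.
  have := congr1 (fun M : 'cV[R]_(1 + b) => M j 0) BT0'.
  by rewrite -colE !mxE eqxx andbT.
have UE : U = B *m V by have [hV _] := orthmxP oV; rewrite /B -mulmxA hV mulmx1.
clearbody B.
have BE : B = block_mx 1%:M 0 0 (drsubmx B).
  rewrite -[LHS]submxK; congr block_mx; apply/matrixP => i j.
  - by rewrite !ord1 !mxE l0 B0.
  - by rewrite !ord1 !mxE l0 B0.
  - by rewrite !ord1 !mxE l0 B0'.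
have oD : orthmx (drsubmx B).
  move: hB; rewrite BE tr_block_mx mulmx_block !trmx0 !mul0mx !mulmx0 !add0r.
  rewrite scalar_mx_block => /eq_block_mx[_ _ _ h].
  by rewrite /orthmx block_mxKdr h.
have iB : row_inv B.
  rewrite BE; apply: (@row_inv_block 1 b); [exact: row_inv1|exact: IH].
by rewrite UE; exact: row_invM.
Qed.

Lemma std_gauss_col_mx d (O : measurableType d) (P : probability O R)
    d' (O' : measurableType d') (P' : probability O' R) a b c
    (Z : O -> 'M[R]_(a, c)) (Z' : O' -> 'M[R]_(b, c)) :
  std_gauss P Z -> std_gauss P' Z' ->
  std_gauss (prod_prob P P') (fun w => col_mx (Z w.1) (Z' w.2)).
Proof.
move=> gZ gZ'.
have := std_gauss_tr (std_gauss_row_mx (std_gauss_tr gZ) (std_gauss_tr gZ')).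
by apply: eq_std_gauss => w; rewrite tr_row_mx !trmxK.
Qed.

Lemma std_gauss_usub d (O : measurableType d) (P : probability O R) a b c
  (Z : O -> 'M[R]_(a + b, c)) : std_gauss P Z -> std_gauss P (fun w => usubmx (Z w)).
Proof.
move=> gZ; have := std_gauss_tr (std_gauss_lsub (std_gauss_tr gZ)).
by apply: eq_std_gauss => w; rewrite -trmx_usub trmxK.
Qed.

Lemma std_gauss_dsub d (O : measurableType d) (P : probability O R) a b c
  (Z : O -> 'M[R]_(a + b, c)) : std_gauss P Z -> std_gauss P (fun w => dsubmx (Z w)).
Proof.
move=> gZ; have := std_gauss_tr (std_gauss_rsub (std_gauss_tr gZ)).
by apply: eq_std_gauss => w; rewrite -trmx_dsub trmxK.
Qed.

(** The rows are independent, so the invariance of one row is applied to them one at a time. *)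
Lemma std_gauss_mulr d (O : measurableType d) (P : probability O R) a b
    (Z : O -> 'M[R]_(a, b)) (U : 'M[R]_b) :
  orthmx U -> std_gauss P Z -> std_gauss P (fun w => Z w *m U).
Proof.
move=> oU; elim: a Z => [|a IH] Z gZ; first exact: std_gauss_mx0.
have gu := std_gauss_usub (gZ : @std_gauss R _ O P (1 + a) b Z).
have gd := std_gauss_dsub (gZ : @std_gauss R _ O P (1 + a) b Z).
have gZ' := std_gauss_col_mx gu gd.
apply: (std_gauss_transfer (mxmeas_mulr (a := 1 + a) U) gZ gZ').
have := std_gauss_col_mx (orth_row_inv oU gu) (IH _ gd).
by apply: eq_std_gauss => w /=; rewrite mul_col_mx.
Qed.

Lemma std_gauss_mull d (O : measurableType d) (P : probability O R) a b
    (Z : O -> 'M[R]_(a, b)) (U : 'M[R]_a) :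
  orthmx U -> std_gauss P Z -> std_gauss P (fun w => U *m Z w).
Proof.
move=> oU gZ; have := std_gauss_tr (std_gauss_mulr (orthmx_tr oU) (std_gauss_tr gZ)).
by apply: eq_std_gauss => w; rewrite trmx_mul !trmxK.
Qed.

End orthogonal_invariance.

(** * Moments of the norm of a Gaussian vector *)

Section half_line_integrals.
Variable R : realType.
Notation leb := (@lebesgue_measure R).
Notation D := (`[0%R, +oo[%classic : set R).

Lemma integral_patch_half (f : R -> R) :
  (\int[leb]_s ((\1_D s)%:E * (f s)%:E) = \int[leb]_(s in D) (f s)%:E)%E.
Proof.
rewrite [RHS]integral_mkcond; apply: eq_integral => s _.
by rewrite patchE indicE; case: ifPn => _; rewrite ?mul1e ?mul0e.
Qed.

Lemma integral_half_line_expR (y : R) : 0 < y ->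
  (\int[leb]_s ((\1_D s)%:E * (expR (- (s * y)))%:E) = (y^-1)%:E)%E.
Proof.
move=> y0; rewrite integral_patch_half.
have dF (x : R) : is_derive x (1 : R) (fun s => (- y^-1) * expR (- (s * y))) (expR (- (x * y))).
  have d1 : is_derive x (1 : R) (fun s => s * - y) (- y).
    have := @is_deriveM R R id (cst (- y)) x 1 1 0 (is_derive_id _ _) (is_derive_cst _ _ _).
    by rewrite /= scaler0 add0r scaler1.
  have d2 : is_derive x (1 : R) (fun s => expR (- (s * y))) (expR (- (x * y)) * - y).
    have -> : (fun s => expR (- (s * y))) = expR \o (fun s => s * - y).
      by apply/funext => s /=; rewrite mulrN.
    apply: (trigger_derive (@is_derive1_comp R expR _ x _ _ (is_derive_expR _) d1)).
    by congr (expR _ * _); rewrite mulrN.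
  apply: (trigger_derive (is_deriveZ (- y^-1) d2)).
  by rewrite /GRing.scale /=; field; rewrite gt_eqF.
rewrite (@ge0_continuous_FTC2y _ _ (fun s => (- y^-1) * expR (- (s * y))) _ 0)//.
- by rewrite mul0r oppr0 expR0 mulr1 EFinN oppeK add0e.
- by apply: continuous_subspaceT => x; apply: continuous_comp; [apply: cvgN; apply: cvgMl|exact: continuous_expR].
- rewrite -(mulr0 (- y^-1)); apply: cvgMr.
  apply: (@cvg_comp _ _ _ (fun s => s * y) (fun z => expR (- z)) _ (pinfty_nbhs R)); last exact: cvgr_expR.
  exact: gt0_cvgMly.
- apply: cvg_at_right_filter; apply: cvgMr.
  by apply: continuous_comp; [apply: cvgN; apply: cvgMl|exact: continuous_expR].
- by move=> x _; rewrite derive1E (@derive_val _ _ _ _ _ _ _ (dF x)).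
Qed.

Lemma integral_half_line_pow (c : R) (p : nat) : 0 < c -> (0 < p)%N ->
  (\int[leb]_s ((\1_D s)%:E * ((c + 2 * s) ^- p.+1)%:E) =
   (c ^- p / (2 * p%:R))%:E)%E.
Proof.
move=> c0 p0; rewrite integral_patch_half.
pose F s : R := (- (2 * p%:R)^-1) * (c + 2 * s)^-1 ^+ p.
have pos (x : R) : 0 <= x -> 0 < c + 2 * x.
  by move=> x0; rewrite ltr_pwDl// mulr_ge0.
have dF (x : R) : 0 <= x -> is_derive x (1 : R) F ((c + 2 * x) ^- p.+1).
  move=> /pos x0; have d1 : is_derive x (1 : R) (fun s => c + 2 * s) (0 + 2 * 1).
    apply: is_deriveD; apply: is_deriveZ.
  have d2 := @is_deriveV R (fun s => c + 2 * s) x _ _ (lt0r_neq0 x0) d1.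
  have := is_deriveZ (- (2 * p%:R)^-1) (is_deriveX p d2).
  rewrite (_ : _ \*: _ = F); last by apply/funext => s; rewrite /F /= exprfctE.
  move=> /trigger_derive; apply; rewrite /GRing.scale /=.
  move: p0 x0; case: (p) => // p' _ x0; rewrite /= exprVn !exprS add0r.
  by field; rewrite !(expf_neq0, pnatr_eq0, gt_eqF).
have cI (x : R) : 0 <= x -> (c + 2 * y)^-1 @[y --> x] --> (c + 2 * x)^-1.
  move=> x0; apply: cvgV; first by rewrite gt_eqF// pos.
  by apply: cvgD; [exact: cvg_cst|apply: cvgMr; exact: cvg_id].
have cP (x : R) k : 0 <= x -> (c + 2 * y)^-1 ^+ k @[y --> x] --> (c + 2 * x)^-1 ^+ k.
  move=> x0; apply: (@cvg_comp _ _ _ (fun y => (c + 2 * y)^-1) (fun z => z ^+ k) _ _ _ (cI x x0)).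
  exact: exprn_continuous.
rewrite (@ge0_continuous_FTC2y _ _ F _ 0)//.
- by rewrite /F mulr0 addr0 sub0e -EFinN mulNr opprK mulrC exprVn.
- by move=> x x0; rewrite invr_ge0 exprn_ge0// ltW// pos.
- apply: continuous_in_subspaceT => x; rewrite inE/= in_itv/= andbT => x0.
  have := cP x p.+1 x0; rewrite exprVn => h; apply: cvg_trans h.
  by apply: near_eq_cvg; apply: nearW => y; rewrite exprVn.
- rewrite -(mulr0 (- (2 * p%:R)^-1)); apply: cvgMr.
  rewrite -[X in _ --> X](_ : 0 ^+ p = 0); last by rewrite expr0n gtn_eqF.
  apply: (@cvg_comp _ _ _ (fun y => (c + 2 * y)^-1) (fun z => z ^+ p) _ (nbhs (0 : R))); last exact: exprn_continuous.
  apply/gtr0_cvgV0; last first.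
    apply: (@cvg_comp _ _ _ (fun y => 2 * y) (fun z => c + z) _ (pinfty_nbhs R)); last exact: cvg_addrl.
    by apply: gt0_cvgMry.
  by near=> y; apply: pos; near: y; apply: nbhs_pinfty_ge; rewrite num_real.
- by move=> x x0; exact: (@ex_derive _ _ _ _ _ _ _ (dF x (ltW x0))).
- by apply: cvg_at_right_filter; apply: cvgMr; apply: cP.
- move=> x; rewrite in_itv/= andbT => x0.
  by rewrite derive1E (@derive_val _ _ _ _ _ _ _ (dF x (ltW x0))).
Unshelve. all: by end_near. Qed.

End half_line_integrals.

(** * Integration over independent blocks *)

Section gaussian_fubini.
Variable R : realType.
Notation gamma := (normal_prob (0 : R) (1 : R)).
Context d (O : measurableType d) (P : probability O R).

(** Drawing the right block from a second copy of the space does not change the joint law, and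
    Tonelli's theorem separates the two draws. *)
Lemma std_gauss_fubini_row a b c (Z : O -> 'M[R]_(a, b + c))
    (F : mxT R a (b + c) -> \bar R) :
  std_gauss P Z -> measurable_fun setT F -> (forall M, 0 <= F M)%E ->
  (\int[P]_w F (Z w) =
   \int[P]_w \int[P]_w' F (row_mx (lsubmx (Z w)) (rsubmx (Z w'))))%E.
Proof.
move=> gZ mF F0.
have gZ2 := std_gauss_row_mx (std_gauss_lsub gZ) (std_gauss_rsub gZ).
transitivity (\int[prod_prob P P]_z F (row_mx (lsubmx (Z z.1)) (rsubmx (Z z.2))))%E.
  exact: (std_gauss_integral gZ gZ2 mF F0).
have mG : measurable_fun setT (fun z : O * O => F (row_mx (lsubmx (Z z.1)) (rsubmx (Z z.2)))).
  exact: (measurableT_comp mF (mxmeas_measurable gZ2.1)).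
exact: (ge0_integral_prod_prob P P mG (fun _ => F0 _)).
Qed.

Lemma std_gauss_fubini_col a b c (Z : O -> 'M[R]_(a + b, c))
    (F : mxT R (a + b) c -> \bar R) :
  std_gauss P Z -> measurable_fun setT F -> (forall M, 0 <= F M)%E ->
  (\int[P]_w F (Z w) =
   \int[P]_w \int[P]_w' F (col_mx (usubmx (Z w)) (dsubmx (Z w'))))%E.
Proof.
move=> gZ mF F0.
have gZ2 := std_gauss_col_mx (std_gauss_usub gZ) (std_gauss_dsub gZ).
transitivity (\int[prod_prob P P]_z F (col_mx (usubmx (Z z.1)) (dsubmx (Z z.2))))%E.
  exact: (std_gauss_integral gZ gZ2 mF F0).
have mG : measurable_fun setT (fun z : O * O => F (col_mx (usubmx (Z z.1)) (dsubmx (Z z.2)))).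
  exact: (measurableT_comp mF (mxmeas_measurable gZ2.1)).
exact: (ge0_integral_prod_prob P P mG (fun _ => F0 _)).
Qed.

Lemma std_gauss_integral_entry (Z : O -> 'M[R]_1) (f : R -> \bar R) :
  std_gauss P Z -> measurable_fun setT f -> (forall x, 0 <= f x)%E ->
  (\int[P]_w f (Z w ord0 ord0) = \int[gamma]_x f x)%E.
Proof.
move=> gZ mf f0.
have mF : measurable_fun setT (fun M : mxT R 1 1 => f ((M : 'M[R]_1) ord0 ord0)).
  by apply: (measurableT_comp mf); exact: mxmeas_id.
rewrite (std_gauss_integral gZ (std_gauss_const R) mF (fun=> f0 _)).
by apply: eq_integral => x _; rewrite mxE.
Qed.

Lemma integral_prob_cst (r : R) : (\int[P]_w r%:E = r%:E)%E.
Proof.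
rewrite integral_cst; last exact: measurableT.
transitivity (r%:E * 1)%E; last by rewrite mule1.
by congr (_ * _)%E; exact: probability_setT.
Qed.
End gaussian_fubini.

Section gaussian_products.
Variable R : realType.
Notation gamma := (normal_prob (0 : R) (1 : R)).
Context d (O : measurableType d) (P : probability O R).
Variables (f : R -> R) (c : R).
Hypotheses (mf : measurable_fun setT f) (f0 : forall x, 0 <= f x)
  (fc : (\int[gamma]_x (f x)%:E = c%:E)%E).

Lemma std_gauss_prod N (z : O -> 'cV[R]_N) : std_gauss P z ->
  (\int[P]_w (\prod_i f (z w i ord0))%:E = (c ^+ N)%:E)%E.
Proof.
elim: N z => [|N IH] z gz.
  by under eq_integral do rewrite big_ord0; rewrite integral_prob_cst.
have mF : measurable_fun setT
    (fun M : mxT R (1 + N) 1 => (\prod_i f ((M : 'cV[R]_(1 + N)) i ord0))%:E).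
  apply/measurable_EFinP; apply: measurable_prodr => i.
  by apply: (measurableT_comp mf); exact: mxmeas_id.
have F0 (M : mxT R (1 + N) 1) : (0 <= (\prod_i f ((M : 'cV[R]_(1 + N)) i ord0))%:E)%E.
  by rewrite lee_fin; apply: prodr_ge0.
rewrite (@std_gauss_fubini_col _ _ _ _ 1 N 1 z _ gz mF F0).
have gd := @std_gauss_dsub R d O P 1 N 1 z gz.
have gu := @std_gauss_usub R d O P 1 N 1 z gz.
have mf' : measurable_fun setT (EFin \o f) by exact/measurable_EFinP.
have mp : measurable_fun setT (fun w => (\prod_i f (dsubmx (z w : 'cV[R]_(1 + N)) i ord0))%:E).
  apply/measurable_EFinP; apply: measurable_prodr => i.
  by apply: (measurableT_comp mf); exact: gd.1.
have p0 w : (0 <= (\prod_i f (dsubmx (z w : 'cV[R]_(1 + N)) i ord0))%:E)%E.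
  by rewrite lee_fin; apply: prodr_ge0.
transitivity (\int[P]_w ((f (usubmx (z w : 'cV[R]_(1 + N)) ord0 ord0))%:E * (c ^+ N)%:E))%E.
  apply: eq_integral => w _.
  rewrite -(IH _ gd) -(ge0_integralZl P measurableT mp (fun w _ => p0 w))//; last by rewrite lee_fin.
  apply: eq_integral => w' _; rewrite -EFinM; congr EFin.
  rewrite big_split_ord big_ord1 col_mxEu; congr (_ * _).
  by apply: eq_bigr => i _; rewrite col_mxEd.
have mu' : measurable_fun setT (fun w => (f (usubmx (z w : 'cV[R]_(1 + N)) ord0 ord0))%:E).
  by apply: (measurableT_comp mf'); exact: gu.1.
have c0 : 0 <= c.
  by rewrite -lee_fin -fc; apply: integral_ge0 => x _; rewrite lee_fin.
have u0 w : (0 <= (f (usubmx (z w : 'cV[R]_(1 + N)) ord0 ord0))%:E)%E by rewrite lee_fin.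
rewrite (ge0_integralZr P measurableT mu' (fun w _ => u0 w)); last by rewrite lee_fin exprn_ge0.
have f0' x : (0 <= (EFin \o f) x)%E by rewrite lee_fin.
have E := std_gauss_integral_entry gu mf' f0'.
rewrite [X in (X * _)%E]E.
by rewrite [X in (X * _)%E]fc -EFinM -exprS.
Qed.
End gaussian_products.

(** * Positive and negative moments of the squared norm *)

Section gaussian_norm_moments.
Variable R : realType.
Notation gamma := (normal_prob (0 : R) (1 : R)).
Notation leb := (@lebesgue_measure R).
Notation D := (`[0%R, +oo[%classic : set R).
Context d (O : measurableType d) (P : probability O R).

Lemma std_gauss_mgf_sqn N (z : O -> 'cV[R]_N) (t : R) : std_gauss P z -> t < 1 / 2 ->
  (\int[P]_w (expR (t * sqn (z w)))%:E = ((Num.sqrt (1 - 2 * t))^-1 ^+ N)%:E)%E.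
Proof.
move=> gz t12.
have mf : measurable_fun setT (fun x : R => expR (t * x ^+ 2)).
  apply: measurableT_comp; first exact: measurable_expR.
  by apply: measurable_funM; [exact: measurable_cst|exact: measurable_funX].
rewrite -(std_gauss_prod mf (fun x => expR_ge0 _) (gauss_mgf_sqr t12) gz).
apply: eq_integral => w _; congr EFin.
by rewrite -expR_sum /sqn mulr_sumr.
Qed.

(** With [K = N + 2m] and [t = m / K], the inequality [1 + u <= exp u] at [u = y / K - 1] gives
    [y^m <= K^m exp(t y - m)]. The moment generating function then leaves the factor
    [exp(-m) (K / N)^(N/2)], at most 1 because [K / N = 1 + 2m / N <= exp(2m / N)]. *)
Lemma std_gauss_sqn_moment N m (z : O -> 'cV[R]_N) : std_gauss P z -> (0 < N)%N ->
  (\int[P]_w ((sqn (z w) ^+ m)%:E) <= ((N + 2 * m)%:R ^+ m)%:E)%E.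
Proof.
move=> gz N0.
set K : R := (N + 2 * m)%:R.
have N0' : 0 < N%:R :> R by rewrite ltr0n.
have K0 : 0 < K by rewrite ltr0n addn_gt0 N0.
have KE : K = N%:R + 2 * m%:R by rewrite /K natrD natrM.
set t : R := m%:R / K.
have t12 : t < 1 / 2.
  by rewrite ltr_pdivrMr// KE; lra.
have ms : measurable_fun setT (fun w => sqn (z w)) by apply: measurable_sqn; exact: gz.1.
have m1 : measurable_fun setT (fun w => (sqn (z w) ^+ m)%:E).
  by apply/measurable_EFinP; exact: measurable_funX.
have m2 : measurable_fun setT (fun w => (expR (t * sqn (z w)))%:E).
  apply/measurable_EFinP; apply: measurableT_comp; first exact: measurable_expR.
  by apply: measurable_funM; [exact: measurable_cst|].
pose c : R := K ^+ m * expR (- m%:R).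
have c0 : 0 <= c by rewrite mulr_ge0 ?expR_ge0// exprn_ge0// ltW.
have le1 w : (((sqn (z w) ^+ m)%:E) <= c%:E * (expR (t * sqn (z w)))%:E)%E.
  rewrite -EFinM lee_fin /c -mulrA -expRD.
  have s0 := sqn_ge0 (z w); move: (sqn _) s0 => y y0.
  rewrite -[y in y ^+ m](divfK (lt0r_neq0 K0)) exprMn mulrC ler_pM2l ?exprn_gt0//.
  have -> : - m%:R + t * y = (y / K - 1) * m%:R by rewrite /t; ring.
  rewrite expRM_natr lerXn2r ?nnegrE ?expR_ge0 ?divr_ge0 ?(ltW K0)//.
  by have := expR_ge1Dx (y / K - 1); rewrite addrC subrK.
apply: (@le_trans _ _ (\int[P]_w (c%:E * (expR (t * sqn (z w)))%:E))%E).
  apply: ge0_le_integral => //.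
  - by move=> w _; rewrite lee_fin exprn_ge0// sqn_ge0.
  - by apply: emeasurable_funM; [exact: measurable_cst|].
have e0 w : (0 <= (expR (t * sqn (z w)))%:E)%E by rewrite lee_fin expR_ge0.
rewrite (ge0_integralZl P measurableT m2 (fun w _ => e0 w))//.
rewrite (std_gauss_mgf_sqn gz t12) -EFinM lee_fin /c -mulrA.
rewrite ler_piMr ?exprn_ge0 ?(ltW K0)//.
rewrite expRN mulrC ler_pdivrMr ?expR_gt0// mul1r.
have -> : m%:R = (m%:R / N%:R) * N%:R :> R by rewrite divfK// gt_eqF.
rewrite expRM_natr lerXn2r ?nnegrE ?expR_ge0 ?invr_ge0 ?sqrtr_ge0//.
have e1 : 1 - 2 * t = N%:R / K.
  have Kn0 := lt0r_neq0 K0; apply: (mulIf Kn0).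
  by rewrite divfK// mulrBl mul1r /t -mulrA divfK// KE; ring.
rewrite e1 -sqrtrV ?divr_ge0 ?(ltW K0) ?(ltW N0')// invf_div.
rewrite -(@ler_sqr _ _ _) ?nnegrE ?sqrtr_ge0 ?expR_ge0// sqr_sqrtr ?divr_ge0 ?(ltW K0) ?(ltW N0')//.
rewrite -expRM_natr.
have -> : K / N%:R = 1 + m%:R / N%:R * 2.
  by rewrite KE; field; rewrite gt_eqF.
exact: expR_ge1Dx.
Qed.

(* At [y = 0] the left-hand side is the junk value 0. *)
Lemma expR_sqr_half_line (a y : R) j : 0 <= y ->
  ((y^-1 ^+ j.+1 * expR (- (a * y)))%:E <=
   \int[leb]_s ((\1_D s)%:E * (y^-1 ^+ j * expR (- ((a + s) * y)))%:E))%E.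
Proof.
move=> y0; have [->|yn0] := eqVneq y 0.
  rewrite invr0 expr0n mul0r; apply: integral_ge0 => s _.
  by rewrite -EFinM lee_fin mulr_ge0 ?mulr_ge0 ?expR_ge0 ?exprn_ge0 ?indicE.
have {}y0 : 0 < y by rewrite lt_neqAle eq_sym yn0.
have mE : measurable_fun setT (fun s : R => ((\1_D s)%:E * (expR (- (s * y)))%:E)%E).
  apply: emeasurable_funM; first by apply/measurable_EFinP; exact: measurable_indic.
  apply/measurable_EFinP; apply: measurableT_comp; first exact: measurable_expR.
  by apply: measurableT_comp => //; apply: measurable_funM.
have E0 s : (0 <= (\1_D s)%:E * (expR (- (s * y)))%:E)%E.
  by rewrite -EFinM lee_fin mulr_ge0 ?expR_ge0 ?indicE.
have -> : (\int[leb]_s ((\1_D s)%:E * (y^-1 ^+ j * expR (- ((a + s) * y)))%:E) =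
    \int[leb]_s ((y^-1 ^+ j * expR (- (a * y)))%:E *
      ((\1_D s)%:E * (expR (- (s * y)))%:E)))%E.
  apply: eq_integral => s _; rewrite -!EFinM; congr EFin.
  by rewrite mulrDl opprD expRD; ring.
rewrite (ge0_integralZl leb measurableT mE (fun s _ => E0 s)); last first.
  by rewrite lee_fin mulr_ge0 ?expR_ge0// exprn_ge0// invr_ge0 ltW.
rewrite integral_half_line_expR// -EFinM lee_fin le_eqVlt; apply/orP; left; apply/eqP.
by rewrite exprS; ring.
Qed.

(** Starts from [E exp(- a |z|^2) = (1 + 2a)^-(m+1)] and integrates over the half line [[a, oo[]
    repeatedly: the step from [j] to [j + 1] produces a factor [1 / |z|^2] on the left, a factor
    [1 / (2 (m - j))] on the right, and lowers the exponent there by one. The even dimension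
    [2m + 2] keeps that exponent an integer, still positive after [m] steps. *)
Lemma std_gauss_neg_moment_rec m (z : O -> 'cV[R]_(2 * m.+1)) (j : nat) (a : R) :
  std_gauss P z -> (j <= m)%N -> 0 <= a ->
  (\int[P]_w ((sqn (z w))^-1 ^+ j * expR (- (a * sqn (z w))))%:E <=
   (((2 ^ j * (m ^_ j))%:R)^-1 * (1 + 2 * a) ^- (m.+1 - j))%:E)%E.
Proof.
move=> gz; elim: j a => [|j IH] a jm a0.
  have aN : - a < 1 / 2 by apply: (@le_lt_trans _ _ 0); rewrite ?oppr_le0// divr_gt0.
  have := std_gauss_mgf_sqn gz aN.
  under eq_integral do rewrite mulNr.
  under [in X in _ -> X]eq_integral do rewrite mul1r.
  move=> ->; rewrite ffactn0 muln1 expn0 invr1 mul1r subn0 lee_fin.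
  rewrite mulrN opprK exprM -exprVn exprVn sqr_sqrtr ?exprVn ?lexx//.
  by rewrite addr_ge0 ?mulr_ge0.
have ms : measurable_fun setT (fun w => sqn (z w)) by apply: measurable_sqn; exact: gz.1.
pose G (x : O * R) : \bar R := ((\1_D x.2)%:E *
  ((sqn (z x.1))^-1 ^+ j * expR (- ((a + x.2) * sqn (z x.1))))%:E)%E.
have mG : measurable_fun setT G.
  apply: emeasurable_funM; apply/measurable_EFinP.
    by apply: measurableT_comp => //; exact: measurable_indic.
  have ms1 : measurable_fun setT (fun x : O * R => sqn (z x.1)).
    exact: (measurableT_comp ms measurable_fst).
  apply: measurable_funM.
    by apply: measurable_funX; apply: measurable_invr.
  apply: measurableT_comp; first exact: measurable_expR.
  apply: measurableT_comp => //; apply: measurable_funM => //.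
  by apply: measurable_funD => //; exact: measurable_snd.
have G0 x : (0 <= G x)%E.
  rewrite /G -EFinM lee_fin mulr_ge0 ?indicE// mulr_ge0 ?expR_ge0//.
  by rewrite exprn_ge0// invr_ge0 sqn_ge0.
apply: (@le_trans _ _ (\int[P]_w \int[leb]_s G (w, s))%E).
  apply: ge0_le_integral => //.
  - by move=> w _; rewrite lee_fin mulr_ge0 ?expR_ge0// exprn_ge0// invr_ge0 sqn_ge0.
  - apply/measurable_EFinP; apply: measurable_funM.
      by apply: measurable_funX; apply: measurable_invr.
    apply: measurableT_comp; first exact: measurable_expR.
    by apply: measurableT_comp => //; apply: measurable_funM.
  - exact: (@measurable_fun_fubini_tonelli_F _ _ _ _ _ leb G mG G0).
  - by move=> w _; exact: expR_sqr_half_line (sqn_ge0 _).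
rewrite (@fubini_tonelli _ _ _ _ _ P leb G mG G0).
pose c : R := ((2 ^ j * (m ^_ j))%:R)^-1.
have c0 : 0 <= c by rewrite invr_ge0.
pose H (s : R) : \bar R := ((\1_D s)%:E * (((1 + 2 * a) + 2 * s) ^- (m - j).+1)%:E)%E.
have mH : measurable_fun setT H.
  apply: emeasurable_funM; apply/measurable_EFinP; first exact: measurable_indic.
  apply: measurable_invr; apply: measurable_funX; exact: measurable_funD.
have H0 s : (0 <= H s)%E.
  rewrite /H indicE; case: (boolP (s \in D)) => [|_]; last by rewrite mul0e.
  rewrite inE/= in_itv/= andbT => s0.
  by rewrite mul1e lee_fin invr_ge0 exprn_ge0// !addr_ge0// mulr_ge0.
apply: (@le_trans _ _ (\int[leb]_s (c%:E * H s))%E).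
  apply: ge0_le_integral => //.
  - by move=> s _; apply: integral_ge0.
  - exact: (@measurable_fun_fubini_tonelli_G _ _ _ _ _ P G mG G0).
  - by apply: emeasurable_funM; [exact: measurable_cst|].
  move=> s _; rewrite /G /H/= indicE; case: (boolP (s \in D)) => [|_]; last first.
    rewrite mul0e mule0; under eq_integral do rewrite mul0e.
    by rewrite integral0.
  rewrite inE/= in_itv/= andbT => s0; rewrite mul1e.
  under eq_integral do rewrite mul1e.
  apply: le_trans (IH _ (ltnW jm) (addr_ge0 a0 s0)) _.
  by rewrite -EFinM lee_fin subSn ?(ltnW jm)// mulrDr addrA lexx.
rewrite (ge0_integralZl leb measurableT mH (fun s _ => H0 s))//.
rewrite integral_half_line_pow ?subn_gt0//; last by rewrite ltr_pwDl// mulr_ge0.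
rewrite -EFinM lee_fin /c subSS ffactnSr expnS le_eqVlt; apply/orP; left; apply/eqP.
by rewrite !natrM !invfM; ring.
Qed.

Lemma std_gauss_neg_moment m (z : O -> 'cV[R]_(2 * m.+1)) : std_gauss P z ->
  (\int[P]_w ((sqn (z w))^-1 ^+ m)%:E <= (((2 ^ m * m`!)%:R)^-1)%:E)%E.
Proof.
move=> gz; have := @std_gauss_neg_moment_rec m z m 0 gz (leqnn _) (lexx _).
rewrite ffactnn mulr0 addr0 expr1n invr1 mulr1.
by under eq_integral do rewrite mul0r oppr0 expR0 mulr1.
Qed.

End gaussian_norm_moments.

(** * The kernel of a Gaussian matrix *)

Section gram_inverse.
Variable R : realType.

Definition gram a b (M : 'M[R]_(a, b)) := M^T *m M.

Lemma gramT a b (M : 'M[R]_(a, b)) : (gram M)^T = gram M.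
Proof. by rewrite /gram trmx_mul trmxK. Qed.

(* Unlike [invmx], this is 0 on singular matrices, so that moments of
   [gram_dual] need no almost sure invertibility. *)
Definition gram_inv b (W : 'M[R]_b) := (\det W)^-1 *: \adj W.

Lemma gram_inv_unit b (W : 'M[R]_b) : W \in unitmx -> gram_inv W = invmx W.
Proof. by rewrite /invmx => ->. Qed.

Lemma gram_inv_nunit b (W : 'M[R]_b) : W \notin unitmx -> gram_inv W = 0.
Proof. by rewrite unitmxE unitfE negbK /gram_inv => /eqP ->; rewrite invr0 scale0r. Qed.

Lemma gram_inv_orth b (H W : 'M[R]_b) : orthmx H ->
  gram_inv (H *m W *m H^T) = H *m gram_inv W *m H^T.
Proof.
move=> oH; have [h1 h2] := orthmxP oH.
have uH : H \in unitmx by case/mulmx1_unit: h2.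
have uHT : H^T \in unitmx by rewrite unitmx_tr.
have [uW|nW] := boolP (W \in unitmx).
  rewrite !gram_inv_unit ?unitmx_mul ?uH ?uW//.
  apply: (can_inj (mulKmx (_ : H *m W *m H^T \in unitmx))).
    by rewrite !unitmx_mul uH uW.
  rewrite mulmxV ?unitmx_mul ?uH ?uW//.
  by rewrite !mulmxA -(mulmxA _ H^T H) h1 mulmx1 mulmxK.
rewrite !gram_inv_nunit ?mulmx0 ?mul0mx//.
by rewrite !unitmx_mul uH (negPf nW).
Qed.

(** For [M] of full column rank, the basis of its column space dual to its columns, that is the
    transposed pseudo-inverse. *)
Definition gram_dual a b (M : 'M[R]_(a, b)) : 'M[R]_(a, b) := M *m gram_inv (gram M).

Lemma gram_dual_orth a b (M : 'M[R]_(a, b)) (H : 'M[R]_b) : orthmx H ->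
  gram_dual (M *m H^T) *m H = gram_dual M.
Proof.
move=> oH; have [h1 h2] := orthmxP oH.
rewrite /gram_dual /gram trmx_mul trmxK !mulmxA -(mulmxA H) gram_inv_orth//.
by rewrite !mulmxA -(mulmxA M) h1 mulmx1 -!mulmxA h1 mulmx1.
Qed.

Lemma tr_gram_dual a b (M : 'M[R]_(a, b)) : gram M \in unitmx ->
  M^T *m gram_dual M = 1%:M.
Proof. by move=> u; rewrite /gram_dual mulmxA gram_inv_unit// mulmxV. Qed.

Lemma gram_kernel a b (M : 'M[R]_(a, b)) (x : 'cV[R]_b) :
  gram M *m x = 0 -> M *m x = 0.
Proof.
move=> h; apply/eqP; rewrite -sqn_eq0 sqnE.
have -> : (M *m x)^T *m (M *m x) = x^T *m (gram M *m x) by rewrite /gram trmx_mul !mulmxA.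
by rewrite h mulmx0 mxE.
Qed.

Lemma unitmx_kernel b (W : 'M[R]_b) :
  (forall x : 'cV[R]_b, W *m x = 0 -> x = 0) -> W \in unitmx.
Proof.
move=> h; rewrite -unitmx_tr -row_free_unit -kermx_eq0; apply/eqP/row_matrixP => i.
rewrite row0; apply: trmx_inj; rewrite trmx0; apply: h.
by apply: trmx_inj; rewrite trmx_mul trmxK trmx0 -row_mul mulmx_ker row0.
Qed.

(** The first row of [H] is orthogonal to the columns of [G]; a nonzero inner product of it with [g]
    shows that [g] lies outside their span. *)
Lemma gram_row_mx_unit l k (G : 'M[R]_(1 + l, k)) (g : 'cV[R]_(1 + l)) (H : 'M[R]_(1 + l)) :
  orthmx H -> (forall j, (H *m G) ord0 j = 0) -> gram G \in unitmx ->
  (H *m g) ord0 ord0 != 0 -> gram (row_mx G g) \in unitmx.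
Proof.
move=> oH hG uG hg; apply: unitmx_kernel => x /gram_kernel.
rewrite -[x]vsubmxK mul_row_col => h.
have := congr1 (fun v : 'cV[R]_(1 + l) => (H *m v) ord0 ord0) h.
rewrite mulmxDr !mulmxA mulmx0 [in RHS]mxE mxE [X in X + _](_ : _ = 0); last first.
  by rewrite mxE big1// => j _; rewrite hG mul0r.
rewrite add0r mxE big_ord1 => /eqP; rewrite mulf_eq0 (negPf hg)/= => /eqP d0.
have dx : dsubmx x = 0 by apply/matrixP => i j; rewrite !ord1 d0 mxE.
move: h; rewrite dx mulmx0 addr0 => h.
suff -> : usubmx x = 0 by rewrite col_mx0.
by rewrite -(mulKmx uG (usubmx x)) /gram -mulmxA h !mulmx0.
Qed.

(* The last column [u] of the dual basis is the shortest vector orthogonal to [G]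
   with [g^T u = 1]; the witness is the top part of [H g], rescaled. *)
Lemma sqn_gram_dual_last s t k (G : 'M[R]_(s + t, k)) (g : 'cV[R]_(s + t)) (H : 'M[R]_(s + t)) :
  orthmx H -> usubmx (H *m G) = 0 -> usubmx (H *m g) != 0 ->
  sqn (gram_dual (row_mx G g) *m delta_mx (rshift k ord0) 0) <= (sqn (usubmx (H *m g)))^-1.
Proof.
move=> oH hG hg; have [h1 h2] := orthmxP oH.
set h := usubmx (H *m g) in hg *.
set M := row_mx G g; set e : 'cV[R]_(k + 1) := delta_mx _ 0.
have [uM|nM] := boolP (gram M \in unitmx); last first.
  rewrite /gram_dual gram_inv_nunit// mulmx0 mul0mx.
  by rewrite [X in X <= _](_ : _ = 0) ?invr_ge0 ?sqn_ge0//; apply/eqP; rewrite sqn_eq0.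
set u := gram_dual M *m e.
have Mu : M^T *m u = e by rewrite mulmxA tr_gram_dual// mul1mx.
set c := (sqn h)^-1.
have h0 : sqn h != 0 by rewrite sqn_eq0.
pose v : 'cV[R]_(s + t) := H^T *m col_mx (c *: h) 0.
have Mv : M^T *m v = e.
  rewrite mulmxA -trmx_mul mul_mx_row tr_row_mx mul_col_mx.
  rewrite -[X in X^T *m _]vsubmxK hG -[H *m g]vsubmxK -/h !tr_col_mx !mul_row_col.
  rewrite !mulmx0 !addr0 trmx0 mul0mx -scalemxAr.
  have -> : h^T *m h = (sqn h)%:M by apply/matrixP => i j; rewrite !ord1 sqnE !mxE eqxx.
  rewrite scale_scalar_mx mulVf//; apply/matrixP => i j; rewrite !mxE ord1.
  case: splitP => i' ii'; rewrite ?ord1 ?mxE/=.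
    by rewrite -val_eqE /= ii' eqn_leq [(_ + _ <= _)%N]leqNgt ltn_addr ?andbF//=.
  by rewrite (_ : i = rshift k 0) ?eqxx//; apply: ord_inj; rewrite ii' ord1.
(* [u] lies in the column space of [M], whose vectors do not distinguish [u] from [v], as
   [M^T u = M^T v]. *)
have uv : sqn u = dot u v.
  rewrite sqnE dotE; congr (_ 0 0).
  by rewrite {1 3}/u /gram_dual -!mulmxA !trmx_mul -!mulmxA Mu Mv.
have sv : sqn v = c.
  rewrite sqn_orth ?orthmx_tr// sqnE tr_col_mx mul_row_col trmx0 mulmx0 addr0 -sqnE sqnZ.
  by rewrite /c expr2 -mulrA mulVf// mulr1.
have := cauchy_schwarz u v; rewrite -uv sv => cs.
have := sqn_ge0 u; rewrite le_eqVlt => /orP[/eqP <-|u0].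
  by rewrite invr_ge0 sqn_ge0.
by rewrite expr2 ler_pM2l in cs.
Qed.

(** Writing [b = Z1^T (gram_dual Z1) b], moving [Z1] onto [w1] and using [Z1 w1 = - Z2 w2] leaves an
    inner product with [w2]. Cauchy-Schwarz then involves the norm of a single random vector. *)
Lemma dot_kernel l k r (Z : 'M[R]_(l, k + r)) (w : 'cV[R]_(k + r)) (b : 'cV[R]_k) :
  gram (lsubmx Z) \in unitmx -> Z *m w = 0 ->
  dot b (usubmx w) ^+ 2 <=
  sqn ((rsubmx Z)^T *m (gram_dual (lsubmx Z) *m b)) * sqn (dsubmx w).
Proof.
move=> u; rewrite -{1}[Z]hsubmxK -{1}[w]vsubmxK mul_row_col.
set Z1 := lsubmx Z in u *; set Z2 := rsubmx Z; set w1 := usubmx w; set w2 := dsubmx w.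
move=> h.
have -> : dot b w1 = - dot (Z2^T *m (gram_dual Z1 *m b)) w2.
  have hw : Z2 *m w2 = - (Z1 *m w1) by apply/eqP; rewrite -addr_eq0 addrC h.
  have -> : dot (Z2^T *m (gram_dual Z1 *m b)) w2 =
      (b^T *m (gram_dual Z1)^T *m (Z2 *m w2)) 0 0.
    by rewrite dotE !trmx_mul trmxK !mulmxA.
  have dZ : (gram_dual Z1)^T *m Z1 = 1%:M.
    by apply: trmx_inj; rewrite trmx_mul trmxK tr_gram_dual// trmx1.
  by rewrite hw mulmxN mulmxA -(mulmxA b^T) dZ mulmx1 [in RHS]mxE opprK dotE.
by rewrite sqrrN cauchy_schwarz.
Qed.
End gram_inverse.

(** * Moments of the dual basis *)

Section gaussian_dual_moments.
Variable R : realType.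
Notation gamma := (normal_prob (0 : R) (1 : R)).

Lemma gamma_set1 (x : R) : gamma [set x] = 0%E.
Proof.
have /null_content_dominatesP h := @normal_prob_dominates R 0 1.
by apply: h; [exact: measurable_set1|exact: lebesgue_measure_set1].
Qed.

Context d (O : measurableType d) (P : probability O R).

Lemma std_gauss_entry0 a b (Z : O -> 'M[R]_(a, b)) i j : std_gauss P Z ->
  P [set w | Z w i j = 0] = 0%E.
Proof.
move=> [mZ hZ].
pose B i' j' : set R := if (i' == i) && (j' == j) then [set 0] else setT.
have mB i' j' : measurable (B i' j').
  by rewrite /B; case: ifP => _ //; exact: measurable_set1.
have -> : [set w | Z w i j = 0] = Z @^-1` mx_box B.
  apply/seteqP; split => w /= h; last by have := h i j; rewrite /B !eqxx.
  by move=> i' j'; rewrite /B; case: ifP => // /andP[/eqP -> /eqP ->].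
rewrite (hZ _ mB) (bigD1 i)//= (bigD1 j)//= /B !eqxx /=.
have -> : fine (gamma [set 0]) = 0 by rewrite gamma_set1.
by rewrite !mul0r.
Qed.

Lemma std_gauss_entry_neq0 a b (Z : O -> 'M[R]_(a, b)) i j : std_gauss P Z ->
  {ae P, forall w, Z w i j != 0}.
Proof.
move=> gZ; exists [set w | Z w i j = 0]; split.
- have := gZ.1 i j measurableT [set 0] (measurable_set1 0).
  by rewrite setTI.
- exact: std_gauss_entry0.
- by move=> w /= /negP; rewrite negbK => /eqP.
Qed.

Lemma measurable_sqn_pow a m (z : O -> 'cV[R]_a) : mxmeas z ->
  measurable_fun setT (fun w => (sqn (z w) ^+ m)%:E).
Proof. by move=> mz; apply/measurable_EFinP; apply: measurable_funX; exact: measurable_sqn. Qed.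

Lemma sqn_pow_ge0 a m (x : 'cV[R]_a) : (0 <= (sqn x ^+ m)%:E)%E.
Proof. by rewrite lee_fin exprn_ge0// sqn_ge0. Qed.

Lemma mxmeas_gram_dual a b (f : O -> 'M[R]_(a, b)) : mxmeas f -> mxmeas (fun w => gram_dual (f w)).
Proof.
move=> mf; have mg : mxmeas (fun w => gram (f w)) by apply: mxmeas_mul => //; exact: mxmeas_tr.
apply: mxmeas_mul => //; apply: mxmeas_scale; last exact: mxmeas_adj.
by apply: measurable_invr; exact: measurable_det.
Qed.

(* [H x] is a multiple of the last basis vector, and [H b] is again Gaussian. *)
Lemma std_gauss_dot_moment k m (x : 'cV[R]_(k + 1)) (b : O -> 'cV[R]_(k + 1)) : std_gauss P b ->
  ((odd_fact m)%:R%:E * (sqn x ^+ m)%:E <= \int[P]_w (dot (b w) x ^+ (2 * m))%:E)%E.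
Proof.
move=> gb; have [H oH Hx] := householder x (rshift k ord0).
have gHb := @std_gauss_dsub R d O P k 1 1 _ (std_gauss_mull oH gb).
have dE w : dot (b w) x = enorm x * dsubmx (H *m b w) ord0 ord0.
  have [h1 _] := orthmxP oH.
  have -> : dot (b w) x = ((H *m b w)^T *m (H *m x)) 0 0.
    by rewrite dotE trmx_mul mulmxA -(mulmxA _ H^T) h1 mulmx1.
  by rewrite Hx -scalemxAr mxE -colE !mxE.
rewrite (eq_integral (fun w => ((sqn x ^+ m)%:E *
   ((dsubmx (H *m b w) ord0 ord0) ^+ (2 * m))%:E)%E)); last first.
  by move=> w _; rewrite dE exprMn exprM enorm_sqr EFinM.
have mp : measurable_fun setT (fun w => ((dsubmx (H *m b w) ord0 ord0) ^+ (2 * m))%:E).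
  by apply/measurable_EFinP; apply: measurable_funX; exact: gHb.1.
have ev (y : R) : (0 <= (y ^+ (2 * m))%:E)%E by rewrite lee_fin exprM exprn_ge0// sqr_ge0.
rewrite (ge0_integralZl P measurableT mp (fun w _ => ev _)); last exact: sqn_pow_ge0.
rewrite muleC; apply: lee_wpmul2l; first exact: sqn_pow_ge0.
have mf : measurable_fun setT (fun y : R => (y ^+ (2 * m))%:E).
  by apply/measurable_EFinP; exact: measurable_funX.
have E := std_gauss_integral_entry gHb mf ev.
by apply: le_trans (gauss_even_moment R m) _; rewrite -E lexx.
Qed.

(** A reflection taking [u] to an axis shows that [Y^T u] is distributed as [|u|] times a standard
    Gaussian vector of size [r]. *)
Lemma std_gauss_mul_moment l r m (u : 'cV[R]_l) (Y : O -> 'M[R]_(l, r)) :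
  std_gauss P Y -> (0 < l)%N -> (0 < r)%N ->
  (\int[P]_w (sqn ((Y w)^T *m u) ^+ m)%:E <= ((r + 2 * m)%:R ^+ m)%:E * (sqn u ^+ m)%:E)%E.
Proof.
case: l u Y => [//|l]; rewrite -[l.+1]/(1 + l)%N => u Y gY _ r0; have [H oH Hu] := householder u (lshift l ord0).
have gz := std_gauss_tr (@std_gauss_usub R d O P 1 l r _ (std_gauss_mull oH gY)).
have dE w : (Y w)^T *m u = enorm u *: (usubmx (H *m Y w))^T.
  have [h1 _] := orthmxP oH.
  have -> : (Y w)^T *m u = (H *m Y w)^T *m (H *m u).
    by rewrite trmx_mul mulmxA -(mulmxA _ H^T) h1 mulmx1.
  rewrite Hu -scalemxAr -colE; congr (_ *: _); move: (H *m Y w) => N.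
  by apply/matrixP => i j; rewrite !mxE (ord1 j).
have mp := measurable_sqn_pow m gz.1.
have E : (\int[P]_w (sqn ((Y w)^T *m u) ^+ m)%:E =
    \int[P]_w ((sqn u ^+ m)%:E * (sqn (usubmx (H *m Y w))^T ^+ m)%:E))%E.
  by apply: eq_integral => w _; rewrite dE sqnZ exprMn enorm_sqr EFinM.
rewrite E (ge0_integralZl P measurableT mp (fun w _ => sqn_pow_ge0 _ _)); last exact: sqn_pow_ge0.
rewrite muleC; apply: lee_wpmul2r; first exact: sqn_pow_ge0.
exact: std_gauss_sqn_moment gz r0.
Qed.

(** At least [2m + 2] directions are orthogonal to the [k] fixed columns of [G]. The components of
    [g] along [2m + 2] of them form a standard Gaussian vector, and its inverse norm dominates the
    norm of the last dual vector. *)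
Lemma std_gauss_dual_last_moment m t k (G : 'M[R]_(2 * m.+1 + t, k))
    (g : O -> 'cV[R]_(2 * m.+1 + t)) : std_gauss P g -> (2 * m.+1 + k <= 2 * m.+1 + t)%N ->
  (\int[P]_w (sqn (gram_dual (row_mx G (g w)) *m delta_mx (rshift k ord0) 0) ^+ m)%:E <=
   (((2 ^ m * m`!)%:R)^-1)%:E)%E.
Proof.
move=> gg kt; have [H oH HG] := ortho_zero_rows G kt.
have gh := std_gauss_usub (std_gauss_mull oH gg).
have hG : usubmx (H *m G) = 0.
  by apply/matrixP => i j; rewrite [LHS]mxE HG ?mxE//= ltn_ord.
apply: le_trans (std_gauss_neg_moment gh).
have mv : mxmeas (fun w => gram_dual (row_mx G (g w)) *m delta_mx (rshift k (ord0 : 'I_1)) (0 : 'I_1)).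
  apply: mxmeas_mul; last exact: mxmeas_cst.
  by apply: mxmeas_gram_dual; apply: mxmeas_row_mx; [exact: mxmeas_cst|exact: gg.1].
apply: ae_ge0_le_integral => //.
- by move=> w _; exact: sqn_pow_ge0.
- exact: measurable_sqn_pow.
- by move=> w _; rewrite lee_fin exprn_ge0// invr_ge0 sqn_ge0.
- apply/measurable_EFinP; apply: measurable_funX; apply: measurable_invr.
  by apply: measurable_sqn; exact: gh.1.
(* If the top part of [H g] vanished, the inverse would be the default value 0 and the pointwise
   bound could fail; a single nonzero entry excludes this almost surely. *)
have := std_gauss_entry_neq0 (Ordinal (isT : (0 < 2 * m.+1)%N)) ord0 gh.
apply: filterS => w hw _; rewrite lee_fin lerXn2r ?nnegrE ?sqn_ge0 ?invr_ge0 ?sqn_ge0//.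
apply: sqn_gram_dual_last => //; apply: contraNneq hw => ->; by rewrite mxE.
Qed.
End gaussian_dual_moments.

Section gaussian_kernel.
Variable R : realType.
Context d (O : measurableType d) (P : probability O R).

(** A reflection of the columns takes [b] to the last axis, so only the last dual vector matters;
    the other columns are then held fixed while the last one is integrated. *)
Lemma std_gauss_dual_moment m t k (Z : O -> 'M[R]_(2 * m.+1 + t, k + 1)) (b : 'cV[R]_(k + 1)) :
  std_gauss P Z -> (2 * m.+1 + k <= 2 * m.+1 + t)%N ->
  (\int[P]_w (sqn (gram_dual (Z w) *m b) ^+ m)%:E <=
   (((2 ^ m * m`!)%:R)^-1)%:E * (sqn b ^+ m)%:E)%E.
Proof.
move=> gZ kt; have [H oH Hb] := householder b (rshift k ord0).
have gZ' := std_gauss_mulr (orthmx_tr oH) gZ.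
set e : 'cV[R]_(k + 1) := delta_mx _ _ in Hb.
have dE w : gram_dual (Z w) *m b = enorm b *: (gram_dual (Z w *m H^T) *m e).
  by rewrite -(gram_dual_orth (Z w) oH) -mulmxA Hb -scalemxAr.
have me (O' := mxT R (2 * m.+1 + t) (k + 1)) :
    mxmeas (fun M : O' => gram_dual (M : 'M[R]_(2 * m.+1 + t, k + 1)) *m e).
  by apply: mxmeas_mul; [apply: mxmeas_gram_dual; exact: mxmeas_id|exact: mxmeas_cst].
have mF := measurable_sqn_pow m me.
have mp := measurable_sqn_pow m (mxmeas_comp me gZ'.1).
rewrite (eq_integral (fun w => ((sqn b ^+ m)%:E * (sqn (gram_dual (Z w *m H^T) *m e) ^+ m)%:E)%E)); last first.
  by move=> w _; rewrite dE sqnZ exprMn enorm_sqr EFinM.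
rewrite (ge0_integralZl P measurableT mp (fun w _ => sqn_pow_ge0 _ _)); last exact: sqn_pow_ge0.
rewrite muleC; apply: lee_wpmul2r; first exact: sqn_pow_ge0.
rewrite (std_gauss_fubini_row gZ' mF (fun=> sqn_pow_ge0 _ _)).
rewrite -[leRHS](integral_prob_cst P).
apply: ge0_le_integral; first exact: measurableT.
  - by move=> w _; apply: integral_ge0 => w' _; exact: sqn_pow_ge0.
  - have mK : measurable_fun setT (fun z : O * O =>
      (sqn (gram_dual (row_mx (lsubmx (Z z.1 *m H^T)) (rsubmx (Z z.2 *m H^T))) *m e) ^+ m)%:E).
      exact: (measurableT_comp mF (mxmeas_measurable (std_gauss_row_mx (std_gauss_lsub gZ') (std_gauss_rsub gZ')).1)).
    exact: (@measurable_fun_fubini_tonelli_F _ _ _ _ _ P _ mK (fun=> sqn_pow_ge0 _ _)).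
  - exact: measurable_cst.
  - by move=> w _; apply: (std_gauss_dual_last_moment (lsubmx (Z w *m H^T)) (std_gauss_rsub gZ') kt).
Qed.

(** Column by column: for fixed independent columns there is a direction orthogonal to them, along
    which the new column almost surely has a nonzero component. Tonelli's theorem is applied to the
    indicator of singularity. *)
Lemma std_gauss_gram_unit l k (Z : O -> 'M[R]_(l, k)) : std_gauss P Z -> (k <= l)%N ->
  {ae P, forall w, gram (Z w) \in unitmx}.
Proof.
case: l Z => [|l].
  by case: k => // Z _ _; apply: aeW => w; rewrite unitmxE det_mx00 unitr1.
rewrite -[l.+1]/(1 + l)%N; elim: k => [|k IH] Z.
  by move=> _ _; apply: aeW => w; rewrite unitmxE det_mx00 unitr1.
move=> + kl; move: Z; rewrite -(addn1 k) => Z gZ.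
have gL := std_gauss_lsub gZ; have gR := std_gauss_rsub gZ.
pose f (M : mxT R (1 + l) (k + 1)) : \bar R :=
  ((gram (M : 'M[R]_(1 + l, k + 1)) \notin unitmx)%:R)%:E.
have f0 M : (0 <= f M)%E by rewrite lee_fin.
have mf : measurable_fun setT f.
  apply/measurable_EFinP.
  pose g (M : mxT R (1 + l) (k + 1)) : R := \det (gram (M : 'M[R]_(1 + l, k + 1))).
  have mg : measurable_fun setT g.
    by apply: measurable_det; apply: mxmeas_mul; [apply: mxmeas_tr|]; exact: mxmeas_id.
  rewrite (_ : (fun M => _) = (\1_[set 0] : R -> R) \o g); last first.
    apply/funext => M /=; rewrite /g unitmxE unitfE negbK indicE; congr (_%:R).
    by congr nat_of_bool; apply/eqP/idP; rewrite inE.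
  by apply: measurableT_comp => //; exact: measurable_indic.
have mfZ : measurable_fun setT (fun w => f (Z w)).
  exact: (measurableT_comp mf (mxmeas_measurable gZ.1)).
have mK : measurable_fun setT (fun z : O * O => f (row_mx (lsubmx (Z z.1)) (rsubmx (Z z.2)))).
  exact: (measurableT_comp mf (mxmeas_measurable (std_gauss_row_mx gL gR).1)).
have int0 : (\int[P]_w f (Z w) = 0)%E.
  rewrite (std_gauss_fubini_row gZ mf f0).
  rewrite (ae_eq_integral (cst 0%E))//; first by rewrite integral0.
    exact: (@measurable_fun_fubini_tonelli_F _ _ _ _ _ P _ mK (fun=> f0 _)).
  apply: filterS (IH _ gL (ltnW kl)) => w uw _ /=.
  have [H oH HG] := @ortho_zero_rows R _ 1 _ (lsubmx (Z w)) kl.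
  rewrite (ae_eq_integral (cst 0%E))//; first by rewrite integral0.
    have h : measurable_fun setT (fun w' => row_mx (lsubmx (Z w)) (rsubmx (Z w')) : mxT R (1 + l) (k + 1)).
      by apply: mxmeas_measurable; apply: mxmeas_row_mx; [exact: mxmeas_cst|exact: gR.1].
    exact: (measurableT_comp mf h).
  apply: filterS (std_gauss_entry_neq0 ord0 ord0 (std_gauss_mull oH gR)) => w' hw' _ /=.
  by rewrite /f (gram_row_mx_unit oH _ uw hw')// => j; exact: HG.
have /(ae_eq_integral_abs P measurableT mfZ) : (\int[P]_w `|f (Z w)| = 0)%E.
  by under eq_integral do rewrite (gee0_abs (f0 _)).
by apply: filterS => w /= /(_ I); rewrite /f; case: (_ \in _) => // -[] /eqP; rewrite oner_eq0.
Qed.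

(** Supplies the test vector [b] from a row of [Z] itself; its independence comes from integrating
    it over a second copy of the space. *)
Lemma std_gauss_col_exists l k (Z : O -> 'M[R]_(l, k)) : std_gauss P Z -> (0 < l)%N ->
  exists b : O -> 'cV[R]_k, std_gauss P b.
Proof.
case: l Z => [//|l] Z gZ _.
by exists (fun w => (usubmx (Z w : 'M[R]_(1 + l, k)))^T); apply: std_gauss_tr; exact: (@std_gauss_usub R d O P 1 l k Z gZ).
Qed.
End gaussian_kernel.

(** * Comparison of head and tail on the kernel *)

Section gaussian_kernel_bound.
Variable R : realType.
Context d (O : measurableType d) (P : probability O R).

Section total.
Context d' (O' : measurableType d') (P' : probability O' R).
Variables (k r : nat) (b : O' -> 'cV[R]_(k + 1)) (m : nat).
Hypotheses (gb : std_gauss P' b).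

(** The admissible [rho] before division by [(2m-1)!!]. It is extended real valued, its finiteness
    being known only almost surely. *)
Definition kernel_ratio l (M : 'M[R]_(l, (k + 1) + r)) : \bar R :=
  (\int[P']_w (sqn ((rsubmx M)^T *m (gram_dual (lsubmx M) *m b w)) ^+ m)%:E)%E.

Let mK l : measurable_fun setT (fun z : mxT R l ((k + 1) + r) * O' =>
  (sqn ((rsubmx (z.1 : 'M[R]_(l, (k + 1) + r)))^T *m
        (gram_dual (lsubmx (z.1 : 'M[R]_(l, (k + 1) + r))) *m b z.2)) ^+ m)%:E).
Proof.
have mid : mxmeas (fun z : mxT R l ((k + 1) + r) * O' => z.1 : 'M[R]_(l, (k + 1) + r)).
  by move=> i j; apply: (measurableT_comp (@mxmeas_id R l ((k + 1) + r) i j)); exact: measurable_fst.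
apply: measurable_sqn_pow; apply: mxmeas_mul.
  by apply: mxmeas_tr; exact: mxmeas_rsub.
apply: mxmeas_mul; first by apply: mxmeas_gram_dual; exact: mxmeas_lsub.
by move=> i j; apply: (measurableT_comp (gb.1 i j)); exact: measurable_snd.
Qed.

Lemma kernel_ratio_ge0 l (M : 'M[R]_(l, (k + 1) + r)) : (0 <= kernel_ratio M)%E.
Proof. by apply: integral_ge0 => w _; exact: sqn_pow_ge0. Qed.

Lemma measurable_kernel_ratio l :
  measurable_fun setT (@kernel_ratio l : mxT R l ((k + 1) + r) -> \bar R).
Proof.
exact: (@measurable_fun_fubini_tonelli_F _ _ _ _ _ P' _ (@mK l) (fun=> sqn_pow_ge0 _ _)).
Qed.

(** The right block is integrated with the left block and [b] fixed, then the left block with [b]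
    fixed, then [b]. The three integrations give the factors [(r + 2m)^m], [1 / (2^m m!)] and
    [(k + 1 + 2m)^m]. *)
Lemma integral_kernel_ratio t (Z : O -> 'M[R]_(2 * m.+1 + t, (k + 1) + r)) :
  std_gauss P Z -> (0 < r)%N -> (2 * m.+1 + k <= 2 * m.+1 + t)%N ->
  (\int[P]_w kernel_ratio (Z w) <=
   (((2 ^ m * m`!)%:R)^-1 * (r + 2 * m)%:R ^+ m * (k + 1 + 2 * m)%:R ^+ m)%:E)%E.
Proof.
move=> gZ r0 kt.
have gL := std_gauss_lsub gZ; have gR := std_gauss_rsub gZ.
set c : R := ((2 ^ m * m`!)%:R)^-1; set a : R := (r + 2 * m)%:R ^+ m.
have l0 : (0 < 2 * m.+1 + t)%N by rewrite mulnS.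
have c0 : 0 <= c by rewrite invr_ge0.
have a0 : 0 <= a by rewrite exprn_ge0.
rewrite (std_gauss_fubini_row gZ (@measurable_kernel_ratio _) (@kernel_ratio_ge0 _)).
have mD : measurable_fun setT (fun z : O * O' =>
    (sqn (gram_dual (lsubmx (Z z.1)) *m b z.2) ^+ m)%:E).
  apply: measurable_sqn_pow; apply: mxmeas_mul.
    by apply: mxmeas_gram_dual => i j; apply: (measurableT_comp (gL.1 i j)); exact: measurable_fst.
  by move=> i j; apply: (measurableT_comp (gb.1 i j)); exact: measurable_snd.
have mDF := @measurable_fun_fubini_tonelli_F _ _ _ _ _ P' _ mD (fun=> sqn_pow_ge0 _ _).
have mDG := @measurable_fun_fubini_tonelli_G _ _ _ _ _ P _ mD (fun=> sqn_pow_ge0 _ _).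
have mb := measurable_sqn_pow m gb.1.
apply: (@le_trans _ _ (\int[P]_w (a%:E * \int[P']_w' (sqn (gram_dual (lsubmx (Z w)) *m b w') ^+ m)%:E))%E).
  apply: ge0_le_integral; first exact: measurableT.
  - by move=> w _; apply: integral_ge0 => w' _; exact: kernel_ratio_ge0.
  - have h := measurableT_comp (@measurable_kernel_ratio _) (mxmeas_measurable (std_gauss_row_mx gL gR).1).
    exact: (@measurable_fun_fubini_tonelli_F _ _ _ _ _ P _ h (fun=> kernel_ratio_ge0 _)).
  - by apply: emeasurable_funM; [exact: measurable_cst|exact: mDF].
  move=> w _; rewrite /kernel_ratio.
  under eq_integral do under eq_integral do rewrite row_mxKl row_mxKr.
  have mE : measurable_fun setT (fun z : O * O' =>
      (sqn ((rsubmx (Z z.1))^T *m (gram_dual (lsubmx (Z w)) *m b z.2)) ^+ m)%:E).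
    apply: measurable_sqn_pow; apply: mxmeas_mul.
      by apply: mxmeas_tr => i j; apply: (measurableT_comp (gR.1 i j)); exact: measurable_fst.
    apply: mxmeas_mul; first exact: mxmeas_cst.
    by move=> i j; apply: (measurableT_comp (gb.1 i j)); exact: measurable_snd.
  rewrite (@fubini_tonelli _ _ _ _ _ P P' _ mE (fun=> sqn_pow_ge0 _ _)).
  have mf1 : measurable_fun setT (fun w' => (sqn (gram_dual (lsubmx (Z w)) *m b w') ^+ m)%:E).
    by apply: measurable_sqn_pow; apply: mxmeas_mul; [exact: mxmeas_cst|exact: gb.1].
  rewrite -(ge0_integralZl P' measurableT mf1 (fun w _ => sqn_pow_ge0 _ _))//.
  apply: ge0_le_integral; first exact: measurableT.
  - by move=> w' _; apply: integral_ge0 => w'' _; exact: sqn_pow_ge0.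
  - exact: (@measurable_fun_fubini_tonelli_G _ _ _ _ _ P _ mE (fun=> sqn_pow_ge0 _ _)).
  - by apply: emeasurable_funM; [exact: measurable_cst|exact: mf1].
  move=> w' _.
  exact: (@std_gauss_mul_moment _ _ _ P _ r m (gram_dual (lsubmx (Z w)) *m b w') _ gR l0 r0).
rewrite (ge0_integralZl P measurableT mDF); last 2 first.
- by move=> w _; apply: integral_ge0 => w' _; exact: sqn_pow_ge0.
- by rewrite lee_fin.
rewrite (@fubini_tonelli _ _ _ _ _ P P' _ mD (fun=> sqn_pow_ge0 _ _)).
rewrite -mulrA mulrCA EFinM; apply: lee_wpmul2l; first by rewrite lee_fin.
apply: (@le_trans _ _ (\int[P']_w (c%:E * (sqn (b w) ^+ m)%:E))%E).
  apply: ge0_le_integral; first exact: measurableT.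
  - by move=> w' _; apply: integral_ge0 => w'' _; exact: sqn_pow_ge0.
  - exact: mDG.
  - by apply: emeasurable_funM; [exact: measurable_cst|exact: mb].
  move=> w' _; exact: (@std_gauss_dual_moment _ _ _ P m t k _ (b w') gL kt).
rewrite (ge0_integralZl P' measurableT mb (fun w _ => sqn_pow_ge0 _ _)); last by rewrite lee_fin.
rewrite EFinM; apply: lee_wpmul2l; first by rewrite lee_fin.
by apply: std_gauss_sqn_moment => //; rewrite addn1.
Qed.

Lemma kernel_ratio_bound l (M : 'M[R]_(l, (k + 1) + r)) (x : 'cV[R]_((k + 1) + r)) :
  gram (lsubmx M) \in unitmx -> M *m x = 0 ->
  ((odd_fact m)%:R%:E * (sqn (usubmx x) ^+ m)%:E <=
   kernel_ratio M * (sqn (dsubmx x) ^+ m)%:E)%E.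
Proof.
move=> uM Mx; apply: le_trans (std_gauss_dot_moment m (usubmx x) gb) _.
have mf1 : measurable_fun setT (fun w' =>
    (sqn ((rsubmx M)^T *m (gram_dual (lsubmx M) *m b w')) ^+ m)%:E).
  apply: measurable_sqn_pow; apply: mxmeas_mul; first exact: mxmeas_cst.
  by apply: mxmeas_mul; [exact: mxmeas_cst|exact: gb.1].
rewrite -(ge0_integralZr P' measurableT mf1 (fun w _ => sqn_pow_ge0 _ _)); last exact: sqn_pow_ge0.
apply: ge0_le_integral; first exact: measurableT.
- by move=> w _; rewrite lee_fin exprM exprn_ge0// sqr_ge0.
- apply/measurable_EFinP; apply: measurable_funX.
  rewrite (_ : (fun w => _) = (fun w => ((b w)^T *m usubmx x) 0 0)); last first.
    by apply/funext => w; rewrite dotE.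
  by apply: mxmeas_mul; [apply: mxmeas_tr; exact: gb.1|exact: mxmeas_cst].
- by apply: emeasurable_funM; [exact: mf1|exact: measurable_cst].
move=> w _; rewrite -EFinM lee_fin exprM -exprMn lerXn2r ?nnegrE ?sqr_ge0//.
  by rewrite mulr_ge0 ?sqn_ge0.
exact: dot_kernel.
Qed.
End total.

Lemma gauss_kernel_bound m t k r (Z : O -> 'M[R]_(2 * m.+1 + t, (k + 1) + r)) :
  std_gauss P Z -> (0 < r)%N -> (2 * m.+1 + k <= 2 * m.+1 + t)%N ->
  exists rho : O -> R, [/\ measurable_fun setT rho, forall w, 0 <= rho w,
    (\int[P]_w (rho w)%:E <=
      ((k + 1 + 2 * m)%:R ^+ m * (r + 2 * m)%:R ^+ m / ((2 * m)`!)%:R)%:E)%E &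
    {ae P, forall w, forall x : 'cV[R]_((k + 1) + r), Z w *m x = 0 ->
      sqn (usubmx x) ^+ m <= rho w * sqn (dsubmx x) ^+ m}].
Proof.
move=> gZ r0 kt; have gL := std_gauss_lsub gZ.
have [b gb] : exists b : O -> 'cV[R]_(k + 1), std_gauss P b by exact: std_gauss_col_exists gL _.
have mk : measurable_fun setT (fun w => kernel_ratio P b m (Z w)).
  have h := @measurable_kernel_ratio _ _ P k r b m gb (2 * m.+1 + t).
  exact: (measurableT_comp h (mxmeas_measurable gZ.1)).
have k0 w := kernel_ratio_ge0 P b m (Z w).
have kb := integral_kernel_ratio gb gZ r0 kt.
have kfin : {ae P, forall w, kernel_ratio P b m (Z w) \is a fin_num}.
  have ki : P.-integrable setT (fun w => kernel_ratio P b m (Z w)).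
    apply/integrableP; split => //; under eq_integral do rewrite (gee0_abs (k0 _)).
    by apply: le_lt_trans kb _; rewrite ltry.
  by apply: filterS (integrable_ae measurableT ki) => w; apply.
have of0 : 0 < (odd_fact m)%:R :> R by rewrite ltr0n odd_fact_gt0.
(* Where the ratio is infinite, [fine] gives the default value 0; by [kfin] this concerns a null set
   only. *)
exists (fun w => (odd_fact m)%:R^-1 * fine (kernel_ratio P b m (Z w))); split.
- by apply: measurable_funM => //; exact: measurableT_comp.
- by move=> w; rewrite mulr_ge0 ?fine_ge0// invr_ge0 ltW.
- apply: (@le_trans _ _ (\int[P]_w ((odd_fact m)%:R^-1%:E * kernel_ratio P b m (Z w)))%E).
    apply: ge0_le_integral; first exact: measurableT.
    + by move=> w _; rewrite lee_fin mulr_ge0 ?fine_ge0// invr_ge0 ltW.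
    + by apply/measurable_EFinP; apply: measurable_funM => //; exact: measurableT_comp.
    + by apply: emeasurable_funM; [exact: measurable_cst|exact: mk].
    move=> w _; rewrite EFinM; apply: lee_wpmul2l; first by rewrite lee_fin invr_ge0 ltW.
    have := k0 w; case: (kernel_ratio _ _ _ _) => [x||]//= _; exact: leey.
  rewrite (ge0_integralZl P measurableT mk (fun w _ => k0 w)); last first.
    by rewrite lee_fin invr_ge0 ltW.
  apply: le_trans (lee_wpmul2l _ kb) _; first by rewrite lee_fin invr_ge0 ltW.
  (* The factor [2^m m!] of the negative moment and the double factorial combine into the factorial
     of [2m]. *)
  rewrite -EFinM lee_fin fact_odd_fact (natrM _ _ (odd_fact m)) invfM.
  by rewrite le_eqVlt; apply/orP; left; apply/eqP; ring.
have kl : (k + 1 <= 2 * m.+1 + t)%N by lia.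
have := std_gauss_gram_unit gL kl.
apply: filterS2 kfin => w kw uw x Zx.
have := kernel_ratio_bound m gb uw Zx.
rewrite -(fineK kw) -!EFinM lee_fin => h.
by rewrite -mulrA ler_pdivlMl.
Qed.
End gaussian_kernel_bound.

(** * The condition number in terms of the kernel *)

Section deterministic_bound.
Variable R : realType.

(** Chebyshev's sum inequality: twice the difference of the sides is the double sum of
    [w_i w_j (a_i^p - a_j^p) (a_i - a_j)], whose terms are nonnegative since powers are
    increasing. *)
Lemma power_sum_chebyshev (I : finType) (S : pred I) (a w : I -> R) p :
  (forall i, S i -> 0 <= a i) -> (forall i, S i -> 0 <= w i) ->
  (\sum_(i | S i) a i ^+ p * w i) * (\sum_(i | S i) a i * w i) <=
  (\sum_(i | S i) w i) * (\sum_(i | S i) a i ^+ p.+1 * w i).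
Proof.
move=> a0 w0.
have h : 0 <= \sum_(i | S i) \sum_(j | S j)
    w i * w j * ((a i ^+ p - a j ^+ p) * (a i - a j)).
  apply: sumr_ge0 => i Si; apply: sumr_ge0 => j Sj.
  apply: mulr_ge0; first by rewrite mulr_ge0 ?w0.
  case: (leP (a j) (a i)) => aij.
    by rewrite mulr_ge0 ?subr_ge0 ?lerXn2r ?nnegrE ?a0.
  by rewrite -mulrNN mulr_ge0 ?opprB ?subr_ge0 ?lerXn2r ?nnegrE ?a0// ltW.
set W := \sum_(i | S i) w i; set Ap := \sum_(i | S i) _ ^+ p * _.
set A1 := \sum_(i | S i) _ * _; set Aq := \sum_(i | S i) _.
have e : \sum_(i | S i) \sum_(j | S j) w i * w j * ((a i ^+ p - a j ^+ p) * (a i - a j)) =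
    (W * Aq - Ap * A1) *+ 2.
  have e1 i : \sum_(j | S j) w i * w j * ((a i ^+ p - a j ^+ p) * (a i - a j)) =
      a i ^+ p.+1 * w i * W - a i ^+ p * w i * A1 - a i * w i * Ap + w i * Aq.
    rewrite !mulr_sumr -!sumrB -big_split/=; apply: eq_bigr => j _.
    by rewrite !exprS; ring.
  under eq_bigr do rewrite e1.
  rewrite big_split !sumrB /= -!mulr_suml.
  by rewrite -/W -/Ap -/A1 -/Aq; ring.
by move: h; rewrite e mulr2n -mulr2n -mulr_natr pmulr_lge0 ?ltr0n// subr_ge0.
Qed.

(** Jensen's inequality for the power [p + 1] with unnormalized weights, by one use of Chebyshev's
    inequality per step. *)
Lemma power_mean (I : finType) (S : pred I) (a w : I -> R) p :
  (forall i, S i -> 0 <= a i) -> (forall i, S i -> 0 <= w i) ->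
  (\sum_(i | S i) a i * w i) ^+ p.+1 <=
  (\sum_(i | S i) w i) ^+ p * \sum_(i | S i) a i ^+ p.+1 * w i.
Proof.
move=> a0 w0; elim: p => [|p IH]; first by rewrite mul1r expr1 lexx.
rewrite exprS mulrC [(\sum_(i | S i) w i) ^+ _]exprSr -mulrA.
have s0 : 0 <= \sum_(i | S i) a i * w i by apply: sumr_ge0 => i Si; rewrite mulr_ge0 ?a0 ?w0.
apply: le_trans (ler_wpM2r s0 IH) _; rewrite -mulrA ler_wpM2l//.
  by rewrite exprn_ge0// sumr_ge0.
exact: power_sum_chebyshev.
Qed.

(** For [y = L^T L x] one has [|y|^2 = <L y, L x>], so Cauchy-Schwarz and the bound on [L] give
    [|y|^4 <= c^2 |y|^2 |x|^2]. *)
Lemma spectral_norm_gram_le n (L : 'M[R]_n) (c : R) : 0 <= c ->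
  (forall x : 'cV[R]_n, sqn (L *m x) <= c * sqn x) -> spectral_norm (gram L) <= c.
Proof.
move=> c0 hL; apply: ge_sup.
  have e0 : enorm (0 : 'cV[R]_n) = 0.
    by rewrite /enorm big1 ?sqrtr0// => i _; rewrite mxE expr0n.
  by exists 0, 0; rewrite /= ?mulmx0 ?e0 ?ler01.
move=> _ [x /= x1 <-].
suff h : enorm (gram L *m x) <= c * enorm x.
  by apply: le_trans h _; rewrite ler_piMr.
rewrite -(@ler_pXn2r _ 2%N) ?nnegrE ?mulr_ge0 ?enorm_ge0// exprMn !enorm_sqr.
set y := gram L *m x.
have e : sqn y = dot (L *m y) (L *m x).
  by rewrite sqnE dotE /y trmx_mul -!mulmxA !trmx_mul /gram -!mulmxA.
have [->|y0] := eqVneq (sqn y) 0; first by rewrite mulr_ge0 ?sqn_ge0// exprn_ge0.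
have {}y0 : 0 < sqn y by rewrite lt_neqAle eq_sym y0 sqn_ge0.
have := cauchy_schwarz (L *m y) (L *m x); rewrite -e => h.
rewrite -(ler_pM2l y0) -expr2; apply: le_trans h _.
apply: le_trans (ler_pM (sqn_ge0 _) (sqn_ge0 _) (hL _) (hL _)) _.
by rewrite le_eqVlt; apply/orP; left; apply/eqP; ring.
Qed.

(* The head and the tail of the coordinates of [w] are compared through the
   kernel inequality, and the head part of the quadratic form through the power
   mean inequality of exponent [2q + 2]; [c2 * s2 <= (c2 + s2)^2 / 4] gives the
   factor 1/4. *)
Lemma head_form_bound n (lam : 'I_n -> R) (mu nu rho y : R) (z : 'cV[R]_n) k q m :
  0 <= mu -> 0 <= rho -> 0 <= y -> (0 < m)%N -> mu <= 2 * nu ->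
  (forall i : 'I_n, (k <= i)%N -> `|lam i| <= nu) ->
  (9 / 4) ^+ m * rho <= y ^+ ((4 * q + 4) * m) ->
  let w i := (lam i + mu) * lam i ^+ q * z i 0 in
  (\sum_(i < n | (i < k)%N) w i ^+ 2) ^+ m <=
    rho * (\sum_(i < n | ~~ (i < k)%N) w i ^+ 2) ^+ m ->
  \sum_i (lam i + mu) * z i 0 ^+ 2 <= nu * (3 + y ^+ 2) * sqn z.
Proof.
have eN : ((2 * q).+2 * m + (2 * q).+2 * m = (4 * q + 4) * m)%N.
  by rewrite -mulnDl; congr (_ * _)%N; lia.
move=> mu0 rho0 y0 m0 munu lamnu hy w hw.
have nu0 : 0 <= nu by rewrite -(pmulr_rge0 _ (ltr0n R 2)) (le_trans mu0).
set c2 := \sum_(i < n | (i < k)%N) z i 0 ^+ 2.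
set s2 := \sum_(i < n | ~~ (i < k)%N) z i 0 ^+ 2.
have c20 : 0 <= c2 by apply: sumr_ge0 => i _; exact: sqr_ge0.
have s20 : 0 <= s2 by apply: sumr_ge0 => i _; exact: sqr_ge0.
have zE : sqn z = c2 + s2 by rewrite /sqn (bigID (fun i : 'I_n => (i < k)%N)).
(* The power mean inequality needs nonnegative values, and replacing negative eigenvalues by 0 only
   increases the quadratic form. *)
pose a i := Num.max (lam i) 0.
have a0 i : 0 <= a i by rewrite le_max lexx orbT.
set h := \sum_(i < n | (i < k)%N) a i * z i 0 ^+ 2.
have h0 : 0 <= h by apply: sumr_ge0 => i _; rewrite mulr_ge0 ?sqr_ge0.
have le1 : \sum_i (lam i + mu) * z i 0 ^+ 2 <= 3 * nu * sqn z + h.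
  rewrite zE (bigID (fun i : 'I_n => (i < k)%N))/=.
  have e1 : \sum_(i < n | (i < k)%N) (lam i + mu) * z i 0 ^+ 2 <= h + mu * c2.
    rewrite /h mulr_sumr -big_split/=; apply: ler_sum => i _.
    by rewrite mulrDl lerD2r ler_wpM2r ?sqr_ge0// le_max lexx.
  have e2 : \sum_(i < n | ~~ (i < k)%N) (lam i + mu) * z i 0 ^+ 2 <= (nu + mu) * s2.
    rewrite mulr_sumr; apply: ler_sum => i ik.
    rewrite ler_wpM2r ?sqr_ge0// lerD2r; rewrite -leqNgt in ik.
    exact: le_trans (ler_norm _) (lamnu _ ik).
  apply: le_trans (lerD e1 e2) _.
  have := ler_wpM2r c20 munu; have := ler_wpM2r s20 munu; have := mulr_ge0 nu0 c20.
  by nra.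
apply: le_trans le1 _; rewrite mulrDr mulrDl lerD ?[nu * 3]mulrC//.
(* This power combines the exponent [2q + 2] of the power mean inequality with the exponent [m] of
   the kernel inequality. *)
suff hp : h ^+ ((2 * q).+2 * m) <= (nu * y ^+ 2 * sqn z) ^+ ((2 * q).+2 * m).
  by move: hp; rewrite ler_pXn2r ?nnegrE ?muln_gt0 ?m0 ?mulr_ge0 ?sqn_ge0 ?exprn_ge0.
have pm := @power_mean _ (fun i : 'I_n => (i < k)%N) a (fun i => z i 0 ^+ 2) (2 * q).+1
  (fun i _ => a0 i) (fun i _ => sqr_ge0 _).
have aw : \sum_(i < n | (i < k)%N) a i ^+ (2 * q).+2 * z i 0 ^+ 2 <=
    \sum_(i < n | (i < k)%N) w i ^+ 2.
  apply: ler_sum => i _; rewrite /w !exprMn ler_wpM2r ?sqr_ge0//.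
  rewrite /a; case: (leP (lam i) 0) => li.
    by rewrite expr0n/= mulr_ge0 ?sqr_ge0.
  rewrite -exprM [(2 * q)%N]mulnC -[(q * 2).+2]/(2 + q * 2)%N exprD.
  by rewrite ler_wpM2r ?exprn_ge0 ?(ltW li)// lerXn2r ?nnegrE ?addr_ge0 ?(ltW li)// lerDl.
(* On the tail [|lam i| <= nu] and [mu <= 2 nu], so [|lam i + mu| <= 3 nu], and the square gives the
   constant 9. *)
have wt : \sum_(i < n | ~~ (i < k)%N) w i ^+ 2 <= 9 * nu ^+ (2 * q).+2 * s2.
  rewrite mulr_sumr; apply: ler_sum => i ik; rewrite -leqNgt in ik.
  rewrite /w !exprMn ler_wpM2r ?sqr_ge0//.
  have l1 := lamnu _ ik.
  have l2 : `|lam i + mu| <= 3 * nu.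
    by apply: le_trans (ler_normD _ _) _; rewrite (ger0_norm mu0); lra.
  rewrite -[X in X * _]real_normK ?num_real// -[(_ ^+ q) ^+ 2]real_normK ?num_real// normrX.
  have -> : 9 * nu ^+ (2 * q).+2 = (3 * nu) ^+ 2 * (nu ^+ q) ^+ 2.
    by rewrite -exprM mulnC !exprS; ring.
  by rewrite ler_pM ?sqr_ge0// lerXn2r ?nnegrE ?mulr_ge0 ?exprn_ge0// lerXn2r ?nnegrE.
have az0 : 0 <= \sum_(i < n | (i < k)%N) a i ^+ (2 * q).+2 * z i 0 ^+ 2.
  by apply: sumr_ge0 => i _; exact: mulr_ge0 (exprn_ge0 _ (a0 i)) (sqr_ge0 _).
rewrite exprM; apply: le_trans (lerXn2r m _ _ pm) _.
- by rewrite nnegrE exprn_ge0.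
- by rewrite nnegrE; exact: mulr_ge0 (exprn_ge0 _ c20) az0.
rewrite exprMn.
have w0 (Q : pred 'I_n) : 0 <= \sum_(i < n | Q i) w i ^+ 2 by apply: sumr_ge0 => i _; exact: sqr_ge0.
have step : (\sum_(i < n | (i < k)%N) a i ^+ (2 * q).+2 * z i 0 ^+ 2) ^+ m <=
    rho * (9 * nu ^+ (2 * q).+2 * s2) ^+ m.
  apply: (@le_trans _ _ ((\sum_(i < n | (i < k)%N) w i ^+ 2) ^+ m)).
    by rewrite lerXn2r ?nnegrE ?w0.
  apply: le_trans hw _; rewrite ler_wpM2l// lerXn2r ?nnegrE ?w0//.
  by apply: mulr_ge0 => //; apply: mulr_ge0 => //; exact: exprn_ge0.
apply: (le_trans (ler_wpM2l _ step)); first by rewrite !exprn_ge0.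
have cs : c2 ^+ (2 * q).+1 * s2 <= sqn z ^+ (2 * q).+2 / 4.
  rewrite !exprS zE.
  have h1 : c2 ^+ (2 * q) <= (c2 + s2) ^+ (2 * q).
    by rewrite lerXn2r ?nnegrE ?addr_ge0// lerDl.
  have h2 : c2 * s2 <= (c2 + s2) ^+ 2 / 4.
    by have := sqr_ge0 (c2 - s2); nra.
  have -> : c2 * c2 ^+ (2 * q) * s2 = c2 * s2 * c2 ^+ (2 * q) by ring.
  have -> : (c2 + s2) * ((c2 + s2) * (c2 + s2) ^+ (2 * q)) / 4 =
    (c2 + s2) ^+ 2 / 4 * (c2 + s2) ^+ (2 * q) by rewrite expr2; ring.
  by rewrite ler_pM ?mulr_ge0 ?exprn_ge0.
have -> : (c2 ^+ (2 * q).+1) ^+ m * (rho * (9 * nu ^+ (2 * q).+2 * s2) ^+ m) =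
    (9 ^+ m * rho) * ((nu ^+ (2 * q).+2) ^+ m * (c2 ^+ (2 * q).+1 * s2) ^+ m).
  by rewrite !exprMn; ring.
apply: (@le_trans _ _ ((9 ^+ m * rho) *
    ((nu ^+ (2 * q).+2) ^+ m * (sqn z ^+ (2 * q).+2 / 4) ^+ m))).
  rewrite ler_wpM2l ?mulr_ge0 ?exprn_ge0// ler_wpM2l ?exprn_ge0//.
  apply: lerXn2r => //; rewrite nnegrE; first exact: mulr_ge0 (exprn_ge0 _ c20) s20.
  exact: divr_ge0 (exprn_ge0 _ (sqn_ge0 z)) (ler0n _ 4).
have -> : (9 ^+ m * rho) * ((nu ^+ (2 * q).+2) ^+ m * (sqn z ^+ (2 * q).+2 / 4) ^+ m) =
    ((9 / 4) ^+ m * rho) * ((nu ^+ (2 * q).+2) ^+ m * (sqn z ^+ (2 * q).+2) ^+ m).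
  by rewrite !exprMn; ring.
rewrite -!exprM !exprMn [leRHS]mulrAC [leRHS]mulrC ler_wpM2r ?mulr_ge0 ?exprn_ge0 ?sqn_ge0//.
by rewrite -exprMn -exprD eN.
Qed.

Lemma diag_mx_col n (a : 'I_n -> R) (x : 'cV[R]_n) i :
  (diag_mx (\row_j a j) *m x) i 0 = a i * x i 0.
Proof. by rewrite mul_diag_mx !mxE. Qed.

Lemma spectral_pow n (U : 'M[R]_n) (a : 'I_n -> R) q : orthmx U ->
  (U *m diag_mx (\row_i a i) *m U^T) ^+ q = U *m diag_mx (\row_i a i ^+ q) *m U^T.
Proof.
move=> oU; have [h1 h2] := orthmxP oU; elim: q => [|q IH].
  rewrite expr0 (_ : \row_i _ = const_mx 1); last by apply/rowP => i; rewrite !mxE expr0.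
  by rewrite diag_const_mx mulmx1 h2.
rewrite exprS IH -[_ * _]/(_ *m _) !mulmxA -(mulmxA _ U^T U) h1 mulmx1; congr (_ *m _).
rewrite -mulmxA mulmx_diag; congr (_ *m diag_mx _).
by apply/rowP => i; rewrite !mxE exprS.
Qed.

(** With [Q = 1 - Pi], the matrix [Q A_mu Q] is the Gram matrix of [L = D^(1/2) U^T Q] for the
    diagonal matrix [D] of the values [lam i + mu]. Its norm is thus governed by the quadratic form
    of [A_mu] on the vectors [Q x], which are no longer than [x]. *)
Lemma projected_norm_bound n l (A Pi U : 'M[R]_n) (X : 'M[R]_(l, n)) (lam : 'I_n -> R)
    (mu nu rho y : R) k q m :
  orthmx U -> A = U *m diag_mx (\row_i lam i) *m U^T ->
  (forall i, 0 < lam i + mu) ->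
  orthogonal_projector_onto_range Pi ((A + mu%:M) *m A ^+ q *m X^T) ->
  0 <= mu -> 0 <= rho -> 0 <= y -> (0 < m)%N -> mu <= 2 * nu ->
  (forall i : 'I_n, (k <= i)%N -> `|lam i| <= nu) ->
  (9 / 4) ^+ m * rho <= y ^+ ((4 * q + 4) * m) ->
  (forall w : 'cV[R]_n, X *m U *m w = 0 ->
    (\sum_(i < n | (i < k)%N) w i 0 ^+ 2) ^+ m <=
    rho * (\sum_(i < n | ~~ (i < k)%N) w i 0 ^+ 2) ^+ m) ->
  spectral_norm ((1%:M - Pi) *m (A + mu%:M) *m (1%:M - Pi)) <= nu * (3 + y ^+ 2).
Proof.
move=> oU AE lam0 [PiT PiPi /andP[_ PiM]] mu0 rho0 y0 m0 munu lamnu hy hw.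
have [h1 h2] := orthmxP oU.
have nu0 : 0 <= nu by rewrite -(pmulr_rge0 _ (ltr0n R 2)) (le_trans mu0).
set Q := 1%:M - Pi; set D := A + mu%:M.
have QT : Q^T = Q by rewrite /Q raddfB /= trmx1 PiT.
have PiQ : Pi *m Q = 0 by rewrite /Q mulmxBr mulmx1 PiPi subrr.
have DE : D = U *m diag_mx (\row_i (lam i + mu)) *m U^T.
  have -> : \row_i (lam i + mu) = \row_i lam i + const_mx mu by apply/rowP => i; rewrite !mxE.
  rewrite raddfD /= diag_const_mx mulmxDr mulmxDl -AE; congr (_ + _).
  by rewrite -scalemx1 -scalemxAr mulmx1 -scalemxAl h2.
pose L := diag_mx (\row_i Num.sqrt (lam i + mu)) *m (U^T *m Q).
have -> : Q *m D *m Q = gram L.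
  rewrite /gram /L !trmx_mul tr_diag_mx trmxK QT DE !mulmxA; congr (_ *m _ *m _).
  rewrite -!mulmxA mulmx_diag; congr (_ *m (_ *m diag_mx _)).
  by apply/rowP => i; rewrite !mxE -expr2 sqr_sqrtr// ltW.
apply: spectral_norm_gram_le => [|x].
  by rewrite mulr_ge0// addr_ge0// exprn_ge0.
set z := U^T *m (Q *m x).
have LE : L *m x = diag_mx (\row_i Num.sqrt (lam i + mu)) *m z by rewrite /L -!mulmxA.
have -> : sqn (L *m x) = \sum_i (lam i + mu) * z i 0 ^+ 2.
  rewrite LE /sqn; apply: eq_bigr => i _.
  by rewrite diag_mx_col exprMn sqr_sqrtr// ltW.
have zx : sqn z <= sqn x.
  rewrite sqn_orth ?orthmx_tr//.
  have -> : sqn x = sqn (Q *m x) + sqn (Pi *m x).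
    rewrite !sqnE !trmx_mul QT PiT !mulmxA -(mulmxA _ Q Q) -(mulmxA _ Pi Pi) PiPi.
    have -> : Q *m Q = Q by rewrite {1}/Q mulmxBl mul1mx PiQ subr0.
    have e (M N : 'M[R]_1) : M 0 0 + N 0 0 = (M + N) 0 0 by rewrite mxE.
    by rewrite e -mulmxDl -mulmxDr /Q subrK mulmx1.
  by rewrite lerDl sqn_ge0.
apply: le_trans (_ : nu * (3 + y ^+ 2) * sqn z <= _); last first.
  by rewrite ler_wpM2l// mulr_ge0// addr_ge0// exprn_ge0.
apply: (@head_form_bound n lam mu nu rho y z k q m) => //.
pose w (i : 'I_n) : R := (lam i + mu) * lam i ^+ q * z i 0.
have := hw (\col_i w i).
under eq_bigr do rewrite mxE.
under [in X in (_ -> _ <= X) -> _]eq_bigr do rewrite mxE.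
apply.
have -> : \col_i w i = diag_mx (\row_i (lam i + mu)) *m (diag_mx (\row_i lam i ^+ q) *m z).
  by apply/colP => i; rewrite !diag_mx_col mxE /w mulrA.
have MT : (D *m A ^+ q *m X^T)^T = X *m A ^+ q *m D.
  have DT : D^T = D by rewrite DE !trmx_mul trmxK tr_diag_mx mulmxA.
  have AT : (A ^+ q)^T = A ^+ q by rewrite AE spectral_pow// !trmx_mul trmxK tr_diag_mx mulmxA.
  by rewrite !trmx_mul trmxK DT AT mulmxA.
have XE : X *m U *m (diag_mx (\row_i (lam i + mu)) *m (diag_mx (\row_i lam i ^+ q) *m z)) =
    X *m A ^+ q *m D *m (Q *m x).
  have dC : diag_mx (\row_i (lam i + mu)) *m diag_mx (\row_i lam i ^+ q) =
      diag_mx (\row_i lam i ^+ q) *m diag_mx (\row_i (lam i + mu)).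
    by rewrite !mulmx_diag; congr diag_mx; apply/rowP => i; rewrite !mxE mulrC.
  rewrite AE spectral_pow// DE /z; move: (diag_mx (\row_i (lam i + mu))) (diag_mx (\row_i lam i ^+ q)) dC => Dp Dq dC.
  by rewrite !mulmxA -(mulmxA _ U^T U) h1 mulmx1 -(mulmxA _ Dp Dq) dC !mulmxA.
(* The transposed sketched matrix factors through [Pi], and [Pi Q = 0]. *)
rewrite XE -MT; have /submxP[E ->] := PiM.
by rewrite PiT !mulmxA -(mulmxA E) PiQ mulmx0 mul0mx.
Qed.
End deterministic_bound.

(** * Measurability of the condition number *)

Section measurable_projector.
Variable R : realType.

(** [M] and [gram M] have the same kernel, so whatever [gram M] annihilates from the right is
    annihilated by [M]. *)
Lemma submx_gram a b (M : 'M[R]_(a, b)) : (M <= gram M)%MS.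
Proof.
rewrite submxE; apply/eqP/matrixP => i j.
have h : gram M *m col j (cokermx (gram M)) = 0 by rewrite colE mulmxA mulmx_coker mul0mx.
have := gram_kernel h; rewrite colE mulmxA -colE => /matrixP/(_ i 0).
by rewrite mxE => ->; rewrite !mxE.
Qed.

(** Tikhonov regularization: a rational function of the entries, hence measurable, from which the
    projector is recovered as a limit. *)
Definition ridge_inv n (K : 'M[R]_n) (e : R) := gram_inv (K + e%:M).

Lemma ridge_form a n (M : 'M[R]_(a, n)) (e : R) (x : 'cV[R]_n) :
  (x^T *m ((gram M + e%:M) *m x)) 0 0 = sqn (M *m x) + e * sqn x.
Proof.
have eD (N N' : 'M[R]_1) : (N + N') 0 0 = N 0 0 + N' 0 0 by rewrite mxE.
have eZ (c : R) (N : 'M[R]_1) : (c *: N) 0 0 = c * N 0 0 by rewrite mxE.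
rewrite mulmxDl mulmxDr mul_scalar_mx -scalemxAr eD eZ !sqnE; congr (_ 0 0 + _).
by rewrite /gram trmx_mul !mulmxA.
Qed.

Lemma ridge_unit a n (M : 'M[R]_(a, n)) (e : R) : 0 < e -> gram M + e%:M \in unitmx.
Proof.
move=> e0; apply: unitmx_kernel => x h; apply/eqP; rewrite -sqn_eq0.
have : sqn (M *m x) + e * sqn x = 0.
  rewrite -ridge_form.
  by rewrite h mulmx0 mxE.
move/eqP; rewrite paddr_eq0 ?sqn_ge0 ?mulr_ge0 ?sqn_ge0 ?(ltW e0)//.
by rewrite mulf_eq0 (gt_eqF e0)/= => /andP[].
Qed.

(** [v] solves [(M^T M + e) v = e x]; pairing with [v] gives [|M v|^2 + e |v|^2 = e <v, x>], so
    [|v|^2 <= <v, x>]. *)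
Lemma ridge_contraction a n (M : 'M[R]_(a, n)) (e : R) (x : 'cV[R]_n) : 0 < e ->
  sqn (e *: (ridge_inv (gram M) e *m x)) <= sqn x.
Proof.
move=> e0; have u := ridge_unit M e0; set v := _ *: _.
have hv : (gram M + e%:M) *m v = e *: x.
  by rewrite /v -scalemxAr mulmxA /ridge_inv gram_inv_unit// mulmxV// mul1mx.
have hd : sqn (M *m v) + e * sqn v = e * dot v x.
  transitivity ((v^T *m ((gram M + e%:M) *m v)) 0 0); last first.
    by rewrite hv -scalemxAr mxE dotE.
  exact/esym/ridge_form.
have vd : sqn v <= dot v x.
  rewrite -(ler_pM2l e0) -hd lerDr sqn_ge0.
  by [].
have [->|v0] := eqVneq (sqn v) 0; first exact: sqn_ge0.
have {}v0 : 0 < sqn v by rewrite lt_neqAle eq_sym v0 sqn_ge0.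
rewrite -(ler_pM2l v0); apply: le_trans (cauchy_schwarz v x).
by rewrite -expr2 lerXn2r ?nnegrE ?(ltW v0)// (le_trans (ltW v0)).
Qed.

Lemma sqn_coord n (x : 'cV[R]_n) i : x i 0 ^+ 2 <= sqn x.
Proof. by rewrite /sqn (bigD1 i)//= lerDl sumr_ge0// => j _; exact: sqr_ge0. Qed.

(** Writing [Pi = K L], the error is [Pi - (K + e)^-1 K = e (L - e (K + e)^-1 L)], and the
    contraction bounds the bracket independently of [e]. *)
Lemma projector_ridge n m (Pi : 'M[R]_n) (M : 'M[R]_(n, m)) i j :
  orthogonal_projector_onto_range Pi M -> exists C : R, forall e : R, 0 < e ->
  `|(ridge_inv (gram M^T) e *m gram M^T) i j - Pi i j| <= C * e.
Proof.
move=> [PiT PiPi /andP[/submxP[D0 PiM] /submxP[D1 MPi]]].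
set K := gram M^T.
have [L PiL] : exists L, Pi = K *m L.
  have /submxP[D2 MK] := submx_gram M^T.
  exists (D0 *m D2)^T; rewrite trmx_mul.
  have KT : K^T = K := gramT _.
  by rewrite -[LHS]trmxK PiM MK -/K 2!trmx_mul KT mulmxA.
have KPi : K *m Pi = K.
  rewrite /K /gram -mulmxA MPi; congr (_ *m _).
  by rewrite -mulmxA PiT PiPi.
exists (Num.sqrt (sqn (col j L)) + `|L i j|) => e e0.
have u := ridge_unit M^T e0; set G := ridge_inv K e.
have GK : G *m (K + e%:M) = 1%:M by rewrite /G /ridge_inv gram_inv_unit// mulVmx.
have GK1 : G *m K = 1%:M - e *: G.
  by rewrite -GK mulmxDr mul_mx_scalar addrK.
have GPi : e *: (G *m Pi) = Pi - G *m K.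
  rewrite -{2}[Pi]mul1mx -GK -[X in _ - G *m X]KPi -mulmxA -mulmxBr mulmxDl.
  by rewrite addrC addKr mul_scalar_mx -scalemxAr.
have hE : Pi - G *m K = e *: (L - e *: (G *m L)).
  by rewrite -GPi PiL mulmxA GK1 mulmxBl mul1mx -scalemxAl.
have := congr1 (fun N : 'M[R]_n => - N i j) hE; rewrite [X in - X = _]mxE [X in - (_ + X) = _]mxE opprB => ->.
rewrite normrN [X in `|X|]mxE normrM (gtr0_norm e0) mulrC ler_wpM2r ?(ltW e0)//.
rewrite [X in `|X|]mxE addrC; apply: le_trans (ler_normD _ _) _; rewrite lerD2r.
rewrite [X in `|X|]mxE normrN.
have -> : (e *: (G *m L)) i j = (e *: (G *m col j L)) i 0.
  by rewrite [LHS]mxE [RHS]mxE colE mulmxA -colE [in RHS]mxE.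
rewrite -sqrtr_sqr ler_wsqrtr//; apply: le_trans (sqn_coord _ i) _.
exact: ridge_contraction.
Qed.

(* [Pi] is the limit of [(K + e)^-1 K] with [K = M M^T], as [e] tends to 0. *)
Lemma mxmeas_projector d (O : measurableType d) n m (Pi : O -> 'M[R]_n) (M : O -> 'M[R]_(n, m)) :
  mxmeas M -> (forall w, orthogonal_projector_onto_range (Pi w) (M w)) -> mxmeas Pi.
Proof.
move=> mM hPi i j.
pose h (k : nat) (w : O) := (ridge_inv (gram (M w)^T) (k.+1%:R^-1) *m gram (M w)^T) i j.
have mg : mxmeas (fun w => gram (M w)^T).
  by apply: mxmeas_mul; [do 2 apply: mxmeas_tr|exact: mxmeas_tr].
apply: (@measurable_fun_cvg _ _ _ setT h) => [k|w _].
  have ma : mxmeas (fun w => gram (M w)^T + (k.+1%:R^-1)%:M).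
    by apply: mxmeas_add => //; exact: mxmeas_cst.
  apply: mxmeas_mul => //; apply: mxmeas_scale; last exact: mxmeas_adj.
  by apply: measurable_invr; exact: measurable_det.
have [C hC] := projector_ridge i j (hPi w).
apply/subr_cvg0; apply/norm_cvg0P.
have hC' : (fun k : nat => C * k.+1%:R^-1) @ \oo --> (0 : R).
  by rewrite -[X in _ --> X](mulr0 C); apply: cvgMr; exact: cvg_harmonic.
apply: (squeeze_cvgr _ (cvg_cst 0) hC').
by apply: nearW => k; rewrite normr_ge0/=; apply: hC; rewrite invr_gt0.
Qed.
End measurable_projector.

(** * The spectral norm as a countable supremum *)

Section measurable_spectral_norm.
Variable R : realType.

(** An enumeration of the points with rational coordinates: the code [j] carries integer numerators
    and a common denominator [N + 1]. *)
Definition grid_pt n (j : nat) : 'cV[R]_n :=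
  if (unpickle j : option (nat * 'cV[int]_n)) is Some (N, z)
  then \col_i ((z i 0)%:~R / N.+1%:R) else 0.

(** Coordinates are rounded towards 0, which keeps the approximations of a point of the unit ball
    inside the ball. *)
Lemma grid_dense n (x : 'cV[R]_n) : exists u : nat -> nat,
  (forall N i, `|grid_pt n (u N) i 0| <= `|x i 0|) /\
  (forall i, (fun N => grid_pt n (u N) i 0) @ \oo --> x i 0).
Proof.
pose z N : 'cV[int]_n := \col_i (sgz (x i 0) * (Num.truncn (`|x i 0| * N.+1%:R))%:Z).
exists (fun N => pickle (N, z N)).
have gE N i : grid_pt n (pickle (N, z N)) i 0 =
    Num.sg (x i 0) * ((Num.truncn (`|x i 0| * N.+1%:R))%:R / N.+1%:R).
  by rewrite /grid_pt pickleK !mxE intrM sgrEz mulrA.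
have tb N i : (Num.truncn (`|x i 0| * N.+1%:R))%:R <= `|x i 0| * N.+1%:R <
    (Num.truncn (`|x i 0| * N.+1%:R)).+1%:R by apply: truncn_itv; rewrite mulr_ge0.
have n0 N : 0 < N.+1%:R :> R by rewrite ltr0n.
have b2 N i : `|grid_pt n (pickle (N, z N)) i 0| <= `|x i 0|.
  rewrite gE normrM [X in _ * X]ger0_norm ?divr_ge0//.
  have := tb N i => /andP[+ _]; rewrite -ler_pdivrMr// => h.
  apply: le_trans h; rewrite ler_piMl ?divr_ge0//.
  by rewrite normr_sg lern1 leq_b1.
split=> // i; apply/subr_cvg0/norm_cvg0P.
apply: (squeeze_cvgr _ (cvg_cst 0) (@cvg_harmonic R)).
apply: nearW => N; rewrite normr_ge0/= gE.
set t := (Num.truncn _)%:R / _.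
have -> : Num.sg (x i 0) * t - x i 0 = Num.sg (x i 0) * (t - `|x i 0|).
  by rewrite mulrBr mulr_sg_norm.
rewrite normrM distrC; apply: (@le_trans _ _ (`| `|x i 0| - t|)).
  by rewrite ler_piMl// normr_sg lern1 leq_b1.
have /andP[t1 t2] := tb N i; rewrite ger0_norm ?subr_ge0 ?ler_pdivrMr//.
have : `|x i 0| <= (Num.truncn (`|x i 0| * N.+1%:R)).+1%:R / N.+1%:R.
  by rewrite ler_pdivlMr// ltW.
by rewrite -[in X in X -> _]natr1 mulrDl mul1r lerBlDl.
Qed.

Lemma enorm0 n : enorm (0 : 'cV[R]_n) = 0.
Proof. by rewrite /enorm big1 ?sqrtr0// => i _; rewrite mxE expr0n. Qed.

Lemma enorm_le1 n (x : 'cV[R]_n) : (enorm x <= 1) = (sqn x <= 1).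
Proof. by rewrite -[RHS]ler_sqrt// sqrtr1. Qed.

Lemma sqn_mulmx_bounded a n (S : 'M[R]_(a, n)) :
  exists C, forall x : 'cV[R]_n, enorm x <= 1 -> enorm (S *m x) <= C.
Proof.
exists (Num.sqrt (\sum_i sqn (row i S)^T)) => x; rewrite enorm_le1 => x1.
rewrite ler_wsqrtr// ler_sum// => i _.
have -> : (S *m x) i 0 = dot (row i S)^T x.
  by rewrite mxE; apply: eq_bigr => j _; rewrite !mxE.
apply: le_trans (cauchy_schwarz _ _) _.
by rewrite ler_piMr ?sqn_ge0.
Qed.

(** By continuity the rational points of the unit ball suffice. Grid points outside the ball are
    given the value 0, which does not affect the supremum, since the point 0 already has this
    value. *)
Lemma spectral_normE a n (S : 'M[R]_(a, n)) :
  spectral_norm S =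
  sups (fun j => if enorm (grid_pt n j) <= 1 then enorm (S *m grid_pt n j) else 0) 0.
Proof.
have [C hC] := sqn_mulmx_bounded S.
set h := fun j => _.
have C0 : 0 <= C.
  by apply: le_trans (hC 0 _); rewrite ?enorm_ge0// enorm0 ler01.
have hu : has_ubound (sdrop h 0).
  by exists C => _ [j _ <-]; rewrite /h; case: ifP => // /hC.
have su : has_ubound [set enorm (S *m x) | x in [set x : 'cV[R]_n | enorm x <= 1]].
  by exists C => _ [x /= x1 <-]; exact: hC.
apply/eqP; rewrite eq_le; apply/andP; split; last first.
  apply: ge_sup; first by exists (h 0%N), 0%N.
  move=> _ [j _ <-]; rewrite /h; case: ifP => [j1|_].
    by apply: (ub_le_sup su); exists (grid_pt n j).
  by apply: (ub_le_sup su); exists 0; rewrite /= ?mulmx0 enorm0 ?ler01.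
apply: ge_sup.
  by exists 0, 0; rewrite /= ?mulmx0 enorm0 ?ler01.
move=> _ [x /= x1 <-].
have [u [u1 u2]] := grid_dense x.
have uh N : enorm (S *m grid_pt n (u N)) <= sups h 0.
  apply: (@ub_le_sup _ _ hu); exists (u N) => //; rewrite /h ifT//.
  apply: le_trans x1; rewrite ler_wsqrtr// ler_sum// => i _.
  by rewrite -[leLHS]real_normK ?num_real// -[leRHS]real_normK ?num_real// lerXn2r ?nnegrE.
have cvg_s (I : Type) (s : seq I) (f : I -> nat -> R) (g : I -> R) :
    (forall i, f i N @[N --> \oo] --> g i) ->
    (\sum_(i <- s) f i N) @[N --> \oo] --> \sum_(i <- s) g i.
  move=> fg; elim: s => [|i s IH].
    by under eq_fun do rewrite big_nil; rewrite big_nil; exact: cvg_cst.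
  by under eq_fun do rewrite big_cons; rewrite big_cons; exact: cvgD.
have cS : enorm (S *m grid_pt n (u N)) @[N --> \oo] --> enorm (S *m x).
  apply: (@cvg_comp _ _ _ (fun N => sqn (S *m grid_pt n (u N))) Num.sqrt _ (nbhs (sqn (S *m x)))).
    apply: (cvg_s) => i.
    have ci : (S *m grid_pt n (u N)) i 0 @[N --> \oo] --> (S *m x) i 0.
      under eq_fun do rewrite mxE; rewrite mxE; apply: (cvg_s) => j.
      by apply: cvgMr; exact: u2.
    by under eq_fun do rewrite expr2; rewrite expr2; exact: cvgM.
  exact: sqrt_continuous.
have cl : limn (fun N => enorm (S *m grid_pt n (u N))) = enorm (S *m x) by exact: cvg_lim cS.
by rewrite -cl; apply: limr_le; [exact: cvgP cS|exact: nearW].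
Qed.

Lemma measurable_spectral_norm d (O : measurableType d) a n (S : O -> 'M[R]_(a, n)) :
  mxmeas S -> measurable_fun setT (fun w => spectral_norm (S w)).
Proof.
move=> mS.
rewrite (_ : (fun w => _) = (fun w => sups (fun j => if enorm (grid_pt n j) <= 1 then
    enorm (S w *m grid_pt n j) else 0) 0)); last by apply/funext => w; exact: spectral_normE.
apply: (@measurable_fun_sups _ _ _ setT
  (fun j w => if enorm (grid_pt n j) <= 1 then enorm (S w *m grid_pt n j) else 0)) => [w _|j].
  have [C hC] := sqn_mulmx_bounded (S w); exists (Num.max C 0) => _ [j _ <-].
  by case: ifP => [/hC h|_]; rewrite le_max ?h ?lexx ?orbT.
case: (enorm (grid_pt n j) <= 1); last exact: measurable_cst.
apply: (@measurableT_comp _ _ _ _ _ _ (@Num.sqrt R) _ (fun w => sqn (S w *m grid_pt n j))).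
  by apply: continuous_measurable_fun; exact: sqrt_continuous.
by apply: measurable_sqn; apply: mxmeas_mul; [|exact: mxmeas_cst].
Qed.
End measurable_spectral_norm.

(** * Numerical constants and conclusion *)

Section numeric_bounds.
Variable R : realType.

(** From [1 - 1/6 <= exp(-1/6)] follows [e <= (6/5)^6], just below 3. *)
Lemma expR1_le3 : expR 1 <= 3 :> R.
Proof.
have h : expR (6^-1) <= 6 / 5 :> R.
  have := expR_ge1Dx (- 6^-1 : R); rewrite expRN => h.
  have e0 := expR_gt0 (6^-1 : R).
  rewrite -[leLHS]invrK -[leRHS]invrK lef_pV2 ?posrE ?invr_gt0//.
  by apply: le_trans h; lra.
have -> : 1 = 6%:R * 6^-1 :> R by rewrite divff.
rewrite expRM_natl; apply: (@le_trans _ _ ((6 / 5) ^+ 6)).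
  by rewrite lerXn2r ?nnegrE ?expR_ge0.
by rewrite !exprS expr0; lra.
Qed.

Lemma exprD1_le (x : R) m : 0 <= x -> m%:R * x <= 1 -> (1 + x) ^+ m <= 3.
Proof.
move=> x0 mx; apply: (@le_trans _ _ (expR x ^+ m)).
  by rewrite lerXn2r ?nnegrE ?expR_ge0 ?addr_ge0// expR_ge1Dx.
by rewrite -expRM_natl (le_trans _ expR1_le3)// ler_expR.
Qed.

(** From [m] to [m + 1] the base is multiplied by [(1 + 1/m) (1 + 2/(2m+1))], whose [m]-th power is
    at most [3 * 3], and 9 times the new base is at most [(2m+1) (2m+2)]. The base is chosen so that
    the comparison of moments is an equality for [k = 2m]. *)
Lemma factorial_lower m : (0 < m)%N ->
  6 * (m%:R * (2 * m%:R + 1) / 10) ^+ m <= ((2 * m)`!)%:R :> R.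
Proof.
elim: m => // -[_ _|m IH _]; first by rewrite expr1 muln1 (_ : 2`! = 2)%N//; lra.
have {}IH := IH isT.
set M : R := m.+1%:R in IH *.
have M1 : 1 <= M by rewrite ler1n.
have M0 : 0 < M by apply: lt_le_trans M1.
have -> : m.+2%:R = M + 1 :> R by rewrite /M natr1.
have -> : ((2 * m.+2)`!)%:R = (2 * M + 2) * ((2 * M + 1) * ((2 * m.+1)`!)%:R) :> R.
  rewrite mulnS !addSn add0n !factS !natrM; congr (_ * (_ * _)).
    by rewrite /M -addn2 natrD natrM.
  by rewrite /M -addn1 natrD natrM.
have p1 : (1 + M^-1) ^+ m.+1 <= 3.
  by apply: exprD1_le; rewrite ?invr_ge0 ?(ltW M0)// divff ?gt_eqF.
have p2 : (1 + 2 / (2 * M + 1)) ^+ m.+1 <= 3.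
  apply: exprD1_le; first by rewrite divr_ge0// addr_ge0// mulr_ge0// ltW.
  by rewrite -/M mulrA ler_pdivrMr; lra.
set f := M * (2 * M + 1) / 10 in IH *.
have f0 : 0 <= f by rewrite divr_ge0// mulr_ge0 ?(ltW M0)// addr_ge0// mulr_ge0// ltW.
have fE : (M + 1) * (2 * (M + 1) + 1) / 10 = f * ((1 + M^-1) * (1 + 2 / (2 * M + 1))).
  by rewrite /f; field; apply/andP; split; lra.
rewrite exprS {2}fE [(f * _) ^+ _]exprMn [((1 + M^-1) * _) ^+ _]exprMn.
set g := (M + 1) * _ / 10.
have g0 : 0 <= g by rewrite /g divr_ge0// mulr_ge0; lra.
have pq : (1 + M^-1) ^+ m.+1 * (1 + 2 / (2 * M + 1)) ^+ m.+1 <= 3 * 3.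
  apply: ler_pM => //; rewrite exprn_ge0// addr_ge0// ?invr_ge0 ?(ltW M0)//.
  by rewrite divr_ge0// addr_ge0// mulr_ge0// ltW.
have q0 : 0 <= (1 + M^-1) ^+ m.+1 * (1 + 2 / (2 * M + 1)) ^+ m.+1.
  rewrite mulr_ge0// exprn_ge0// addr_ge0// ?invr_ge0 ?(ltW M0)//.
  by rewrite divr_ge0// addr_ge0// mulr_ge0// ltW.
set P := _ * _ in pq q0; set Fm := f ^+ m.+1 in IH *.
have F0 : 0 <= Fm by rewrite exprn_ge0.
have -> : 6 * (g * (Fm * P)) = (6 * Fm) * (g * P) by ring.
rewrite [leRHS]mulrA [leRHS]mulrC; apply: ler_pM => //.
- by rewrite mulr_ge0.
- by rewrite mulr_ge0.
apply: le_trans (ler_wpM2l g0 pq) _; rewrite /g.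
by nra.
Qed.

(** After the factorial bound only the bases of the [m]-th powers are compared. For even [k] they
    are equal; for odd [k] the inequality follows from [2m <= n]. *)
Lemma moment_bound_numeric n k m : (0 < m)%N -> (k < n)%N -> (2 * m <= k.+1)%N -> (k <= 2 * m)%N ->
  (k + 2 * m)%:R ^+ m * (n - k + 2 * m)%:R ^+ m / ((2 * m)`!)%:R <=
  (40 * (n%:R / k.+1%:R)) ^+ m / 6 :> R.
Proof.
move=> m0 kn mk km.
have fl := factorial_lower m0.
set f := _ / 10 in fl.
have M1 : 1 <= m%:R :> R by rewrite ler1n.
have f0 : 0 < f by rewrite divr_gt0// mulr_gt0; lra.
have F0 : 0 < ((2 * m)`!)%:R :> R by rewrite ltr0n fact_gt0.
rewrite ler_pdivrMr// -exprMn.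
apply: (@le_trans _ _ ((40 * (n%:R / k.+1%:R)) ^+ m * f ^+ m)); last first.
  rewrite -mulrA ler_wpM2l ?exprn_ge0 ?mulr_ge0 ?divr_ge0//.
  by rewrite ler_pdivlMl.
rewrite -exprMn lerXn2r ?nnegrE ?mulr_ge0 ?divr_ge0 ?(ltW f0)//.
have [kE|kE] : k = (2 * m)%N \/ k.+1 = (2 * m)%N by lia.
  have -> : (n - k + 2 * m)%N = n by lia.
  have -> : (k + 2 * m)%:R = 4 * m%:R :> R by rewrite -natrM; congr _%:R; lia.
  have -> : k.+1%:R = 2 * m%:R + 1 :> R by rewrite kE -natr1 natrM.
  rewrite le_eqVlt; apply/orP; left; apply/eqP; rewrite /f; field.
  by lra.
have -> : (n - k + 2 * m)%:R = n%:R + 1 :> R by rewrite natr1; congr _%:R; lia.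
have -> : (k + 2 * m)%:R = 4 * m%:R - 1 :> R.
  by apply: (addIr 1); rewrite subrK natr1 -natrM; congr _%:R; lia.
have -> : k.+1%:R = 2 * m%:R :> R by rewrite kE natrM.
have -> : 40 * (n%:R / (2 * m%:R)) * f = 2 * n%:R * (2 * m%:R + 1).
  by rewrite /f; field; lra.
have nm : 2 * m%:R <= n%:R :> R by rewrite -natrM ler_nat; lia.
by nra.
Qed.

End numeric_bounds.

(** * From the sketch to the kernel estimate and the condition number *)

Section sketch_bounds.
Variable R : realType.

Lemma sketch_std_gauss d (O : measurableType d) (P : probability O R) l n
    (X : O -> 'M[R]_(l, n)) : (0 < l)%N -> gaussian_sketch P X ->
  std_gauss P (fun w => (Num.sqrt (l%:R^-1 : R))^-1 *: X w).
Proof.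
move=> l0 [mX hX iX]; set s := Num.sqrt _.
have s0 : 0 < s by rewrite sqrtr_gt0 invr_gt0 ltr0n.
split; first by apply: mxmeas_scale; [exact: measurable_cst|exact: mX].
move=> B mB.
pose B' (ij : 'I_l * 'I_n) : set R := (fun x => s^-1 * x) @^-1` B ij.1 ij.2.
have mB' ij : measurable (B' ij).
  have h : measurable_fun setT (fun x : R => s^-1 * x) by apply: measurable_funM.
  by have := h measurableT _ (mB ij.1 ij.2); rewrite setTI.
have -> : (fun w => s^-1 *: X w) @^-1` mx_box B =
    \bigcap_(ij in [set` [set: 'I_l * 'I_n]%SET]) ((fun w => X w ij.1 ij.2) @^-1` B' ij).
  apply/seteqP; split => w /= h; first by move=> ij _; have := h ij.1 ij.2; rewrite mxE.
  by move=> i j; rewrite mxE; apply: (h (i, j)); rewrite /= inE.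
rewrite (iX _ _ mB').
have e ij : P ((fun w => X w ij.1 ij.2) @^-1` B' ij) =
    (fine (normal_prob (0 : R) (1 : R) (B ij.1 ij.2)))%:E.
  rewrite (hX _ _ _ (mB' ij)).
  transitivity (normal_prob (0 : R) (1 : R) (B ij.1 ij.2)); last exact: (gamma_fin (mB ij.1 ij.2)).
  exact: normal_prob_scale s0 (mB ij.1 ij.2).
rewrite (eq_bigr _ (fun ij _ => e ij)) prodEFin; congr EFin; rewrite pair_big/=.
by apply: eq_bigl => ij; rewrite inE.
Qed.

(** Translates the block form into sums over indices. The size condition, with [l + 1], says that
    the complement of the span of [k - 1] columns has dimension at least [2m + 2]. *)
Lemma kernel_head_bound d (O : measurableType d) (P : probability O R) l n k m
    (Z : O -> 'M[R]_(l, n)) :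
  std_gauss P Z -> (0 < k)%N -> (k < n)%N -> (2 * m.+1 + k <= l.+1)%N ->
  exists rho : O -> R, [/\ measurable_fun setT rho, forall w, 0 <= rho w,
    (\int[P]_w (rho w)%:E <=
      ((k + 2 * m)%:R ^+ m * (n - k + 2 * m)%:R ^+ m / ((2 * m)`!)%:R)%:E)%E &
    {ae P, forall w, forall x : 'cV[R]_n, Z w *m x = 0 ->
      (\sum_(i < n | (i < k)%N) x i 0 ^+ 2) ^+ m <=
      rho w * (\sum_(i < n | ~~ (i < k)%N) x i 0 ^+ 2) ^+ m}].
Proof.
case: k => // k gZ _ kn kl.
have [t lE] : exists t, l = (2 * m.+1 + t)%N by exists (l - 2 * m.+1)%N; lia.
have [r nE] : exists r, n = (k + 1 + r)%N by exists (n - k.+1)%N; lia.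
have r0 : (0 < r)%N by lia.
have kt : (2 * m.+1 + k <= 2 * m.+1 + t)%N by lia.
subst l n.
have [rho [mrho rho0 irho hrho]] := gauss_kernel_bound gZ r0 kt.
exists rho; split => //.
  have e : (k + 1 + r - k.+1 = r)%N by lia.
  by rewrite e -[k.+1]addn1.
apply: filterS hrho => w hw x Zx; have := hw x Zx.
have -> : sqn (usubmx x) = \sum_(i < k + 1 + r | (i < k.+1)%N) x i 0 ^+ 2.
  rewrite big_split_ord/= [X in _ = _ + X]big1 ?addr0; last first.
    by move=> i h; exfalso; lia.
  by apply: eq_big => [i|i _]; [rewrite -[k.+1]addn1 ltn_ord|rewrite mxE].
have -> : sqn (dsubmx x) = \sum_(i < k + 1 + r | ~~ (i < k.+1)%N) x i 0 ^+ 2.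
  rewrite big_split_ord/= [X in _ = X + _]big1 ?add0r; last first.
    by move=> i; rewrite -[k.+1]addn1 (ltn_ord i).
  by apply: eq_big => [i|i _]; [rewrite -[k.+1]addn1 -leqNgt leq_addr|rewrite mxE].
by [].
Qed.

Lemma spectral_data n (A : 'M[R]_n) (mu : R) (lambda : n.-tuple R) :
  sym_posdef (A + mu%:M) -> eigenvalues_decr_magnitude A lambda ->
  exists U : 'M[R]_n, [/\ orthmx U,
    A = U *m diag_mx (\row_i nth 0 lambda i) *m U^T &
    forall i : 'I_n, 0 < nth 0 lambda i + mu].
Proof.
move=> [sA pA] [cA _].
have AT : A^T = A.
  by apply: (addIr mu%:M); rewrite -[RHS]sA raddfD /= tr_scalar_mx.
have [U oU AE] := real_spectral AT cA; have [h1 h2] := orthmxP oU.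
exists U; split=> // i.
pose e : 'cV[R]_n := delta_mx i 0.
have eE : e^T *m e = 1%:M.
  apply/matrixP => a b; rewrite !ord1 mxE (bigD1 i)//= big1 ?addr0.
    by rewrite !mxE !eqxx mulr1.
  by move=> j ji; rewrite !mxE (negPf ji) mul0r.
have UU : U^T *m (U *m e) = e by rewrite mulmxA h1 mul1mx.
have Ue0 : U *m e != 0.
  apply/eqP => Ue; move/matrixP/(_ 0 0): eE; rewrite -UU Ue !mulmx0 !mxE => /eqP.
  by rewrite eq_sym oner_eq0.
have := pA _ Ue0.
have -> : (U *m e)^T *m (A + mu%:M) *m (U *m e) =
    e^T *m (diag_mx (\row_i nth 0 lambda i) *m e) + mu%:M.
  rewrite mulmxDr mulmxDl {1}AE trmx_mul -!mulmxA !UU; congr (_ + _).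
    by congr (_ *m _); rewrite mulmxA h1 mul1mx.
  by rewrite mul_scalar_mx -!scalemxAr UU eE scalemx1.
rewrite mxE [X in _ + X]mxE eqxx mulr1n -dotE /dot (bigD1 i)//= big1 ?addr0.
  by rewrite diag_mx_col !mxE !eqxx mul1r mulr1.
by move=> j ji; rewrite mxE (negPf ji) mul0r.
Qed.

Lemma sorted_magnitude n (lambda : n.-tuple R) i j :
  sorted (fun x y : R => `|y| <= `|x|) lambda -> (i <= j)%N -> (j < n)%N ->
  `|nth 0 lambda j| <= `|nth 0 lambda i|.
Proof.
move=> sl ij jn.
apply: (sorted_leq_nth (leT := fun x y : R => `|y| <= `|x|)) => //.
- by move=> y x z h1 h2; apply: le_trans h2 h1.
- by rewrite inE size_tuple (leq_ltn_trans ij).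
- by rewrite inE size_tuple.
Qed.

Lemma condition_bound n l d q (A Pi U : 'M[R]_n) (mu rho y : R) (lambda : n.-tuple R)
    (X : 'M[R]_(l, n)) m :
  let nu := nth 0 lambda n.-1 + mu in
  0 <= mu -> orthmx U -> A = U *m diag_mx (\row_i nth 0 lambda i) *m U^T ->
  (forall i : 'I_n, 0 < nth 0 lambda i + mu) ->
  sorted (fun x y : R => `|y| <= `|x|) lambda ->
  (0 < d <= n)%N -> `|nth 0 lambda d.-1| <= nu ->
  orthogonal_projector_onto_range Pi ((A + mu%:M) *m A ^+ q *m X^T) ->
  (0 < m)%N -> 0 <= rho -> 1 <= y -> (9 / 4) ^+ m * rho <= y ^+ ((4 * q + 4) * m) ->
  (forall w : 'cV[R]_n, X *m U *m w = 0 ->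
    (\sum_(i < n | (i < d.-1)%N) w i 0 ^+ 2) ^+ m <=
    rho * (\sum_(i < n | ~~ (i < d.-1)%N) w i 0 ^+ 2) ^+ m) ->
  Num.sqrt (spectral_norm ((1%:M - Pi) *m (A + mu%:M) *m (1%:M - Pi)) / nu) <= 1 + y.
Proof.
move=> nu mu0 oU AE lam0 sl /andP[d0 dn] ld hPi m0 rho0 y1 hy hw.
have n0 : (0 < n)%N := leq_trans d0 dn.
have n1 : (n.-1 < n)%N by rewrite prednK.
have nu0 : 0 < nu := lam0 (Ordinal n1).
have tl i : (d.-1 <= i)%N -> (i < n)%N -> `|nth 0 lambda i| <= nu.
  by move=> di iN; apply: le_trans ld; exact: sorted_magnitude.
(* [mu = nu - lambda_n], and [|lambda_n| <= |lambda_d| <= nu] by the ordering. *)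
have munu : mu <= 2 * nu.
  have dn1 : (d.-1 <= n.-1)%N by rewrite -ltnS !prednK.
  have h := tl n.-1 dn1 n1.
  have := ler_norm (- nth 0 lambda n.-1); rewrite normrN => h'.
  have e : mu = nu - nth 0 lambda n.-1 by rewrite /nu; ring.
  by rewrite e mulr_natl mulr2n lerD2l (le_trans h' h).
have y0 : 0 <= y := le_trans ler01 y1.
have := projected_norm_bound oU AE lam0 hPi mu0 rho0 y0 m0 munu (fun i di => tl i di (ltn_ord i)) hy hw.
set S := spectral_norm _ => hS.
rewrite -[leRHS]ger0_norm ?addr_ge0// -sqrtr_sqr ler_wsqrtr// ler_pdivrMr//.
(* What remains is [3 + y^2 <= (1 + y)^2], which is [1 <= y]. *)
by apply: le_trans hS _; rewrite mulrC ler_pM2r//; nra.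
Qed.
End sketch_bounds.

Lemma bernoulli (R : realDomainType) (x : R) N : -1 <= x -> 1 + N%:R * x <= (1 + x) ^+ N.
Proof.
move=> x1; elim: N => [|N IH]; first by rewrite mul0r addr0 expr0.
have x0 : 0 <= 1 + x by rewrite addrC -lerBlDr sub0r.
rewrite exprS; apply: le_trans (ler_wpM2l x0 IH).
rewrite -natr1 -subr_ge0 [X in 0 <= X](_ : _ = N%:R * x ^+ 2); last by ring.
by rewrite mulr_ge0 ?sqr_ge0.
Qed.

Lemma ratio_ge1 (R : realType) n d : (0 < d <= n)%N -> 1 <= n%:R / d%:R :> R.
Proof. by move=> /andP[d0 dn]; rewrite ler_pdivlMr ?ltr0n// mul1r ler_nat. Qed.

Lemma sketch_size (R : realType) d l : 24 / 10 * d%:R + 4 <= l%:R :> R -> (2 * d + 4 <= l)%N.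
Proof. by rewrite -(@ler_nat R) natrD natrM => h; have := ler0n R d; lra. Qed.

(** Here [9/4 * 40 = 90], and the division by 6 together with the margin up to 148 absorbs the added
    1. In the second bound [1440 = 40 * 36]: from [6^d <= 6^(2m+1)] one factor 6 cancels the
    division by 6 and [36^m] remains. *)
Lemma moment_constants (R : realType) (x B : R) m d : 1 <= x -> (0 < m)%N -> (d <= (2 * m).+1)%N ->
  0 <= B -> B <= (40 * x) ^+ m / 6 ->
  1 + (9 / 4) ^+ m * B <= (148 * x) ^+ m /\ B <= 6 ^- d * (1440 * x) ^+ m.
Proof.
move=> x1 m0 dm B0 hB; split.
  have h : (9 / 4) ^+ m * B <= (90 * x) ^+ m / 6.
    apply: le_trans (ler_wpM2l _ hB) _; first by rewrite exprn_ge0.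
    rewrite mulrA -exprMn (_ : 9 / 4 * (40 * x) = 90 * x) ?lexx//.
    by field.
  have h1 : 90 <= (90 * x) ^+ m.
    apply: (@le_trans _ _ (90 * x)); first by rewrite ler_pMr.
    by rewrite -[leLHS]expr1 ler_eXn2l//; lra.
  have h2 : (90 * x) ^+ m <= (148 * x) ^+ m by rewrite lerXn2r ?nnegrE; lra.
  by lra.
rewrite mulrC ler_pdivlMr ?exprn_gt0//.
apply: (@le_trans _ _ ((40 * x) ^+ m / 6 * 6 ^+ (2 * m).+1)).
  by apply: ler_pM => //; rewrite ?exprn_ge0// ler_eXn2l// ltr1n.
rewrite exprS exprM (_ : 1440 * x = 40 * x * 6 ^+ 2); last by ring.
rewrite [leRHS]exprMn le_eqVlt; apply/orP; left; apply/eqP; by field.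
Qed.

(** By Bernoulli's inequality the tangent of the [N]-th root at [a ^+ N] lies above the root. It is
    evaluated at [1 + c] rather than [c], which also gives [1 <= y]. *)
Lemma tangent_root (R : realFieldType) (a c : R) N : 0 < a -> (0 < N)%N -> 0 <= c ->
  let y := a * (1 + ((1 + c) / a ^+ N - 1) / N%:R) in 1 <= y /\ c <= y ^+ N.
Proof.
move=> a0 N0 c0 y.
have N0' : 0 < N%:R :> R by rewrite ltr0n.
have N1 : 1 <= N%:R :> R by rewrite ler1n.
have aN0 : 0 < a ^+ N by rewrite exprn_gt0.
set t := (1 + c) / a ^+ N in y *.
have t0 : 0 <= t by rewrite divr_ge0 ?(ltW aN0)// addr_ge0.
have u1 : -1 <= (t - 1) / N%:R by rewrite ler_pdivlMr//; lra.
have y0 : 0 <= y by rewrite mulr_ge0 ?(ltW a0)//; lra.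
have yN : 1 + c <= y ^+ N.
  rewrite /y exprMn -ler_pdivrMl//.
  have := bernoulli N u1.
  by rewrite mulrC divfK ?gt_eqF// addrC subrK [X in X <= _ -> _]mulrC.
split; last by apply: le_trans yN; rewrite lerDr.
rewrite -(@ler_pXn2r _ N) ?nnegrE ?expr1n//.
by apply: le_trans yN; rewrite lerDl.
Qed.

(** * Expectation and tail from the moment bound *)

Section condition_number_bounds.
Variable R : realType.
Context d (O : measurableType d) (P : probability O R).
Variables (T rho : O -> R) (B : R).
Hypotheses (mT : measurable_fun setT T) (T0 : forall w, 0 <= T w).
Hypotheses (mrho : measurable_fun setT rho) (rho0 : forall w, 0 <= rho w).
Hypothesis irho : (\int[P]_w (rho w)%:E <= B%:E)%E.

Let mrhoE : measurable_fun setT (fun w => (rho w)%:E).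
Proof. exact/measurable_EFinP. Qed.

Let rhoE0 w : (0 <= (rho w)%:E)%E.
Proof. by rewrite lee_fin. Qed.

(* The tangent of the [N]-th root at [a ^+ N] is affine in [rho], hence can be
   integrated. *)
Lemma expectation_root_bound (a e : R) N : 0 < a -> (0 < N)%N -> 0 <= e ->
  1 + e * B <= a ^+ N ->
  {ae P, forall w, forall y : R, 1 <= y -> e * rho w <= y ^+ N -> T w <= 1 + y} ->
  (\int[P]_w (T w)%:E <= (1 + a)%:E)%E.
Proof.
move=> a0 N0 e0 eB hT.
have N0' : 0 < N%:R :> R by rewrite ltr0n.
have aN0 : 0 < a ^+ N by rewrite exprn_gt0.
pose al := 1 + a * (1 + ((1 + 0) / a ^+ N - 1) / N%:R).
pose be := a * (e / a ^+ N / N%:R).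
have be0 : 0 <= be by rewrite mulr_ge0 ?(ltW a0)// divr_ge0 ?(ltW N0')// divr_ge0 ?(ltW aN0).
have al0 : 0 <= al.
  by have [h _] := tangent_root a0 N0 (lexx 0); rewrite addr_ge0// (le_trans ler01 h).
have lin r : al + be * r = 1 + a * (1 + ((1 + e * r) / a ^+ N - 1) / N%:R).
  by rewrite /al /be; field; rewrite !gt_eqF.
have Tle : {ae P, forall w, T w <= al + be * rho w}.
  apply: filterS hT => w hw; rewrite lin.
  have [y1 yN] := tangent_root a0 N0 (mulr_ge0 e0 (rho0 w)).
  exact: hw.
apply: (@le_trans _ _ (\int[P]_w (al%:E + be%:E * (rho w)%:E))%E).
  apply: ae_ge0_le_integral => //.
  + by move=> w _; rewrite lee_fin.
  + exact/measurable_EFinP.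
  + by move=> w _; rewrite -EFinM -EFinD lee_fin addr_ge0// mulr_ge0.
  + by apply: emeasurable_funD => //; apply: emeasurable_funM.
  + by apply: filterS Tle => w hw _; rewrite -EFinM -EFinD lee_fin.
have mbe : measurable_fun setT (fun w => (be%:E * (rho w)%:E)%E).
  by apply: emeasurable_funM => //; exact: measurable_cst.
have berho0 w : (0 <= be%:E * (rho w)%:E)%E by rewrite -EFinM lee_fin mulr_ge0.
rewrite (@ge0_integralD _ _ _ P _ measurableT (fun=> al%:E) _ (fun _ _ => _) _ (fun w _ => berho0 w) mbe); last 2 first.
- by rewrite lee_fin.
- exact: measurable_cst.
rewrite (integral_prob_cst P) (ge0_integralZl P measurableT mrhoE (fun w _ => rhoE0 w)) ?lee_fin//.
apply: (@le_trans _ _ (al%:E + be%:E * B%:E)%E).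
  by apply: leeD2l; apply: lee_wpmul2l; rewrite ?lee_fin.
rewrite -EFinM -EFinD lee_fin lin.
rewrite lerD2l ler_piMr ?(ltW a0)// gerDl ler_pdivrMr// mul0r subr_le0.
by rewrite ler_pdivrMr// mul1r.
Qed.

Lemma tail_bound (c y delta : R) : 0 < c -> B <= delta * c ->
  {ae P, forall w, rho w <= c -> T w <= y} ->
  ((1 - delta)%:E <= P [set w | (T w <= y)%R])%E.
Proof.
move=> c0 Bc hT; set E := [set w | _].
have mE : measurable E.
  rewrite (_ : E = setT `&` T @^-1` `]-oo, y]%classic); first exact: mT.
  by rewrite setTI; apply/seteqP; split => w /=; rewrite in_itv.
have ci0 : 0 <= c^-1 by rewrite invr_ge0 ltW.
have PC : (P (~` E) <= delta%:E)%E.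
  rewrite (measure_int_indic P (measurableC mE)).
  apply: (@le_trans _ _ (\int[P]_w ((c^-1)%:E * (rho w)%:E))%E).
    apply: ae_ge0_le_integral => //.
    + by apply/measurable_EFinP; apply: measurable_indic; exact: measurableC.
    + by move=> w _; rewrite -EFinM lee_fin mulr_ge0.
    + by apply: emeasurable_funM => //; exact: measurable_cst.
    apply: filterS hT => w hw _; rewrite -EFinM lee_fin indicE.
    have [wE|] := boolP (w \in ~` E); last by rewrite mulr_ge0.
    rewrite ler_pdivlMl// mulr1 leNgt; apply/negP => rc.
    by move: wE; rewrite inE; apply; apply: hw; exact: ltW.
  rewrite (ge0_integralZl P measurableT mrhoE (fun w _ => rhoE0 w)) ?lee_fin//.
  apply: (@le_trans _ _ ((c^-1)%:E * B%:E)%E); first by apply: lee_wpmul2l; rewrite ?lee_fin.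
  by rewrite -EFinM lee_fin ler_pdivrMl// mulrC.
rewrite -[E]setCK probability_setC; last exact: measurableC.
by rewrite EFinB; apply: leeB.
Qed.
End condition_number_bounds.

Lemma powR_root_ge1 (R : realType) (x : R) p : 1 <= x -> 1 <= x `^ p%:R^-1.
Proof. by move=> x1; rewrite -[leLHS](powRr0 x); apply: ler_powR; rewrite ?invr_ge0. Qed.

Lemma powR_root_exp (R : realType) (x : R) p m : (0 < p)%N -> 0 <= x ->
  (x `^ p%:R^-1) ^+ (p * m) = x ^+ m.
Proof.
move=> p0 x0; rewrite exprM; congr (_ ^+ m).
by rewrite -powR_mulrn ?powR_ge0// -powRrM mulVf ?pnatr_eq0 -?lt0n// powRr1.
Qed.

(* For [d = 1] the head is empty and [rho = 0] is admissible. *)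
Lemma sketch_kernel_ratio (R : realType) d' (O : measurableType d') (P : probability O R)
    (l n d : nat) (Z : O -> 'M[R]_(l, n)) :
  std_gauss P Z -> (0 < d <= n)%N -> (2 * d + 4 <= l)%N ->
  exists (m : nat) (rho : O -> R) (B : R),
  [/\ (0 < m)%N, measurable_fun setT rho, forall w, 0 <= rho w,
    [/\ (\int[P]_w (rho w)%:E <= B%:E)%E,
      1 + (9 / 4) ^+ m * B <= (148 * (n%:R / d%:R)) ^+ m
      & B <= 6 ^- d * (1440 * (n%:R / d%:R)) ^+ m] &
    {ae P, forall w, forall v : 'cV[R]_n, Z w *m v = 0 ->
      (\sum_(i < n | (i < d.-1)%N) v i 0 ^+ 2) ^+ m <=
      rho w * (\sum_(i < n | ~~ (i < d.-1)%N) v i 0 ^+ 2) ^+ m}].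
Proof.
move=> gZ dn dl; have x1 := ratio_ge1 R dn.
case: d dn dl x1 => // -[|k] /andP[_ kn] dl x1.
  have [b1 b2] := moment_constants x1 (isT : (0 < 1)%N) (isT : (1 <= 3)%N) (lexx 0)
    (divr_ge0 (exprn_ge0 1 (mulr_ge0 (ler0n R 40) (le_trans ler01 x1))) (ler0n R 6)).
  exists 1%N, (fun=> 0), 0; split.
  - by [].
  - exact: measurable_cst.
  - by move=> w; exact: lexx.
  - by split; [rewrite integral0|exact: b1|exact: b2].
  - by apply: aeW => w v _; rewrite big_pred0// expr1 mul0r.
(* Half of [d - 1], rounded up: the least exponent with [d <= 2m + 1], as the tail bound requires,
   while [2m <= d] keeps [2m + 2] dimensions available for the negative moment. *)
pose m := uphalf k.+1.
have [m0 mk km kl] : [/\ (0 < m)%N, (2 * m <= k.+2)%N, (k.+1 <= 2 * m)%N &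
    (2 * m.+1 + k.+1 <= l.+1)%N] by rewrite /m; split; lia.
have [rho [mrho rho0 irho hrho]] := kernel_head_bound gZ (ltn0Sn k) kn kl.
have b := moment_bound_numeric R m0 kn mk km.
have B0 : 0 <= (k.+1 + 2 * m)%:R ^+ m * (n - k.+1 + 2 * m)%:R ^+ m / ((2 * m)`!)%:R :> R.
  by rewrite divr_ge0 ?mulr_ge0 ?exprn_ge0.
have [b1 b2] := moment_constants x1 m0 (km : (k.+2 <= (2 * m).+1)%N) B0 b.
exists m, rho, ((k.+1 + 2 * m)%:R ^+ m * (n - k.+1 + 2 * m)%:R ^+ m / ((2 * m)`!)%:R).
by split; [exact: m0|exact: mrho|exact: rho0|split; [exact: irho|exact: b1|exact: b2]|exact: hrho].
Qed.

(* The eigenvalues are ordered by magnitude, so the tail threshold is read as a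
   bound on the magnitude of lambda_d. For lambda_d >= 0 this is exactly
   lambda_d <= lambda_n + mu. For lambda_d < 0 the unsigned reading is needed:
   with n = 10, d = 1, l = 7, mu = 1 and the spectrum -0.99, 0.95 (8 times),
   -0.9, one always has T >= sqrt 19.5, but the bounds tend to 2 as q grows. *)
Theorem proposition6p6 (R : realType) (n l d q : nat)
    (A : 'M[R]_n) (mu : R) (lambda : n.-tuple R)
    (disp : measure_display) (Omega : measurableType disp)
    (P : probability Omega R)
    (X : Omega -> 'M[R]_(l, n)) (Pi : Omega -> 'M[R]_n) :
  let A_mu : 'M[R]_n := A + mu%:M in
  let lambda_d : R := nth 0 lambda d.-1 in
  let lambda_n : R := nth 0 lambda n.-1 in
  let T : Omega -> R := fun w =>
    Num.sqrt (spectral_norm ((1%:M - Pi w) *m A_mu *m (1%:M - Pi w))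
              / (lambda_n + mu)) in
  0 <= mu ->
  sym_posdef A_mu ->
  eigenvalues_decr_magnitude A lambda ->
  (0 < d <= n)%N ->
  `|lambda_d| <= lambda_n + mu ->
  24 / 10 * d%:R + 4 <= l%:R :> R ->
  gaussian_sketch P X ->
  (forall w, orthogonal_projector_onto_range (Pi w)
               (A_mu *m A ^+ q *m (X w)^T)) ->
  ('E_P[T] <= (1 + (148 * (n%:R / d%:R)) `^ (4 * q + 4)%:R^-1)%R%:E)%E /\
  ((1 - 6 ^- d)%R%:E <=
     P [set w | (T w <= 1 + (3240 * (n%:R / d%:R)) `^ (4 * q + 4)%:R^-1)%R])%E.
Proof.
move=> A_mu lambda_d lambda_n T mu0 pA eig dn ld ldl gX hPi.
have [U [oU AE lam0]] := spectral_data pA eig; have sl := eig.2.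
have ld2 : (2 * d + 4 <= l)%N := sketch_size ldl.
have gZ := std_gauss_mulr oU (sketch_std_gauss (leq_trans (ltn_addl _ (isT : (0 < 4)%N)) ld2) gX).
have mPi : mxmeas Pi.
  apply: (mxmeas_projector _ hPi); apply: mxmeas_mul; first exact: mxmeas_cst.
  by apply: mxmeas_tr; have [mX _ _] := gX; exact: mX.
have mT : measurable_fun setT T.
  have mQ : mxmeas (fun w => 1%:M - Pi w).
    by apply: mxmeas_add; [exact: mxmeas_cst|exact: mxmeas_opp].
  have mS : mxmeas (fun w => (1%:M - Pi w) *m A_mu *m (1%:M - Pi w)).
    by apply: mxmeas_mul => //; apply: mxmeas_mul => //; exact: mxmeas_cst.
  apply: (@measurableT_comp _ _ _ _ _ _ (@Num.sqrt R)).
    by apply: continuous_measurable_fun; exact: sqrt_continuous.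
  by apply: measurable_funM; [exact: measurable_spectral_norm|exact: measurable_cst].
have T0 w : 0 <= T w by exact: sqrtr_ge0.
have [m [rho [B [m0 mrho rho0 [irho B1 B2] hrho]]]] := sketch_kernel_ratio gZ dn ld2.
have x1 := ratio_ge1 R dn; set x : R := n%:R / d%:R in B1 B2 x1 *.
have x0 : 0 < x := lt_le_trans ltr01 x1.
set p := (4 * q + 4)%N.
have p0 : (0 < p)%N by rewrite /p addnS.
have N0 : (0 < p * m)%N by rewrite muln_gt0 p0.
have cx0 (c : nat) : 0 <= c%:R * x by rewrite mulr_ge0// ltW.
have cx1 (c : nat) : (0 < c)%N -> 1 <= c%:R * x.
  by move=> c0; rewrite -[leLHS]mulr1 ler_pM// ler1n.
have e0 : 0 <= (9 / 4) ^+ m :> R by rewrite exprn_ge0// divr_ge0.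
(* One null set serves all [y], so that [y] may depend on [w] in the expectation bound and be
   constant in the tail bound. *)
have hT : {ae P, forall w, forall y : R, 1 <= y ->
    (9 / 4) ^+ m * rho w <= y ^+ (p * m) -> T w <= 1 + y}.
  apply: filterS hrho => w hw y y1 hy.
  apply: (condition_bound mu0 oU AE lam0 sl dn ld (hPi w) m0 (rho0 w) y1 hy) => v Xv.
  by apply: hw; rewrite -!scalemxAl Xv scaler0.
split.
  rewrite unlock.
  have a1 := powR_root_ge1 p (cx1 148%N isT).
  apply: (expectation_root_bound mT T0 mrho rho0 irho (lt_le_trans ltr01 a1) N0 e0 _ hT).
  by rewrite (powR_root_exp m p0 (cx0 148%N)).
have c0 : 0 < (1440 * x) ^+ m.
  by apply: exprn_gt0; exact: lt_le_trans ltr01 (cx1 1440%N isT).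
apply: (tail_bound mT mrho rho0 irho c0 B2).
apply: filterS hT => w hw rc; apply: hw.
  exact: powR_root_ge1 (cx1 3240%N isT).
rewrite (powR_root_exp m p0 (cx0 3240%N)).
have -> : 3240%:R * x = 9 / 4 * (1440 * x) by field.
by rewrite [leRHS]exprMn; apply: ler_wpM2l.
Qed.
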